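(* (Gamma theorem for $\mathcal F_\lambda$.) Let $\tilde\kappa=1$. The leading term of the asymptotics of the $q$-hypergeometric solutions $\bigl(\hat\Psi^\circ_I(z;p;\tilde\kappa)\bigr)_{I\in\mathcal I_\lambda}$ as $p_i/p_{i+1}\to0$, $i=1,\dots,N-1$, is the product of the equivariant gamma class of $\mathcal F_\lambda$ and the exponentials of the equivariant first Chern classes of the associated vector bundles $E_1,\dots,E_N$: $$\hat\Gamma_{\mathcal F_\lambda}\ \prod_{i=1}^N\bigl(e^{\pi\sqrt{-1}(\lambda_i-n)}\,p_i\bigr)^{c_1(E_i)};$$ that is, for every $I\in\mathcal I_\lambda$ the leading term of $\hat\Psi^\circ_I$ is this class multiplied by $\Delta_I$ (equivalently, the value of this class at the fixed point $x_I$, given by $\{\gamma_{i,1},\dots,\gamma_{i,\lambda_i}\}=\{z_a:a\in I_i\}$, times $\Delta_I$).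
   Context: Fix positive integers $N,n$ and $\tilde\kappa\in\mathbb C^\times$. Let $\lambda=(\lambda_1,\dots,\lambda_N)\in\mathbb Z_{\ge0}^N$, $\lambda_1+\dots+\lambda_N=n$; $\lambda^{(i)}=\lambda_1+\dots+\lambda_i$, $\lambda^{\{1\}}=\sum_{i=1}^{N-1}\lambda^{(i)}$, $\lambda_{\{2\}}=\sum_{1\le i<j\le N}\lambda_i\lambda_j$. $\mathcal I_\lambda$ is the set of ordered partitions $I=(I_1,\dots,I_N)$ of $\{1,\dots,n\}$ with $|I_j|=\lambda_j$; $I^{i}=I_1\cup\dots\cup I_i=\{i^{(i)}_1<\dots<i^{(i)}_{\lambda^{(i)}}\}$. Empty products equal 1. Cohomology. $\mathcal F_\lambda$ is the variety of flags $0=F_0\subset\dots\subset F_N=\mathbb C^n$ with $\dim F_i/F_{i-1}=\lambda_i$; $A\subset GL_n(\mathbb C)$ is the diagonal torus. $E_i$ is the vector bundle with fiber $F_i/F_{i-1}$, with Chern roots $\gamma_{i,1},\dots,\gamma_{i,\lambda_i}$ and $c_1(E_i)=\sum_a\gamma_{i,a}$; $\Gamma$ denotes the collection of all $\gamma_{i,a}$, and $$H^*_A(\mathcal F_\lambda)=\mathbb C[\Gamma]^{S_{\lambda_1}\times\dots\times S_{\lambda_N}}\otimes\mathbb C[z]\Big/\Bigl\langle\prod_{i=1}^N\prod_{j=1}^{\lambda_i}(u-\gamma_{i,j})=\prod_{a=1}^n(u-z_a)\Bigr\rangle .$$ For $f$ symmetric in each group $\gamma_{i,\cdot}$, $f(z_J)$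 denotes the substitution $\{\gamma_{i,1},\dots,\gamma_{i,\lambda_i}\}=\{z_a:a\in J_i\}$ (restriction to the fixed point $x_J$). Classes are taken in $H^*_A(\mathcal F_\lambda)$ extended by functions of $z$ holomorphic on the domain $z_a-z_b\notin\tilde\kappa\mathbb Z$ ($a\ne b$); a holomorphic function of $\Gamma,z$ symmetric in each group represents the class with restrictions $f(z_J)$. The equivariant gamma class is $\hat\Gamma_{\mathcal F_\lambda}=\prod_{1\le i<j\le N}\prod_{a=1}^{\lambda_i}\prod_{b=1}^{\lambda_j}\Gamma(1+\gamma_{j,b}-\gamma_{i,a})$. $\Delta_I=\prod_{i<j}\prod_{a=1}^{\lambda_i}\prod_{b\in I_j}(\gamma_{i,a}-z_b)\Big/\prod_{i<j}\prod_{a\in I_i}\prod_{b\in I_j}(z_a-z_b)$ is the class with $\Delta_I(z_J)=\delta_{I,J}$. The functions $\hat\Psi^\circ_I$. Variables $t=(t^{(j)}_a)$, $1\le j\le N-1$, $1\le a\le\lambda^{(j)}$; $t^{(N)}_a=z_a$; $p=(p_1,\dots,p_N)$ with a fixed branch of each $\log p_i$. Let $$\Phi^\circ_\lambda(t;z;p;\tilde\kappa)=(e^{\pi\sqrt{-1}(\lambda_N-n)}p_N)^{\sum_{a=1}^n z_a/\tilde\kappa}\prod_{i=1}^{N-1}\Bigl(\frac{e^{\pi\sqrt{-1}(\lambda_i-\lambda_{i+1})}}{\tilde\kappa^{\lambda_i+\lambda_{i+1}}}\frac{p_i}{p_{i+1}}\Bigr)^{\sum_{j=1}^{\lambda^{(i)}}t^{(i)}_j/\tilde\kappa}\prod_{i=1}^{N-1}\prod_{a=1}^{\lambda^{(i)}}\Bigl(\prod_{b\ne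 a}\frac1{\Gamma\bigl((t^{(i)}_b-t^{(i)}_a)/\tilde\kappa\bigr)}\prod_{c=1}^{\lambda^{(i+1)}}\Gamma\bigl((t^{(i+1)}_c-t^{(i)}_a)/\tilde\kappa\bigr)\Bigr),$$ $b$ ranging over $1,\dots,\lambda^{(i)}$; powers are $(e^{\pi\sqrt{-1}m}p)^x=e^{x(\pi\sqrt{-1}m+\log p)}$, $\log(p_i/p_{i+1})=\log p_i-\log p_{i+1}$, with a fixed branch of $\log\tilde\kappa$. Let $$\hat W^\circ(t;\Gamma)=\prod_{i=1}^{N-1}\prod_{a=1}^{\lambda^{(i)}}\prod_{b=1}^{\lambda_{i+1}}(t^{(i)}_a-\gamma_{i+1,b}).$$ $\Sigma_I$ is the point $t^{(k)}_a=z_{i^{(k)}_a}$; $\mathrm{Res}_{t=s}$ is the iterated residue $\mathrm{Res}_{t^{(1)}_1=s^{(1)}_1}\cdots\mathrm{Res}_{t^{(N-1)}_{\lambda^{(N-1)}}=s^{(N-1)}_{\lambda^{(N-1)}}}$ (rightmost first). Then $$\hat\Psi^\circ_I(z;p;\tilde\kappa)=(-\tilde\kappa)^{-\lambda^{\{1\}}-\lambda_{\{2\}}}\ \tilde\kappa^{\,\sum_{i=1}^{N-1}\sum_{a\in I^i}(\lambda_i+\lambda_{i+1})z_a/\tilde\kappa}\sum_{r\in\mathbb Z_{\ge0}^{\lambda^{\{1\}}}}\mathrm{Res}_{t=\Sigma_I+r\tilde\kappa}\bigl(\Phi^\circ_\lambda(t;z;p;\tilde\kappa)\bigr)\,\hat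 W^\circ(\Sigma_I+r\tilde\kappa;\Gamma).$$ Each $\hat\Psi^\circ_I$ equals $\prod_{i=1}^N p_i^{\,\sum_{a\in I_i}z_a/\tilde\kappa}$ times a power series in $p_1/p_2,\dots,p_{N-1}/p_N$; its leading term is this factor times the constant term of the series. *)

(* Defs.v *)
From HB Require Import structures.
From mathcomp Require Import all_boot all_order all_algebra finmap.
From mathcomp Require Import complex.
From mathcomp Require Import all_classical all_reals all_analysis.
From mathcomp Require showcase.summability.

Set Implicit Arguments.
Unset Strict Implicit.
Unset Printing Implicit Defensive.

Import Order.TTheory GRing.Theory Num.Theory.
Import numFieldNormedType.Exports.

Local Open Scope classical_set_scope.
Local Open Scope ring_scope.

(* R[i] is used as the field of complex numbers; the alias R[i]^o carries its
   topology and its structure of normed module over itself. *)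

Section ComplexAnalysis.
Variable R : realType.
Local Notation C := (R[i]).

Definition Cexp (z : C) : C :=
  ((expR (complex.Re z))%:C * (cos (complex.Im z) +i* sin (complex.Im z)))%C.

Definition pi_i : C := (0 +i* pi)%C.

(* b `^ x for a base b given through a chosen logarithm L of it. *)
Definition Cpow (L x : C) : C := Cexp (x * L).

(* Euler-Gauss limit.  At the poles 0, -1, -2, ... all but finitely many terms
   are 0 (division by 0), so that Gamma takes the value 0 there and
   (Gamma z)^-1 is the entire function 1/Gamma at every z. *)
Definition Gamma (z : C) : C :=
  lim ((fun k : nat =>
    (k`!)%:R * Cpow ((ln (k%:R : R))%:C)%C z / \prod_(j < k.+1) (z + j%:R)
    : R[i]^o) @ \oo).

(* c is the coefficient of (u - s)^-1 in the Laurent expansion of f at s: near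
   s, f is the sum of a principal part and of a holomorphic function h. *)
Definition is_residue (f : C -> C) (s c : C) : Prop :=
  exists (k : nat) (a : nat -> C) (h : C -> C),
    [/\ a 0%N = c,
        \forall u \near (s : R[i]^o), derivable (h : R[i]^o -> R[i]^o) u 1
      & \forall u \near (s : R[i]^o)^',
          f u = h u + \sum_(j < k.+1) a j * (u - s) ^- j.+1].

Definition Residue (f : C -> C) (s : C) : C := xget 0 [set c | is_residue f s c].

(* The head of vs is the outermost residue, hence the last one taken. *)
Fixpoint iter_res (V : eqType) (vs : seq V) (F : (V -> C) -> C)
    (s t : V -> C) : C :=
  if vs is v :: vs' then
    Residue (fun u => iter_res vs' F s (fun w => if w == v then u else t w))
            (s v)
  else F t.

(* Sums over infinite index sets are unconditional: limits of finite partial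
   sums along the filter of finite subsets ordered by inclusion. *)
Definition has_sum (T : choiceType) (f : T -> C) (s : C) : Prop :=
  summability.partial_sum (f : T -> R[i]^o) @ summability.totally
    --> (s : R[i]^o).

Definition Csum (T : choiceType) (f : T -> C) : C :=
  summability.sum (f : T -> R[i]^o).

End ComplexAnalysis.

(* The number of blocks is N = M.+1.  Blocks are indexed by 'I_M.+1 (block i is
   the (i+1)-st one), the levels 1, ..., N-1 of the variables t by 'I_M. *)

Section Combinatorics.
Variables (M n : nat) (lam : 'I_M.+1 -> nat).

(* For a level i : 'I_M, the blocks number i+1 and i+2 of the usual
   one-based numbering. *)
Definition lo (i : 'I_M) : 'I_M.+1 := widen_ord (leqnSn M) i.
Definition hi (i : 'I_M) : 'I_M.+1 := lift ord0 i.

(* lambda^(k+1) *)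
Definition psum (k : nat) : nat := (\sum_(j < M.+1 | (j <= k)%N) lam j)%N.

(* lambda^{1} *)
Definition lam_up1 : nat := (\sum_(i < M) psum i)%N.

(* lambda_{2} *)
Definition lam_low2 : nat :=
  (\sum_(i < M.+1) \sum_(j < M.+1 | (i < j)%N) lam i * lam j)%N.

Definition is_opart (I : {ffun 'I_M.+1 -> {set 'I_n}}) : bool :=
  [&& [forall j, #|I j| == lam j],
      [forall i, forall j, (i != j) ==> [disjoint I i & I j]]
    & \big[@finset.setU _ / finset.set0]_j I j == finset.setTfor 'I_n].

Definition opart := {I : {ffun 'I_M.+1 -> {set 'I_n}} | is_opart I}.

Definition block (I : opart) (j : 'I_M.+1) : {set 'I_n} := val I j.

(* I^(k+1), the union of the first k+1 blocks *)
Definition upto (I : opart) (k : nat) : {set 'I_n} :=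
  \big[@finset.setU _ / finset.set0]_(j < M.+1 | (j <= k)%N) block I j.

Definition tvar := {i : 'I_M & 'I_(psum i)}.

Definition tv (i : 'I_M) (a : 'I_(psum i)) : tvar := existT _ i a.

(* t^(1)_1, t^(1)_2, ..., in lexicographic order *)
Definition tvars : seq tvar :=
  flatten [seq [seq tv a | a : 'I_(psum i) <- enum 'I_(psum i)]
          | i : 'I_M <- enum 'I_M].

End Combinatorics.

Section FlagVariety.
Variables (R : realType) (M n : nat) (lam : 'I_M.+1 -> nat).
Local Notation C := (R[i]).
Variable z : 'I_n -> C.

Definition roots_type := forall i : 'I_M.+1, 'I_(lam i) -> C.

(* Over the domain where the differences z_a - z_b do not vanish, a class is
   the same thing as the family of its restrictions to the fixed points x_J;
   classes multiply pointwise. *)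
Definition class := opart n lam -> C.

Definition fixed_point (J : opart n lam) : roots_type :=
  fun i a => nth 0 [seq z b | b <- enum (block J i)] a.

(* The class represented by a function of the Chern roots, symmetric in each
   group. *)
Definition Cls (f : roots_type -> C) : class := fun J => f (fixed_point J).

Definition c1 (g : roots_type) (i : 'I_M.+1) : C := \sum_(a < lam i) g i a.

Definition gamma_class (g : roots_type) : C :=
  \prod_(i < M.+1) \prod_(j < M.+1 | (i < j)%N)
    \prod_(a < lam i) \prod_(b < lam j) Gamma (1 + g j b - g i a).

Definition Delta (I : opart n lam) (g : roots_type) : C :=
  (\prod_(i < M.+1) \prod_(j < M.+1 | (i < j)%N)
     \prod_(a < lam i) \prod_(b in block I j) (g i a - z b)) /
  (\prod_(i < M.+1) \prod_(j < M.+1 | (i < j)%N)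
     \prod_(a in block I i) \prod_(b in block I j) (z a - z b)).

End FlagVariety.

Section Solutions.
Variables (R : realType) (M n : nat) (lam : 'I_M.+1 -> nat).
Local Notation C := (R[i]).
(* logk and logp are the chosen branches of log kappa and of the log p_i. *)
Variables (kappa logk : C) (z : 'I_n -> C) (logp : 'I_M.+1 -> C).

(* The values of the variables of level k+1; the level N consists of the z_a. *)
Definition level (t : tvar lam -> C) (k : nat) : seq C :=
  if insub k is Some i
  then [seq t (@tv M lam i a) | a <- enum 'I_(psum lam i)]
  else [seq z a | a <- enum 'I_n].

Definition Phi (t : tvar lam -> C) : C :=
  Cpow (pi_i R * ((lam ord_max)%:R - n%:R) + logp ord_max)
       ((\sum_(a < n) z a) / kappa)
  * (\prod_(i < M)
       Cpow (pi_i R * ((lam (lo i))%:R - (lam (hi i))%:R)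
             - (lam (lo i) + lam (hi i))%:R * logk
             + (logp (lo i) - logp (hi i)))
            ((\sum_(a < psum lam i) t (tv a)) / kappa))
  * \prod_(i < M) \prod_(a < psum lam i)
      ((\prod_(b < psum lam i | b != a)
          (Gamma ((t (tv b) - t (tv a)) / kappa))^-1)
       * \prod_(c <- level t i.+1) Gamma ((c - t (tv a)) / kappa)).

Definition What (t : tvar lam -> C) (g : roots_type R lam) : C :=
  \prod_(i < M) \prod_(a < psum lam i) \prod_(b < lam (hi i))
    (t (tv a) - g (hi i) b).

Definition Sigma (I : opart n lam) (v : tvar lam) : C :=
  nth 0 [seq z b | b <- enum (upto I (tag v))] (tagged v).

Definition shifted (I : opart n lam) (r : {ffun tvar lam -> nat})
  (v : tvar lam) : C := Sigma I v + (r v)%:R * kappa.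

Definition Psi (I : opart n lam) (g : roots_type R lam) : C :=
  (- kappa) ^- (lam_up1 lam + lam_low2 lam)
  * Cpow logk (\sum_(i < M) \sum_(a in upto I i)
                 (lam (lo i) + lam (hi i))%:R * z a / kappa)
  * Csum (fun r : {ffun tvar lam -> nat} =>
      iter_res (tvars lam) Phi (shifted I r) (shifted I r)
      * What (shifted I r) g).

Definition lead_factor (I : opart n lam) : C :=
  \prod_(i < M.+1) Cpow (logp i) ((\sum_(a in block I i) z a) / kappa).

End Solutions.

Section LeadingTerm.
Variables (R : realType) (M n : nat) (lam : 'I_M.+1 -> nat).
Local Notation C := (R[i]).

(* F, a class-valued function of p and of the branches of the log p_i, is
   lead_factor times a convergent power series in the ratios p_i / p_{i+1} with
   coefficients A, and L is lead_factor times the constant term of that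
   series. *)
Definition has_leading_term (kappa : C) (z : 'I_n -> C) (I : opart n lam)
    (F L : ('I_M.+1 -> C) -> class R n lam) : Prop :=
  exists A : {ffun 'I_M -> nat} -> class R n lam,
    forall p logp : 'I_M.+1 -> C, (forall i, Cexp (logp i) = p i) ->
    forall J : opart n lam,
      (exists2 S : C,
         has_sum (fun d : {ffun 'I_M -> nat} =>
                    A d J * \prod_(i < M) (p (lo i) / p (hi i)) ^+ d i) S
       & F logp J = lead_factor kappa z logp I * S)
      /\ L logp J = lead_factor kappa z logp I * A [ffun=> 0%N] J.

End LeadingTerm.

(* Main.v *)
Require Import Defs.
From mathcomp Require Import all_boot all_order all_algebra finmap.
From mathcomp Require Import complex.
From mathcomp Require Import all_classical all_reals all_analysis.
From mathcomp Require Import ring lra zify.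

Set Implicit Arguments.
Unset Strict Implicit.
Unset Printing Implicit Defensive.

Import Order.TTheory GRing.Theory Num.Theory.
Local Open Scope ring_scope.

(** The function Psi is a sum of iterated residues, and each residue can be
    computed in closed form.  At a shifted target point every variable sees
    at most one singular Gamma factor, the one that joins it to the variable of
    the next level with the same index; all the other factors are holomorphic
    because the differences z_a - z_b are not integers.  So the residue is the
    integrand with each of these factors replaced by its own residue
    (iter_resE).  It vanishes unless the shifts decrease along the levels.

    For kappa = 1 the shifts enter the exponential factors only through the
    powers of the ratios p_i / p_(i+1); all the rest of the dependence on p sums
    up by parts over the levels to the leading factor (PhiP_split).  Regrouping
    the sum by these powers gives the power series (Psi_series), whose
    constant term is the residue without shifts.  There the Gamma factors inside
    a level cancel all but those between the blocks, and the weight function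
    turns each Gamma (z_c - z_a) into Gamma (1 + z_c - z_a), which produces the
    gamma class; at a fixed point x_J other than x_I both the weight function and
    Delta_I vanish (leading_coeff).

    Convergence is a matter of factorials.  Along w + p - q the Gamma function
    compares to p! / q! up to exponential factors (Gamma_growth).  In this form
    the bounds cancel and leave r_v! to the power minus the sum of the sizes of
    two consecutive blocks, for each variable v with shift r_v (ratioE).  When
    these two blocks are empty nothing is left, but the shift is then dominated
    by the shift of a variable on a lower level for which something is left
    (dominating_var).

    The analysis rests on no integral formula.  A function is called nice at s
    when it has a two-term Taylor expansion with a holomorphic remainder, a
    property that products and inverses inherit by algebra and that is what a
    simple pole needs (polar_residue).  It follows from bounds on divided
    differences up to order 3 (dd_nice), and these bounds pass to pointwise limits.
    The exponential function and 1/Gamma are such limits, of polynomials whose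
    coefficients are uniformly summable on every disc (nice_Cexp,
    nice_invGamma). *)

(** * Modulus and limits of complex numbers *)

Section ComplexModulus.
Variable R : realType.
Local Notation C := (R[i]).
Local Notation nm := (@Normc.normc R).
Implicit Types x y z : C.

Lemma nmE z : `|z| = (nm z)%:C%C.
Proof. by []. Qed.

Lemma nm_ge0 z : 0 <= nm z.
Proof. by case: z => a b; exact: sqrtr_ge0. Qed.

Lemma nm_eq0 z : (nm z == 0) = (z == 0).
Proof.
by apply/eqP/eqP => [/Normc.eq0_normc//|->]; rewrite Normc.normc0.
Qed.

Lemma nm_gt0 z : (0 < nm z) = (z != 0).
Proof. by rewrite lt_def nm_eq0 nm_ge0 andbT. Qed.

Lemma nmC x y : nm (x - y) = nm (y - x).
Proof. by rewrite -normcN opprB. Qed.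

Lemma nmX z n : nm (z ^+ n) = nm z ^+ n.
Proof.
elim: n => [|n IH]; first by rewrite !expr0 Normc.normc1.
by rewrite !exprS Normc.normcM IH.
Qed.

Lemma nm_sum (T : Type) (r : seq T) (P : pred T) (f : T -> C) :
  nm (\sum_(i <- r | P i) f i) <= \sum_(i <- r | P i) nm (f i).
Proof.
elim/big_rec2: _ => [|i y x _ H]; first by rewrite Normc.normc0.
by apply: (le_trans (le_normcD _ _)); rewrite lerD2l.
Qed.

Lemma nmR (a : R) : nm a%:C%C = `|a|.
Proof. by rewrite /= expr0n /= addr0 sqrtr_sqr. Qed.

Lemma nm_nat n : nm n%:R = n%:R.
Proof.
have -> : (n%:R : C) = (n%:R : R)%:C%C by rewrite rmorph_nat.
by rewrite nmR ger0_norm.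
Qed.

Lemma le_nmB x y : nm (x - y) <= nm x + nm y.
Proof. by rewrite -(normcN y) le_normcD. Qed.

Lemma ler_dist_nm x y : nm x - nm y <= nm (x - y).
Proof. by rewrite lerBlDr -{1}(subrK y x) le_normcD. Qed.

Lemma Re_le_nm z : `|complex.Re z| <= nm z.
Proof. by have := normc_ge_Re z; rewrite nmE lecR. Qed.

Lemma Im_le_nm z : `|complex.Im z| <= nm z.
Proof.
case: z => a b /=; rewrite -sqrtr_sqr ler_sqrt ?lerDr ?sqr_ge0 //.
by rewrite addr_ge0 ?sqr_ge0.
Qed.

Lemma nm_le_ReIm z : nm z <= `|complex.Re z| + `|complex.Im z|.
Proof.
rewrite [z in nm z]complexE; apply: (le_trans (le_normcD _ _)).
rewrite Normc.normcM !nmR.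
have -> : nm 'i%C = 1 by rewrite /= expr0n /= expr1n add0r sqrtr1.
by rewrite mul1r.
Qed.

Lemma ReD x y : complex.Re (x + y) = complex.Re x + complex.Re y.
Proof. by case: x y => a b [c d]. Qed.
Lemma ImD x y : complex.Im (x + y) = complex.Im x + complex.Im y.
Proof. by case: x y => a b [c d]. Qed.
Lemma ReB x y : complex.Re (x - y) = complex.Re x - complex.Re y.
Proof. by case: x y => a b [c d]. Qed.
Lemma ImB x y : complex.Im (x - y) = complex.Im x - complex.Im y.
Proof. by case: x y => a b [c d]. Qed.

End ComplexModulus.

Section ComplexLimits.
Local Open Scope classical_set_scope.
Import numFieldNormedType.Exports.
Variable R : realType.
Local Notation C := (R[i]).
Local Notation nm := (@Normc.normc R).

Lemma gt0C (e : C) : 0 < e -> exists2 r : R, 0 < r & e = r%:C%C.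
Proof.
case: e => a b; rewrite ltcE /= => /andP[/eqP b0 a0].
by exists a; rewrite ?b0.
Qed.

Lemma cvgCP (T : Type) (F : set_system T) (FF : Filter F) (f : T -> C) (l : C) :
  (f : T -> R[i]^o) @ F --> (l : R[i]^o) <->
  forall e : R, 0 < e -> \forall x \near F, nm (l - f x) < e.
Proof.
split=> [/cvgrPdist_lt fl e e0|fl].
  have e0' : 0 < e%:C%C :> C by rewrite ltcR.
  by have := fl _ e0'; apply: filterS => x; rewrite nmE ltcR.
apply/cvgrPdist_lt => e /gt0C[r r0 ->].
by have := fl _ r0; apply: filterS => x; rewrite nmE ltcR.
Qed.

Lemma cvg_seqCP (f : nat -> C) (l : C) :
  (f : nat -> R[i]^o) @ \oo --> (l : R[i]^o) <->
  forall e : R, 0 < e -> exists N, forall k, (N <= k)%N -> nm (l - f k) < e.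
Proof.
split=> [/cvgCP fl e /fl [N _ H]|fl]; first by exists N.
by apply/cvgCP => e /fl[N H]; exists N.
Qed.

Lemma nearCP (s : C) (P : C -> Prop) :
  (\forall u \near (s : R[i]^o), P u) <->
  exists2 d : R, 0 < d & forall u, nm (u - s) < d -> P u.
Proof.
split=> [/nbhs_ballP[e /= /gt0C[r r0 ->] H]|[d d0 H]].
  by exists r => // u us; apply: H; rewrite /ball /= nmE ltcR nmC.
apply/nbhs_ballP; exists d%:C%C => /=; first by rewrite ltcR.
by move=> u; rewrite /ball /= nmE ltcR nmC; exact: H.
Qed.

Lemma dnearCP (s : C) (P : C -> Prop) :
  (\forall u \near (s : R[i]^o)^', P u) <->
  exists2 d : R, 0 < d & forall u, u != s -> nm (u - s) < d -> P u.
Proof.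
rewrite /dnbhs; split.
  by rewrite near_withinE => /nearCP[d d0 H]; exists d => // u us /H; apply.
move=> [d d0 H]; rewrite near_withinE; apply/nearCP; exists d => // u us us'.
exact: H.
Qed.

Lemma derivableCP (f : C -> C) (s : C) :
  derivable (f : R[i]^o -> R[i]^o) s 1 <->
  exists l : C, forall e : R, 0 < e -> exists2 d : R, 0 < d &
    forall u, u != s -> nm (u - s) < d -> nm (l - (f u - f s) / (u - s)) < e.
Proof.
have E (l : C) : ((fun h : R[i]^o => h^-1 *: ((f \o shift s) (h *: (1:R[i]^o)) - f s) : R[i]^o)
     @ (0:R[i]^o)^' --> (l : R[i]^o)) <-> (forall e : R, 0 < e -> exists2 d : R, 0 < d &
    forall u, u != s -> nm (u - s) < d -> nm (l - (f u - f s) / (u - s)) < e).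
  split=> [/cvgCP fl e /fl/dnearCP[d d0 H]|fl].
    exists d => // u us ud.
    have := H (u - s); rewrite subr0 subr_eq0 => /(_ us ud).
    by rewrite /= /GRing.scale /= mulr1 subrK mulrC.
  apply/cvgCP => e /fl[d d0 H]; apply/dnearCP; exists d => // h h0.
  rewrite subr0 => hd; have := H (h + s).
  rewrite addrK -subr_eq0 addrK => /(_ h0 hd).
  by rewrite /= /GRing.scale /= mulr1 mulrC.
rewrite /derivable; split.
  by move=> /cvg_ex[l] /E H; exists l.
by move=> [l /E H]; apply/cvg_ex; exists l.
Qed.

Lemma seqR_complete (a : nat -> R) (D : R) :
  (forall k l, (k <= l)%N -> `|a l - a k| <= D / k.+1%:R) ->
  exists l, forall k, `|l - a k| <= D / k.+1%:R.
Proof.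
move=> H.
have D0 : 0 <= D by have := H 0 0 (leqnn _); rewrite subrr normr0 divr1.
have HH k l : a k - D / k.+1%:R <= a l + D / l.+1%:R.
  have [kl|lk] := leqP k l.
    have := H _ _ kl; rewrite ler_norml => /andP[h _].
    have : 0 <= D / l.+1%:R by rewrite divr_ge0.
    move: h; move: (D / _) (D / _) => u v; lra.
  have := H _ _ (ltnW lk); rewrite ler_norml => /andP[_ h].
  have : 0 <= D / k.+1%:R by rewrite divr_ge0.
  move: h; move: (D / _) (D / _) => u v; lra.
pose A := range (fun k => a k - D / k.+1%:R).
have ubA l : ubound A (a l + D / l.+1%:R) by move=> _ [k _ <-].
exists (sup A) => k; rewrite ler_norml; apply/andP; split.
  rewrite lerBrDl; apply: ub_le_sup; first by exists (a 0%N + D / 1%:R); apply: ubA.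
  by exists k.
by rewrite lerBlDl; apply: ge_sup => //; exists (a 0%N - D / 1%:R); exists 0%N.
Qed.

(** Completeness of the complex plane, in the quantitative form in which it
    is used. *)
Lemma seqC_complete (a : nat -> C) (D : R) :
  (forall k l, (k <= l)%N -> nm (a l - a k) <= D / k.+1%:R) ->
  exists l, forall k, nm (l - a k) <= 2 * D / k.+1%:R.
Proof.
move=> H.
have [|x Hx] := @seqR_complete (fun k => complex.Re (a k)) D.
  move=> k l kl; rewrite -ReB; exact: le_trans (Re_le_nm _) (H _ _ kl).
have [|y Hy] := @seqR_complete (fun k => complex.Im (a k)) D.
  move=> k l kl; rewrite -ImB; exact: le_trans (Im_le_nm _) (H _ _ kl).
exists (x +i* y)%C => k; apply: (le_trans (nm_le_ReIm _)).
by rewrite ReB ImB /= -mulrA mulrDl mul1r lerD.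
Qed.

Lemma inv_nat_lt (e : R) : 0 < e -> exists N, forall k, (N <= k)%N -> k.+1%:R^-1 < e.
Proof.
move=> e0; exists (Num.bound e^-1) => k Nk.
rewrite invf_plt ?posrE //.
apply: lt_le_trans (_ : (Num.bound e^-1)%:R <= _).
  by rewrite archi_boundP // invr_ge0 ltW.
by rewrite ler_nat (leq_trans Nk).
Qed.

Lemma cvg_seq_rate (a : nat -> C) (D : R) (l : C) :
  (forall k, nm (l - a k) <= D / k.+1%:R) ->
  (a : nat -> R[i]^o) @ \oo --> (l : R[i]^o).
Proof.
move=> H; apply/cvg_seqCP => e e0.
have D0 : 0 <= D by have := H 0; rewrite divr1; apply: le_trans; exact: nm_ge0.
have D1 : 0 < D + 1 by lra.
have [N HN] := inv_nat_lt (divr_gt0 e0 D1).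
exists N => k /HN; rewrite ltr_pdivlMr // => h; apply: le_lt_trans (H k) _.
by apply: le_lt_trans h; rewrite mulrC ler_wpM2l ?invr_ge0 // lerDl.
Qed.

Lemma cvg_nm_le (a : nat -> C) (l : C) (B : R) :
  (a : nat -> R[i]^o) @ \oo --> (l : R[i]^o) ->
  (exists N, forall k, (N <= k)%N -> nm (a k) <= B) -> nm l <= B.
Proof.
move=> /cvg_seqCP al [N HN]; apply/ler_addgt0Pr => e /al[N' HN'].
have := HN' _ (leq_maxr N N'); have := HN _ (leq_maxl N N').
have := le_normcD (l - a (maxn N N')) (a (maxn N N')); rewrite subrK; lra.
Qed.

Lemma cvg_nm_ge (a : nat -> C) (l : C) (B : R) :
  (a : nat -> R[i]^o) @ \oo --> (l : R[i]^o) ->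
  (exists N, forall k, (N <= k)%N -> B <= nm (a k)) -> B <= nm l.
Proof.
move=> /cvg_seqCP al [N HN]; apply/ler_addgt0Pr => e /al[N' HN'].
have := HN' _ (leq_maxr N N'); have := HN _ (leq_maxl N N').
have := ler_dist_nm (a (maxn N N')) l; rewrite nmC; lra.
Qed.

End ComplexLimits.

(** * Holomorphic functions and simple poles *)

Section Holomorphic.
Local Open Scope classical_set_scope.
Import numFieldNormedType.Exports.
Variable R : realType.
Local Notation C := (R[i]).
Local Notation nm := (@Normc.normc R).

Lemma derivableCD (f g : R[i]^o -> R[i]^o) u :
  derivable f u 1 -> derivable g u 1 -> derivable (fun u => f u + g u) u 1.
Proof. exact: derivableD. Qed.

Lemma derivableCM (f g : R[i]^o -> R[i]^o) u :
  derivable f u 1 -> derivable g u 1 -> derivable (fun u => f u * g u) u 1.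
Proof. exact: derivableM. Qed.

Lemma derivableCV (f : R[i]^o -> R[i]^o) u :
  f u != 0 -> derivable f u 1 -> derivable (fun u => (f u)^-1) u 1.
Proof. exact: derivableV. Qed.

Definition hol (f : C -> C) (s : C) : Prop :=
  \forall u \near (s : R[i]^o), derivable (f : R[i]^o -> R[i]^o) u 1.

Lemma hol_derivable f s : hol f s -> derivable (f : R[i]^o -> R[i]^o) s 1.
Proof. by move/nearCP => [d d0]; apply; rewrite subrr Normc.normc0. Qed.

Lemma hol_cst (c s : C) : hol (fun=> c) s.
Proof. by apply/nearCP; exists 1 => // u _; exact: derivable_cst. Qed.

Lemma hol_id (s : C) : hol id s.
Proof. by apply/nearCP; exists 1 => // u _; exact: derivable_id. Qed.

Lemma hol_add f g s : hol f s -> hol g s -> hol (fun u => f u + g u) s.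
Proof.
move=> hf hg; move: hf hg; apply: filterS2 => u; exact: derivableCD.
Qed.

Lemma hol_mul f g s : hol f s -> hol g s -> hol (fun u => f u * g u) s.
Proof.
move=> hf hg; move: hf hg; apply: filterS2 => u; exact: derivableCM.
Qed.

Lemma hol_lipschitz f s : hol f s ->
  exists2 d : R, 0 < d & exists2 K : R, 0 <= K &
    forall u, nm (u - s) < d -> nm (f u - f s) <= K * nm (u - s).
Proof.
move=> /hol_derivable/derivableCP[l /(_ 1 ltr01)[d d0 H]].
exists d => //; exists (nm l + 1); first by rewrite addr_ge0 // nm_ge0.
move=> u us; have [->|us0] := eqVneq u s; first by rewrite !subrr !Normc.normc0 mulr0.
have := H u us0 us; set q := (f u - f s) / (u - s) => h.
have -> : f u - f s = q * (u - s) by rewrite divfK // subr_eq0.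
rewrite Normc.normcM ler_wpM2r ?nm_ge0 //.
have := le_nmB l (l - q); rewrite opprB addrC subrK; lra.
Qed.

Lemma hol_near_neq0 f s : hol f s -> f s != 0 ->
  \forall u \near (s : R[i]^o), f u != 0.
Proof.
move=> /hol_lipschitz[d d0 [K K0 H]] fs; apply/nearCP.
have K1 : 0 < K + 1 by lra.
have fs0 : 0 < nm (f s) by rewrite nm_gt0.
exists (Num.min d (nm (f s) / (K + 1))); first by rewrite lt_min d0 divr_gt0.
move=> u; rewrite lt_min => /andP[ud]; rewrite ltr_pdivlMr // => uK.
apply/eqP => fu; have := H _ ud; rewrite fu sub0r normcN.
have := nm_ge0 (u - s); nra.
Qed.

Lemma hol_inv f s : hol f s -> f s != 0 -> hol (fun u => (f u)^-1) s.
Proof.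
move=> hf fs; have fn := hol_near_neq0 hf fs.
by move: fn hf; apply: filterS2 => u; exact: derivableCV.
Qed.

Lemma near_affine (P : C -> Prop) (a b s : C) :
  (\forall w \near (a * s + b : R[i]^o), P w) ->
  \forall u \near (s : R[i]^o), P (a * u + b).
Proof.
move=> /nearCP[d d0 H]; apply/nearCP.
have a0 : 0 < nm a + 1 by have := nm_ge0 a; lra.
exists (d / (nm a + 1)); first by rewrite divr_gt0.
move=> u; rewrite ltr_pdivlMr // => us; apply: H.
have -> : a * u + b - (a * s + b) = a * (u - s) by ring.
rewrite Normc.normcM; have := nm_ge0 (u - s); nra.
Qed.

Lemma hol_affine f (a b s : C) : hol f (a * s + b) -> hol (fun u => f (a * u + b)) s.
Proof.
move=> /near_affine; apply: filterS => u /derivable1_diffP df.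
have da : derivable ((fun u => a * u + b) : R[i]^o -> R[i]^o) u 1.
  apply/derivableCD; last exact: derivable_cst.
  apply/derivableCM; [exact: derivable_cst | exact: derivable_id].
move/derivable1_diffP in da; apply/derivable1_diffP.
exact: (differentiable_comp da df).
Qed.

(** A two-term Taylor expansion with a holomorphic remainder.  This form of
    holomorphy is stable under products and inverses for purely algebraic
    reasons, and hands over the regular part of a simple pole: no integral
    formula is needed to remove the singularity of the difference quotient. *)
Definition nice (f : C -> C) (s : C) : Prop :=
  exists2 g, hol g s & \forall u \near (s : R[i]^o), f u = f s + (u - s) * g u.

Lemma nice_near f g s : (\forall u \near (s : R[i]^o), f u = g u) -> nice f s -> nice g s.
Proof.
move=> fg [h hh fE]; exists h => //.
have gs : f s = g s by exact: (nbhs_singleton fg).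
near=> u; rewrite -gs; transitivity (f u); last by near: u.
by apply/esym; near: u.
Unshelve. all: by end_near. Qed.

Lemma nice_cst c s : nice (fun=> c) s.
Proof.
exists (fun=> 0); first apply hol_cst.
by near=> u; rewrite mulr0 addr0.
Unshelve. all: by end_near. Qed.

Lemma nice_id s : nice id s.
Proof.
exists (fun=> 1); first apply hol_cst.
by near=> u; rewrite mulr1 addrC subrK.
Unshelve. all: by end_near. Qed.

Lemma nice_mul f g s : nice f s -> nice g s -> nice (fun u => f u * g u) s.
Proof.
move=> [f1 hf fE] [g1 hg gE].
exists (fun u => f s * g1 u + g s * f1 u + (u - s) * (f1 u * g1 u)).
  apply hol_add.
    by apply hol_add; apply hol_mul; [apply hol_cst | exact hg | apply hol_cst | exact hf].
  apply hol_mul; first by apply hol_add; [apply hol_id | apply hol_cst].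
  by apply hol_mul; [exact hf | exact hg].
near=> u.
have -> : f u = f s + (u - s) * f1 u by near: u.
have -> : g u = g s + (u - s) * g1 u by near: u.
by ring.
Unshelve. all: by end_near. Qed.

Lemma nice_hol f s : nice f s ->
  exists2 f', hol f' s & \forall u \near (s : R[i]^o), f u = f' u.
Proof.
move=> [g hg fE]; exists (fun u => f s + (u - s) * g u); last exact: fE.
apply hol_add; first apply hol_cst.
apply hol_mul; last exact hg.
by apply hol_add; [apply hol_id | apply hol_cst].
Qed.

Lemma nice_inv f s : nice f s -> f s != 0 -> nice (fun u => (f u)^-1) s.
Proof.
move=> nf fs; have [f' hf' ff'] := nice_hol nf; have [g hg fE] := nf.
have fs' : f s = f' s by exact: (nbhs_singleton ff').
have f's : f' s != 0 by rewrite -fs'.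
have f'n := hol_near_neq0 hf' f's.
exists (fun u => - (f s)^-1 * (f' u)^-1 * g u).
  apply hol_mul; last exact hg.
  apply hol_mul; first apply hol_cst.
  by apply hol_inv; [exact hf' | exact f's].
near=> u.
have fu : f u = f' u by near: u.
have fu0 : f' u != 0 by near: u.
have fuE : f u = f s + (u - s) * g u by near: u.
have : (u - s) * g u = f' u - f s by rewrite -fu fuE addrAC subrr add0r.
rewrite fu => H.
have -> : (u - s) * (- (f s)^-1 * (f' u)^-1 * g u)
   = - (f s)^-1 * (f' u)^-1 * ((u - s) * g u) by ring.
by rewrite H; field; rewrite fs fu0.
Unshelve. all: by end_near. Qed.

Lemma nice_affine f (a b s : C) :
  nice f (a * s + b) -> nice (fun u => f (a * u + b)) s.
Proof.
move=> [g hg /near_affine fE]; exists (fun u => a * g (a * u + b)).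
  by apply hol_mul; [apply hol_cst | apply hol_affine; exact hg].
near=> u.
have -> : f (a * u + b) =
  f (a * s + b) + (a * u + b - (a * s + b)) * g (a * u + b) by near: u.
by ring.
Unshelve. all: by end_near. Qed.

Lemma nice_lin (f phi : C -> C) (s a b : C) : (forall u, phi u = a * u + b) ->
  nice f (phi s) -> nice (fun u => f (phi u)) s.
Proof.
move=> phiE; rewrite phiE => /nice_affine; apply: nice_near.
by near=> u; rewrite phiE.
Unshelve. all: by end_near. Qed.

(** k bounds the order of the pole, and c is the coefficient of
    (u - s)^-k, possibly 0.  Allowing c = 0 lets a regular factor count as a
    simple pole, so that orders just add up in products. *)
Definition polar (f : C -> C) (s : C) (k : nat) (c : C) : Prop :=
  exists g, [/\ nice g s, g s = c &
    \forall u \near (s : R[i]^o)^', f u = g u * (u - s) ^- k].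

Lemma polar_near f g s k c :
  (\forall u \near (s : R[i]^o)^', f u = g u) -> polar f s k c -> polar g s k c.
Proof.
move=> fg [h [nh hs fE]]; exists h; split => //; near=> u.
by transitivity (f u); [apply/esym|]; near: u.
Unshelve. all: by end_near. Qed.

Lemma polar_nice f s : nice f s -> polar f s 0 (f s).
Proof.
move=> nf; exists f; split => //; near=> u; by rewrite expr0 invr1 mulr1.
Unshelve. all: by end_near. Qed.

Lemma polar_mul f g s k l c d : polar f s k c -> polar g s l d ->
  polar (fun u => f u * g u) s (k + l) (c * d).
Proof.
move=> [f1 [nf <- fE]] [g1 [ng <- gE]].
exists (fun u => f1 u * g1 u); split => //; first exact: nice_mul.
near=> u.
have -> : f u = f1 u * (u - s) ^- k by near: u.
have -> : g u = g1 u * (u - s) ^- l by near: u.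
by rewrite exprD invfM mulrACA.
Unshelve. all: by end_near. Qed.

Lemma polar_prod (T : eqType) (r : seq T) (P : pred T) (f : T -> C -> C) (s : C)
    (k : T -> nat) (c : T -> C) :
  (forall i, i \in r -> P i -> polar (f i) s (k i) (c i)) ->
  polar (fun u => \prod_(i <- r | P i) f i u) s (\sum_(i <- r | P i) k i)%N
    (\prod_(i <- r | P i) c i).
Proof.
elim: r => [|i r IH] H.
  rewrite !big_nil; have := polar_nice (nice_cst (1 : C) s); apply: polar_near.
  by near=> u; rewrite big_nil.
have {}IH := IH (fun j jr => H j (mem_behead (s := i :: r) jr)).
rewrite !big_cons; case: ifP => Pi.
  have := polar_mul (H i (mem_head _ _) Pi) IH; apply: polar_near.
  by near=> u; rewrite big_cons Pi.
by apply: polar_near IH; near=> u; rewrite big_cons Pi.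
Unshelve. all: by end_near. Qed.

Lemma small_eq0 (s d : C) (K : R) :
  (\forall u \near (s : R[i]^o)^', nm d <= K * nm (u - s)) -> d = 0.
Proof.
move=> /dnearCP[e e0 H]; apply: Normc.eq0_normc; apply/eqP; rewrite eq_le nm_ge0 andbT.
apply/ler_addgt0Pr => r r0; rewrite add0r.
have K1 : 0 < `|K| + 1 by rewrite ltr_wpDl.
pose t := Num.min (e / 2) (r / (`|K| + 1)).
have t0 : 0 < t by rewrite lt_min !divr_gt0.
have te : t < e.
  by apply: (@le_lt_trans _ _ (e / 2)); [rewrite ge_min lexx | lra].
have tr : t * (`|K| + 1) <= r by rewrite -ler_pdivlMr // ge_min lexx orbT.
have nt : nm (t%:C%C + s - s) = t by rewrite addrK nmR gtr0_norm.
have := H (t%:C%C + s); rewrite nt -subr_eq0 addrK => H'.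
apply: le_trans (H' _ te) _; first by rewrite -nm_gt0 nmR gtr0_norm.
have := ler_norm K; nra.
Qed.

(** Multiplying by (u - s)^k leaves the last coefficient up to a term of order
    u - s, hence that coefficient is 0; the others follow one by one. *)
Lemma principal_part_eq0 (h : C -> C) (s : C) (M : R) (a : nat -> C) k :
  (\forall u \near (s : R[i]^o)^', nm (h u) <= M) ->
  (\forall u \near (s : R[i]^o)^',
     h u + \sum_(j < k) a j * (u - s) ^- j.+1 = 0) ->
  forall j, (j < k)%N -> a j = 0.
Proof.
move=> hM; elim: k => // k IH hE.
have ak : a k = 0.
  pose K := M + \sum_(j < k) nm (a j).
  apply: (@small_eq0 s _ K).
  have s1 : \forall u \near (s : R[i]^o)^', u != s /\ nm (u - s) < 1.
    by apply/dnearCP; exists 1.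
  near=> u.
  have [us us1] : u != s /\ nm (u - s) < 1 by near: u.
  have us0 : u - s != 0 by rewrite subr_eq0.
  have : h u + \sum_(j < k.+1) a j * (u - s) ^- j.+1 = 0 by near: u.
  rewrite big_ord_recr /= => E.
  have {}E : a k = - (u - s) * (h u * (u - s) ^+ k
       + \sum_(j < k) a j * (u - s) ^+ (k - j.+1)).
    have -> : a k = (a k * (u - s) ^- k.+1) * (u - s) ^+ k.+1.
      by rewrite divfK // expf_neq0.
    have -> : a k * (u - s) ^- k.+1 = - (h u + \sum_(j < k) a j * (u - s) ^- j.+1).
      by apply/eqP; rewrite -addr_eq0 addrC -addrA E.
    rewrite !mulNr exprS; congr (- _); rewrite mulrCA; congr (_ * _).
    rewrite mulrDl; congr (_ + _).
    rewrite big_distrl /=; apply: eq_bigr => j _.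
    rewrite -mulrA; congr (_ * _).
    have -> : (u - s) ^+ k = (u - s) ^+ (k - j.+1) * (u - s) ^+ j.+1.
      by rewrite -exprD subnK.
    by rewrite mulrCA mulVf ?mulr1 // expf_neq0.
  have hu : nm (h u) <= M by near: u.
  rewrite E Normc.normcM normcN mulrC ler_wpM2r ?nm_ge0 //.
  have p1 m : nm (u - s) ^+ m <= 1 by rewrite exprn_ile1 ?nm_ge0 // ltW.
  apply: (le_trans (le_normcD _ _)); rewrite lerD //.
    by rewrite Normc.normcM nmX; apply: le_trans hu; rewrite ler_piMr ?nm_ge0.
  apply: (le_trans (nm_sum _ _ _)); apply: ler_sum => j _.
  by rewrite Normc.normcM nmX ler_piMr ?nm_ge0.
move=> j; rewrite ltnS leq_eqVlt => /orP[/eqP->//|]; apply: IH.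
near=> u.
have : h u + \sum_(j < k.+1) a j * (u - s) ^- j.+1 = 0 by near: u.
by rewrite big_ord_recr /= ak mul0r addr0.
Unshelve. all: by end_near. Qed.

Lemma is_residue_uniq (f : C -> C) (s c c' : C) : is_residue f s c -> is_residue f s c' -> c = c'.
Proof.
move=> [k [a [h [<- hh fE]]]] [k' [a' [h' [<- hh' fE']]]].
pose tr m (b : nat -> C) j := if (j <= m)%N then b j else 0.
have trE m (b : nat -> C) n (u : C) : (m <= n)%N ->
  \sum_(j < m.+1) b j * (u - s) ^- j.+1 = \sum_(j < n.+1) tr m b j * (u - s) ^- j.+1.
  move=> mn; rewrite (big_ord_widen n.+1 (fun j => b j * (u - s) ^- j.+1)) //.
  rewrite big_mkcond /=; apply: eq_bigr => j _; rewrite /tr ltnS.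
  by case: ifP => //; rewrite mul0r.
have [d d0 [K K0 hK]] := hol_lipschitz hh.
have [d' d'0 [K' K'0 hK']] := hol_lipschitz hh'.
pose n := maxn k k'.
suff: forall j, (j < n.+1)%N -> tr k a j - tr k' a' j = 0.
  by move=> /(_ 0%N isT)/eqP; rewrite subr_eq0 => /eqP.
apply: (@principal_part_eq0 (fun u => h u - h' u) s
   (K * d + nm (h s) + (K' * d' + nm (h' s)))).
  apply/dnearCP; exists (Num.min d d') => [|u _]; first by rewrite lt_min d0.
  rewrite lt_min => /andP[ud ud'].
  apply: (le_trans (le_nmB _ _)); apply: lerD.
    have := hK _ ud; have := ler_dist_nm (h u) (h s).
    have : K * nm (u - s) <= K * d by rewrite ler_wpM2l // ltW.
    lra.
  have := hK' _ ud'; have := ler_dist_nm (h' u) (h' s).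
  have : K' * nm (u - s) <= K' * d' by rewrite ler_wpM2l // ltW.
  lra.
near=> u.
have e1 : f u = h u + \sum_(j < k.+1) a j * (u - s) ^- j.+1 by near: u.
have e2 : f u = h' u + \sum_(j < k'.+1) a' j * (u - s) ^- j.+1 by near: u.
rewrite (trE k a n) ?leq_maxl // in e1.
rewrite (trE k' a' n) ?leq_maxr // in e2.
under eq_bigr do rewrite mulrBl.
rewrite sumrB; move: e1 e2 => ->.
by move=> e; rewrite addrACA -opprD e subrr.
Unshelve. all: by end_near. Qed.

(** The remainder of the nice factor is the holomorphic part of the expansion
    that the definition of a residue asks for. *)
Lemma polar_residue f s c : polar f s 1 c -> Residue f s = c.
Proof.
move=> [g [[g1 hg gE] gs fE]].
have H : is_residue f s c.
  exists 0, (fun=> c), g1; split => //.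
  have gE' : \forall u \near (s : R[i]^o)^', g u = g s + (u - s) * g1 u.
    by apply/dnearCP; case/nearCP: gE => d d0 H; exists d => // u _; exact: H.
  have us : \forall u \near (s : R[i]^o)^', u != s by apply/dnearCP; exists 1.
  near=> u; rewrite big_ord1.
  have -> : f u = g u * (u - s) ^- 1 by near: u.
  have -> : g u = g s + (u - s) * g1 u by near: u.
  have us0 : u - s != 0 by rewrite subr_eq0; near: u.
  by rewrite gs expr1; field.
rewrite /Residue; case: xgetP => [x _ Hx|/(_ c)/= /(_ H)//].
exact: (is_residue_uniq Hx H).
Unshelve. all: by end_near. Qed.

End Holomorphic.

(** * Divided differences *)

Section DividedDifferences.
Local Open Scope classical_set_scope.
Import numFieldNormedType.Exports.
Variable R : realType.
Local Notation C := (R[i]).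
Local Notation nm := (@Normc.normc R).

Definition dquo (s : C) (f : C -> C) : C -> C := fun u => (f u - f s) / (u - s).

(** Bounds for the divided differences of order 2 and 3 on a disc, at pairwise
    distinct points only: in this form the bounds survive pointwise limits,
    whereas derivatives would not. *)
Definition dd_bounded (f : C -> C) (rho B : R) : Prop :=
  (forall x y u, nm x <= rho -> nm y <= rho -> nm u <= rho ->
     uniq [:: x; y; u] -> nm (dquo y (dquo x f) u) <= B) /\
  (forall x y w u, nm x <= rho -> nm y <= rho -> nm w <= rho -> nm u <= rho ->
     uniq [:: x; y; w; u] -> nm (dquo w (dquo y (dquo x f)) u) <= B).

Lemma cvgC_sub (a b : nat -> C) x y :
  (a : nat -> R[i]^o) @ \oo --> (x : R[i]^o) ->
  (b : nat -> R[i]^o) @ \oo --> (y : R[i]^o) ->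
  ((fun k => a k - b k) : nat -> R[i]^o) @ \oo --> (x - y : R[i]^o).
Proof. exact: cvgB. Qed.

Lemma cvgC_mul (a b : nat -> C) x y :
  (a : nat -> R[i]^o) @ \oo --> (x : R[i]^o) ->
  (b : nat -> R[i]^o) @ \oo --> (y : R[i]^o) ->
  ((fun k => a k * b k) : nat -> R[i]^o) @ \oo --> (x * y : R[i]^o).
Proof. exact: cvgM. Qed.

Lemma cvgC_inv (a : nat -> C) x : x != 0 ->
  (a : nat -> R[i]^o) @ \oo --> (x : R[i]^o) ->
  ((fun k => (a k)^-1) : nat -> R[i]^o) @ \oo --> (x^-1 : R[i]^o).
Proof. exact: cvgV. Qed.

Lemma cvgC_cst (x : C) : ((fun=> x) : nat -> R[i]^o) @ \oo --> (x : R[i]^o).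
Proof. exact: cvg_cst. Qed.

Lemma cvg_dquo (f : nat -> C -> C) (g : C -> C) s u :
  (forall x, ((fun k => f k x) : nat -> R[i]^o) @ \oo --> (g x : R[i]^o)) ->
  ((fun k => dquo s (f k) u) : nat -> R[i]^o) @ \oo --> (dquo s g u : R[i]^o).
Proof. by move=> H; apply: cvgC_mul; [exact: cvgC_sub | exact: cvgC_cst]. Qed.

(** The reason for working with divided differences: a polynomial bound passes
    to pointwise limits without any uniformity. *)
Lemma dd_bounded_lim (f : nat -> C -> C) (g : C -> C) rho B :
  (forall x, ((fun k => f k x) : nat -> R[i]^o) @ \oo --> (g x : R[i]^o)) ->
  (forall k, dd_bounded (f k) rho B) -> dd_bounded g rho B.
Proof.
move=> fg H; split=> [x y u hx hy hu xyu|x y w u hx hy hw hu xywu].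
  apply: (@cvg_nm_le _ (fun k => dquo y (dquo x (f k)) u)).
    by do 2!apply: cvg_dquo => ?.
  by exists 0%N => k _; apply: (H k).1.
apply: (@cvg_nm_le _ (fun k => dquo w (dquo y (dquo x (f k))) u)).
  by do 3!apply: cvg_dquo => ?.
by exists 0%N => k _; apply: (H k).2.
Qed.

Lemma dquo_lip (F : C -> C) u v B : u != v -> nm (dquo v F u) <= B ->
  nm (F u - F v) <= B * nm (u - v).
Proof.
move=> uv H; have -> : F u - F v = dquo v F u * (u - v).
  by rewrite /dquo divfK // subr_eq0.
by rewrite Normc.normcM ler_wpM2r // nm_ge0.
Qed.

Definition seq_to (s : C) (d : R) (k : nat) : C := s + (d / k.+1%:R)%:C%C.

Lemma seq_to_nm s d k : 0 <= d -> nm (seq_to s d k - s) = d / k.+1%:R.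
Proof. by move=> d0; rewrite /seq_to addrAC subrr add0r nmR ger0_norm // divr_ge0. Qed.

Lemma seq_to_neq s d k : 0 < d -> seq_to s d k != s.
Proof.
move=> d0; rewrite -subr_eq0 -nm_gt0 seq_to_nm ?ltW //.
by rewrite divr_gt0 ?ltr0n.
Qed.

Lemma seq_to_le s d k : 0 <= d -> nm (seq_to s d k) <= nm s + d.
Proof.
move=> d0; apply: (le_trans (le_normcD _ _)); rewrite lerD2l nmR ger0_norm ?divr_ge0 //.
by rewrite ler_pdivrMr ?ltr0n // ler_peMr // ler1n.
Qed.

Lemma seq_to_cvg s d : 0 <= d -> (seq_to s d : nat -> R[i]^o) @ \oo --> (s : R[i]^o).
Proof.
by move=> d0; apply: (@cvg_seq_rate _ _ d) => k; rewrite nmC seq_to_nm.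
Qed.

Lemma lip_lim (F : C -> C) (s : C) (rho B : R) : nm s < rho -> 0 <= B ->
  (forall u v, u != s -> v != s -> nm u <= rho -> nm v <= rho ->
     nm (F u - F v) <= B * nm (u - v)) ->
  exists l, (forall u, u != s -> nm u <= rho -> nm (F u - l) <= B * nm (u - s)) /\
    forall d, 0 < d -> nm s + d <= rho ->
    ((fun k => F (seq_to s d k)) : nat -> R[i]^o) @ \oo --> (l : R[i]^o).
Proof.
move=> srho B0 H; pose d := rho - nm s; have d0 : 0 < d by rewrite subr_gt0.
have rk k : nm (seq_to s d k) <= rho.
  by apply: (le_trans (seq_to_le _ _ (ltW d0))); rewrite /d addrC subrK.
have [|l Hl] := @seqC_complete _ (fun k => F (seq_to s d k)) (B * d).
  move=> k l kl; apply: (le_trans (H _ _ _ _ _ _)); rewrite ?seq_to_neq //.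
  rewrite -mulrA ler_wpM2l // /seq_to opprD addrACA subrr add0r -rmorphB nmR.
  have kl' : d / l.+1%:R <= d / k.+1%:R.
    by rewrite ler_pM2l // lef_pV2 ?posrE ?ltr0n // ler_nat ltnS.
  have l0 : 0 <= d / l.+1%:R by rewrite divr_ge0 // ltW.
  by rewrite ler0_norm ?subr_le0 // opprB lerBlDr lerDl.
have cl := @cvg_seq_rate _ _ _ _ Hl.
have Fl u : u != s -> nm u <= rho -> nm (F u - l) <= B * nm (u - s).
  move=> us ur; apply/ler_addgt0Pr => e e0.
  move/cvg_seqCP : (cl) => /(_ (e / 2)); rewrite divr_gt0 // => /(_ isT)[N HN].
  have B1 : 0 < B + 1 by lra.
  have := @seq_to_cvg s d (ltW d0) => /cvg_seqCP/(_ (e / 2 / (B + 1))).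
  rewrite !divr_gt0 // => /(_ isT)[N' HN'].
  have := HN _ (leq_maxl N N'); have := HN' _ (leq_maxr N N').
  set m := maxn N N'; rewrite ltr_pdivlMr // => h1 h2.
  have := H u (seq_to s d m) us (seq_to_neq _ _ d0) ur (rk m).
  have := le_normcD (F u - F (seq_to s d m)) (F (seq_to s d m) - l).
  rewrite addrA subrK [nm (F _ - l)]nmC => h3 h4.
  have : nm (u - seq_to s d m) <= nm (u - s) + nm (s - seq_to s d m).
    by apply: le_trans (le_normcD _ _); rewrite addrA subrK.
  have := nm_ge0 (s - seq_to s d m); nra.
exists l; split => // d' d'0 sd'.
apply: (@cvg_seq_rate _ _ (B * d')) => k; rewrite nmC.
apply: (le_trans (Fl _ _ _)); rewrite ?seq_to_neq //.
  by apply: le_trans sd'; apply: seq_to_le; exact: ltW.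
by rewrite seq_to_nm ?mulrA // ltW.
Qed.

(** A bound on the second divided differences makes the difference quotient at
    s Lipschitz away from s, hence extendable to s by completeness. *)
Lemma dd2_derivable f rho B s : 0 <= B ->
  (forall x y u, nm x <= rho -> nm y <= rho -> nm u <= rho ->
     uniq [:: x; y; u] -> nm (dquo y (dquo x f) u) <= B) -> nm s < rho ->
  exists l, (forall u, u != s -> nm u <= rho -> nm (dquo s f u - l) <= B * nm (u - s)) /\
    forall d, 0 < d -> nm s + d <= rho ->
    ((fun k => dquo s f (seq_to s d k)) : nat -> R[i]^o) @ \oo --> (l : R[i]^o).
Proof.
move=> B0 H sr; apply: lip_lim => // u v us vs ur vr.
have [->|uv] := eqVneq u v; first by rewrite !subrr Normc.normc0 mulr0.
apply: dquo_lip => //; apply: H => //; first exact: ltW.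
by rewrite /= !inE negb_or (eq_sym s v) (eq_sym s u) us vs (eq_sym v u) uv.
Qed.

Lemma lip_derivable (f : C -> C) s (l : C) rho B : 0 <= B -> nm s < rho ->
  (forall u, u != s -> nm u <= rho -> nm (dquo s f u - l) <= B * nm (u - s)) ->
  derivable (f : R[i]^o -> R[i]^o) s 1.
Proof.
move=> B0 sr H; apply/derivableCP; exists l => e e0.
have B1 : 0 < B + 1 by lra.
exists (Num.min (rho - nm s) (e / (B + 1))).
  by rewrite lt_min subr_gt0 sr divr_gt0.
move=> u us; rewrite lt_min ltr_pdivlMr // => /andP[u1 u2].
rewrite nmC; apply: le_lt_trans (H u us _) _.
  by have := ler_dist_nm u s; lra.
by have := nm_ge0 (u - s); nra.
Qed.

(** The third divided differences of f with one node at s are second ones of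
    its difference quotient, which is therefore differentiable in its turn,
    also at s. *)
Lemma dd_nice f rho B s : 0 <= B -> dd_bounded f rho B -> nm s < rho -> nice f s.
Proof.
move=> B0 [H2 H3] sr.
have [l [Hl cl]] := dd2_derivable B0 H2 sr.
pose F u := if u == s then l else dquo s f u.
have df u : nm u < rho -> derivable (f : R[i]^o -> R[i]^o) u 1.
  move=> ur; have [l' [Hl' _]] := dd2_derivable B0 H2 ur.
  exact: (lip_derivable B0 ur Hl').
have Fs : exists l', forall u, u != s -> nm u <= rho -> nm (dquo s F u - l') <= B * nm (u - s).
  suff H u v : u != s -> v != s -> nm u <= rho -> nm v <= rho ->
     nm (dquo s F u - dquo s F v) <= B * nm (u - v).
    by have [l' [Hl' _]] := lip_lim sr B0 H; exists l'.
  move=> us vs ur vr.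
  have [->|uv] := eqVneq u v; first by rewrite !subrr Normc.normc0 mulr0.
  apply: dquo_lip => //.
  pose d := rho - nm s; have d0 : 0 < d by rewrite subr_gt0.
  have sd k : nm (seq_to s d k) <= rho.
    by apply: (le_trans (seq_to_le _ _ (ltW d0))); rewrite /d addrC subrK.
  (* F s is a limit of values of dquo s f, so that the second divided
     differences of F with a node at s are limits of third ones of f. *)
  have cF : ((fun k => F (seq_to s d k)) : nat -> R[i]^o) @ \oo --> (F s : R[i]^o).
    rewrite {2}/F eqxx.
    have -> : (fun k => F (seq_to s d k)) = (fun k => dquo s f (seq_to s d k)).
      by apply/funext => k; rewrite /F (negPf (seq_to_neq _ _ d0)).
    by apply: cl; rewrite // /d addrC subrK.
  have cs := @seq_to_cvg s d (ltW d0).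
  have cq w : w != s -> ((fun k => dquo (seq_to s d k) F w) : nat -> R[i]^o) @ \oo
     --> (dquo s F w : R[i]^o).
    move=> ws; apply: cvgC_mul; first by apply: cvgC_sub; [exact: cvgC_cst|].
    apply: cvgC_inv; first by rewrite subr_eq0.
    by apply: cvgC_sub; [exact: cvgC_cst|].
  apply: (@cvg_nm_le _ (fun k => dquo v (dquo (seq_to s d k) F) u)).
    by apply: cvgC_mul; [apply: cvgC_sub; exact: cq | exact: cvgC_cst].
  pose e := Num.min (nm (u - s)) (nm (v - s)).
  have e0 : 0 < e by rewrite lt_min !nm_gt0 !subr_eq0 us.
  move/cvg_seqCP : cs => /(_ e e0)[N HN]; exists N => k Nk.
  have := HN _ Nk; rewrite lt_min => /andP[ku kv].
  have ku' : u != seq_to s d k by apply: contraTneq ku => ->; rewrite nmC ltxx.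
  have kv' : v != seq_to s d k by apply: contraTneq kv => ->; rewrite nmC ltxx.
  have ks := seq_to_neq s k d0.
  have -> : dquo v (dquo (seq_to s d k) F) u
      = dquo v (dquo (seq_to s d k) (dquo s f)) u.
    by rewrite /dquo /F (negPf us) (negPf vs) (negPf ks).
  apply: H3 => //; first exact: ltW.
  rewrite /= !inE !negb_or (eq_sym s) ks (eq_sym s) vs (eq_sym s) us.
  by rewrite (eq_sym _ v) kv' (eq_sym _ u) ku' (eq_sym v) uv.
have [l' Hl'] := Fs.
exists F; last first.
  near=> u; rewrite /F; case: eqVneq => [->|us]; first by rewrite subrr mul0r addr0.
  by rewrite /dquo mulrC divfK ?subr_eq0 // addrC subrK.
apply/nearCP; exists (rho - nm s); first by rewrite subr_gt0.
move=> u us; have [->|us0] := eqVneq u s; first exact: (lip_derivable B0 sr Hl').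
have ur : nm u < rho by have := ler_dist_nm u s; lra.
have dq : derivable ((fun u => (f u - f s) * (u - s)^-1) : R[i]^o -> R[i]^o) u 1.
  apply/derivableCM.
    by apply/derivableCD; [exact: df | exact: derivable_cst].
  apply/derivableCV; first by rewrite subr_eq0.
  by apply/derivableCD; [exact: derivable_id | exact: derivable_cst].
apply/derivableCP; move/derivableCP : dq => [q Hq]; exists q => e /Hq[d d0 Hd].
exists (Num.min d (nm (u - s))); first by rewrite lt_min d0 nm_gt0 subr_eq0.
move=> w wu; rewrite lt_min => /andP[wd ws].
have ws' : w != s by apply: contraTneq ws => ->; rewrite nmC ltxx.
by rewrite /F (negPf ws') (negPf us0); exact: Hd.
Unshelve. all: by end_near. Qed.

End DividedDifferences.

(** * A norm on polynomials, and the exponential function *)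

Section PolynomialNorm.
Variable R : realType.
Local Notation C := (R[i]).
Local Notation nm := (@Normc.normc R).
Implicit Types (p q : {poly C}) (rho : R).

Definition pnorm rho p : R := \sum_(i < size p) nm p`_i * rho ^+ i.

Lemma pnormE rho p n : (size p <= n)%N -> pnorm rho p = \sum_(i < n) nm p`_i * rho ^+ i.
Proof.
move=> pn; rewrite /pnorm (big_ord_widen n (fun i => nm p`_i * rho ^+ i)) //.
rewrite big_mkcond; apply: eq_bigr => i _; case: ltnP => // ip.
by rewrite nth_default // Normc.normc0 mul0r.
Qed.

Lemma pnorm0 rho : pnorm rho 0 = 0.
Proof. by rewrite /pnorm size_poly0 big_ord0. Qed.

Lemma pnorm_ge0 rho p : 0 <= rho -> 0 <= pnorm rho p.
Proof. by move=> r0; apply: sumr_ge0 => i _; rewrite mulr_ge0 ?nm_ge0 ?exprn_ge0. Qed.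

Lemma pnormD rho p q : 0 <= rho -> pnorm rho (p + q) <= pnorm rho p + pnorm rho q.
Proof.
move=> r0; pose n := maxn (size p) (size q).
rewrite (@pnormE _ (p + q) n) ?size_polyD // (@pnormE _ p n) ?leq_maxl //.
rewrite (@pnormE _ q n) ?leq_maxr // -big_split /=; apply: ler_sum => i _.
by rewrite -mulrDl coefD ler_wpM2r ?exprn_ge0 // le_normcD.
Qed.

Lemma pnorm_sum rho (T : Type) (r : seq T) (P : pred T) (f : T -> {poly C}) :
  0 <= rho -> pnorm rho (\sum_(i <- r | P i) f i) <= \sum_(i <- r | P i) pnorm rho (f i).
Proof.
move=> r0; elim/big_rec2: _ => [|i y x _ H]; first by rewrite pnorm0.
by apply: (le_trans (pnormD _ _ r0)); rewrite lerD2l.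
Qed.

Lemma pnormZ rho (c : C) p : 0 <= rho -> pnorm rho (c *: p) <= nm c * pnorm rho p.
Proof.
move=> r0; rewrite (@pnormE _ (c *: p) (size p)) ?size_scale_leq // mulr_sumr.
by apply: ler_sum => i _; rewrite coefZ Normc.normcM mulrA.
Qed.

Lemma pnormXn rho k : pnorm rho 'X^k = rho ^+ k.
Proof.
rewrite /pnorm size_polyXn big_ord_recr /= coefXn eqxx Normc.normc1 mul1r.
rewrite big1 ?add0r // => i _; rewrite coefXn.
by rewrite (ltn_eqF (ltn_ord i)) Normc.normc0 mul0r.
Qed.

Lemma pnormC rho (c : C) : pnorm rho c%:P = nm c.
Proof.
rewrite (@pnormE _ _ 1) ?size_polyC ?leq_b1 // big_ord1 coefC eqxx expr0 mulr1.
by [].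
Qed.

Lemma pnorm1 rho : pnorm rho 1 = 1.
Proof. by rewrite -(Normc.normc1 R) -(pnormC rho). Qed.

Lemma poly_sumE p : p = \sum_(i < size p) p`_i *: 'X^i.
Proof. by rewrite -poly_def coefK. Qed.

Lemma pnormM rho p q : 0 <= rho -> pnorm rho (p * q) <= pnorm rho p * pnorm rho q.
Proof.
move=> r0; rewrite {1}[p]poly_sumE {1}[q]poly_sumE big_distrlr /=.
apply: (le_trans (pnorm_sum _ _ _ r0)).
rewrite /pnorm big_distrlr /=; apply: ler_sum => i _.
apply: (le_trans (pnorm_sum _ _ _ r0)); apply: ler_sum => j _.
rewrite -scalerAl -scalerAr scalerA -exprD.
apply: (le_trans (pnormZ _ _ r0)); rewrite pnormXn Normc.normcM exprD.
by rewrite mulrACA.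
Qed.

Lemma pnorm_exp rho p k : 0 <= rho -> pnorm rho (p ^+ k) <= pnorm rho p ^+ k.
Proof.
move=> r0; elim: k => [|k IH]; first by rewrite !expr0 pnorm1.
rewrite !exprS; apply: (le_trans (pnormM _ _ r0)).
by rewrite ler_wpM2l // pnorm_ge0.
Qed.

Lemma pnorm_prod rho (T : Type) (r : seq T) (P : pred T) (f : T -> {poly C}) :
  0 <= rho -> pnorm rho (\prod_(i <- r | P i) f i) <= \prod_(i <- r | P i) pnorm rho (f i).
Proof.
move=> r0.
suff : 0 <= pnorm rho (\prod_(i <- r | P i) f i) <= \prod_(i <- r | P i) pnorm rho (f i).
  by case/andP.
elim/big_rec2: _ => [|i y x _ /andP[H1 H2]]; first by rewrite pnorm1 lexx ler01.
rewrite pnorm_ge0 //=.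
by apply: (le_trans (pnormM _ _ r0)); rewrite ler_wpM2l // pnorm_ge0.
Qed.

Lemma nm_horner_le rho p x : nm x <= rho -> nm p.[x] <= pnorm rho p.
Proof.
move=> xr; rewrite horner_coef; apply: (le_trans (nm_sum _ _ _)).
apply: ler_sum => i _; rewrite Normc.normcM nmX ler_wpM2l ?nm_ge0 //.
by rewrite lerXn2r ?nnegrE ?nm_ge0 // (le_trans _ xr) ?nm_ge0.
Qed.

(** Dividing by a linear factor whose root lies in the disc costs a factor 2
    in the radius, as n * rho^(n-1) <= (2 * rho)^n. *)
Lemma pnorm_quo rho p x : 1 <= rho -> nm x <= rho ->
  exists2 q, p = p.[x]%:P + ('X - x%:P) * q & pnorm rho q <= pnorm (2 * rho) p.
Proof.
move=> r1 xr; have r0 : 0 <= rho by lra.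
pose q := \sum_(k < size p) p`_k *: \sum_(i < k) ('X^(k.-1 - i) * x%:P ^+ i : {poly C}).
exists q.
  transitivity (\sum_(k < size p) p`_k *: 'X^k); first exact: poly_sumE.
  rewrite /q mulr_sumr horner_coef rmorph_sum -big_split /=; apply: eq_bigr => k _.
  rewrite polyCM polyC_exp -scalerAr -subrXX mul_polyC -scalerDr.
  by rewrite addrC subrK.
apply: (le_trans (pnorm_sum _ _ _ r0)); apply: ler_sum => k _.
apply: (le_trans (pnormZ _ _ r0)); rewrite ler_wpM2l ?nm_ge0 //.
apply: (le_trans (pnorm_sum _ _ _ r0)).
apply: (@le_trans _ _ (\sum_(i < k) rho ^+ k)).
  apply: ler_sum => i _; apply: (le_trans (pnormM _ _ r0)).
  rewrite pnormXn -polyC_exp pnormC nmX.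
  apply: (@le_trans _ _ (rho ^+ (k.-1 - i) * rho ^+ i)).
    rewrite ler_wpM2l ?exprn_ge0 //.
    by rewrite lerXn2r ?nnegrE ?nm_ge0 // (le_trans _ xr) ?nm_ge0.
  rewrite -exprD subnK; last by case: (k : nat) i => [[]|m i] //=; rewrite -ltnS.
  by rewrite ler_weXn2l // leq_pred.
rewrite sumr_const card_ord exprMn -[leLHS]mulr_natl ler_wpM2r ?exprn_ge0 //.
by rewrite -natrX ler_nat ltnW // ltn_expl.
Qed.

(** Three divisions by linear factors, hence the radius 2^3 * rho. *)
Lemma poly_dd_bounded rho p : 1 <= rho ->
  dd_bounded (horner p) rho (pnorm (8 * rho) p).
Proof.
move=> r1.
have dq (s : C) q r f : s != r -> f r = q.[r] -> f s = q.[s] ->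
    forall q', q = q.[s]%:P + ('X - s%:P) * q' -> dquo s f r = q'.[r].
  move=> sr fr fs q' qE; rewrite /dquo fr fs {1}qE !hornerE addrAC subrr add0r.
  by rewrite mulrAC divff ?mul1r // subr_eq0 eq_sym.
split=> [x y u hx hy hu|x y w u hx hy hw hu] /=; rewrite !inE !negb_or.
  move=> /and3P[/andP[xy xu] yu _].
  have [||q0 E0 N0] := @pnorm_quo (4 * rho) p x; [lra|lra|].
  have [||q1 E1 N1] := @pnorm_quo (2 * rho) q0 y; [lra|lra|].
  have -> : dquo y (dquo x (horner p)) u = q1.[u].
    by apply: (dq _ q0) => //; exact: (dq _ p).
  apply: (@le_trans _ _ (pnorm (2 * rho) q1)); first by apply: nm_horner_le; lra.
  apply: (le_trans N1); rewrite mulrA -natrM; apply: (le_trans N0).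
  by rewrite mulrA -natrM.
move=> /and4P[/and3P[xy xw xu] /andP[yw yu] wu _].
have [||q0 E0 N0] := @pnorm_quo (4 * rho) p x; [lra|lra|].
have [||q1 E1 N1] := @pnorm_quo (2 * rho) q0 y; [lra|lra|].
have [||q2 E2 N2] := @pnorm_quo rho q1 w; [lra|lra|].
have h0 v : x != v -> dquo x (horner p) v = q0.[v] by move=> xv; exact: (dq _ p).
have h1 v : x != v -> y != v -> dquo y (dquo x (horner p)) v = q1.[v].
  by move=> xv yv; apply: (dq _ q0) => //; exact: h0.
have -> : dquo w (dquo y (dquo x (horner p))) u = q2.[u].
  by apply: (dq _ q1) => //; exact: h1.
apply: (@le_trans _ _ (pnorm rho q2)); first by apply: nm_horner_le.
apply: (le_trans N2); apply: (le_trans N1); rewrite mulrA -natrM; apply: (le_trans N0).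
by rewrite mulrA -natrM.
Qed.

End PolynomialNorm.

Section ComplexExponential.
Local Open Scope classical_set_scope.
Import numFieldNormedType.Exports.
Variable R : realType.
Local Notation C := (R[i]).
Local Notation nm := (@Normc.normc R).
Implicit Types z w : C.

Lemma CexpD z w : Cexp (z + w) = Cexp z * Cexp w.
Proof.
rewrite /Cexp ReD ImD expRD rmorphM mulrACA; congr (_ * _).
rewrite cosD sinD; simpc; congr (_ +i* _)%C; ring.
Qed.

Lemma Cexp0 : Cexp (0 : C) = 1.
Proof. by rewrite /Cexp /= expR0 cos0 sin0 mulr1. Qed.

Lemma nm_Cexp z : nm (Cexp z) = expR (complex.Re z).
Proof.
rewrite /Cexp Normc.normcM nmR ger0_norm ?expR_ge0 //=.
by rewrite cos2Dsin2 sqrtr1 mulr1.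
Qed.

Lemma Cexp_neq0 z : Cexp z != 0.
Proof. by rewrite -nm_gt0 nm_Cexp expR_gt0. Qed.

Lemma CexpN z : Cexp (- z) = (Cexp z)^-1.
Proof.
by apply: (mulfI (Cexp_neq0 z)); rewrite -CexpD subrr Cexp0 divff ?Cexp_neq0.
Qed.

Lemma Cexp_sum (T : Type) (r : seq T) (P : pred T) (f : T -> C) :
  Cexp (\sum_(i <- r | P i) f i) = \prod_(i <- r | P i) Cexp (f i).
Proof. exact: (big_morph _ CexpD Cexp0). Qed.

Lemma CexpMn z k : Cexp (k%:R * z) = Cexp z ^+ k.
Proof.
rewrite mulr_natl; elim: k => [|k IH]; first by rewrite mulr0n Cexp0.
by rewrite mulrS CexpD IH exprS.
Qed.

Lemma Cexp_real (x : R) : Cexp x%:C%C = (expR x)%:C%C.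
Proof. by rewrite /Cexp /= cos0 sin0 mulr1. Qed.

Lemma derive_seq (phi : R -> R) (l : R) : is_derive (0 : R) (1 : R) phi l ->
  (fun m => m.+1%:R * (phi m.+1%:R^-1 - phi 0)) @ \oo --> l.
Proof.
move=> [d dE]; have : h^-1 *: ((phi \o shift 0) (h *: 1) - phi 0) @[h --> 0^'] --> l.
  by rewrite -dE; exact: d.
move=> /cvgrPdist_lt H; apply/cvgrPdist_lt => e /H.
rewrite /dnbhs near_withinE => /nbhs_ballP[r /= r0 Hr].
have [N HN] := inv_nat_lt r0; exists N => // m /HN mr.
have m0 : 0 < m.+1%:R^-1 :> R by rewrite invr_gt0 ltr0n.
have := Hr m.+1%:R^-1; rewrite /ball /= sub0r normrN gtr0_norm // => /(_ mr).
by rewrite gt_eqF // => /(_ isT); rewrite invrK addr0 /GRing.scale /= mulr1.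
Qed.

(** The approximation by polynomials through which the norm bounds reach the
    exponential function. *)
Lemma Cexp_lim z :
  ((fun m => (1 + z / m.+1%:R) ^+ m.+1) : nat -> R[i]^o) @ \oo --> (Cexp z : R[i]^o).
Proof.
case: z => x y; set z : C := (x +i* y)%C.
have dx : is_derive (0 : R) (1 : R) (fun t : R => expR (x * t) * cos (y * t)) x.
  apply: is_derive_eq.
  by rewrite !mulr0 expR0 cos0 sin0 /GRing.scale /=; ring.
have dy : is_derive (0 : R) (1 : R) (fun t : R => expR (x * t) * sin (y * t)) y.
  apply: is_derive_eq.
  by rewrite !mulr0 expR0 cos0 sin0 /GRing.scale /=; ring.
apply/cvg_seqCP => e e0.
have eqle (u v : R) : u = v -> u <= v by move=> ->.
pose K := expR (nm z).
have K0 : 0 < K by exact: expR_gt0.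
have e' : 0 < e / K / 2 by rewrite !divr_gt0.
have /cvgrPdist_lt/(_ _ e')[N1 _ H1] := derive_seq dx.
have /cvgrPdist_lt/(_ _ e')[N2 _ H2] := derive_seq dy.
exists (maxn N1 N2) => m; rewrite geq_max => /andP[/H1 + /H2] {H1 H2}.
rewrite !mulr0 expR0 cos0 sin0 !mulr1 !mulr0 !subr0.
set M : R := m.+1%:R => h1 h2.
have M0 : 0 < M by rewrite ltr0n.
have zM : z / m.+1%:R = (x / M +i* (y / M))%C.
  have -> : (m.+1%:R : C)^-1 = (M^-1)%:C%C by rewrite fmorphV rmorph_nat.
  by rewrite /z; simpc.
pose a := 1 + z / m.+1%:R; pose b := Cexp (z / m.+1%:R).
have bz : b ^+ m.+1 = Cexp z by rewrite /b -CexpMn mulrC divfK // pnatr_eq0.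
have ab : M * nm (b - a) < e / K.
  have -> : M * nm (b - a) = nm (M%:C%C * (b - a)).
    by rewrite Normc.normcM nmR gtr0_norm.
  apply: (le_lt_trans (nm_le_ReIm _)); rewrite [e / K]splitr.
  rewrite /a /b zM /Cexp /=; apply: ltrD.
    apply: le_lt_trans h1; rewrite -normrN; apply: eqle; congr (`| _ |).
    rewrite !(mul0r, mulr0, subr0, addr0, sub0r, add0r, oppr0); field; lra.
  apply: le_lt_trans h2; rewrite -normrN; apply: eqle; congr (`| _ |).
  rewrite !(mul0r, mulr0, subr0, addr0, sub0r, add0r, oppr0); field; lra.
pose E := expR (nm z / M).
have nz : nm (z / m.+1%:R) = nm z / M by rewrite Normc.normcM Normc.normcV nm_nat.
have aE : nm a <= E.
  apply: (le_trans (le_normcD _ _)); rewrite Normc.normc1 nz.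
  exact: expR_ge1Dx.
have bE : nm b <= E.
  rewrite nm_Cexp ler_expR -nz; apply: le_trans (Re_le_nm _); exact: ler_norm.
have EK : E ^+ m.+1 = K.
  by rewrite /E /K -expRM_natl mulrC divfK // gt_eqF.
have E1 : 1 <= E by rewrite -expR0 ler_expR divr_ge0 ?nm_ge0 // ltW.
have E0 : 0 <= E by lra.
rewrite -bz -/a subrXX Normc.normcM.
apply: (@le_lt_trans _ _ (nm (b - a) * (M * K))).
  rewrite ler_wpM2l ?nm_ge0 //; apply: (le_trans (nm_sum _ _ _)).
  apply: (@le_trans _ _ (\sum_(i < m.+1) K)); last first.
    by rewrite sumr_const card_ord mulr_natl.
  apply: ler_sum => i _; rewrite Normc.normcM !nmX -EK.
  apply: (@le_trans _ _ (E ^+ m)); last by rewrite ler_weXn2l.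
  rewrite -[in leRHS](@subnK i m); last by rewrite -ltnS.
  rewrite exprD /= ler_pM ?exprn_ge0 ?nm_ge0 //.
    by rewrite lerXn2r // nnegrE ?nm_ge0.
  by rewrite lerXn2r // nnegrE ?nm_ge0.
by rewrite mulrA -ltr_pdivlMr // mulrC.
Qed.

End ComplexExponential.

(** * The Gamma function *)

Section GammaFunction.
Local Open Scope classical_set_scope.
Import numFieldNormedType.Exports.
Variable R : realType.
Local Notation C := (R[i]).
Local Notation nm := (@Normc.normc R).
Implicit Types z : C.

Definition lnstep (k : nat) : R := ln (k.+2%:R / k.+1%:R).

Lemma lnstep_le k : lnstep k <= k.+1%:R^-1.
Proof.
have k0 : 0 < k.+1%:R :> R by rewrite ltr0n.
rewrite /lnstep -[leRHS]expRK ler_ln ?posrE ?expR_gt0 ?divr_gt0 ?ltr0n //.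
apply: le_trans (expR_ge1Dx _); rewrite ler_pdivrMr // mulrDl mulVf ?gt_eqF //.
by rewrite mul1r -natr1.
Qed.

Lemma lnstep_ge k : k.+2%:R^-1 <= lnstep k.
Proof.
have k0 : 0 < k.+1%:R :> R by rewrite ltr0n.
have k1 : 0 < k.+2%:R :> R by rewrite ltr0n.
rewrite -lerN2 /lnstep -lnV ?posrE ?divr_gt0 // invf_div -[leRHS]expRK.
rewrite ler_ln ?posrE ?expR_gt0 ?divr_gt0 ?ltr0n //.
apply: le_trans (expR_ge1Dx _); rewrite ler_pdivrMr // mulrDl mulNr mulVf ?gt_eqF //.
by rewrite mul1r -[k.+2%:R]natr1 addrK.
Qed.

Lemma expR_lnstep k : expR (lnstep k) = k.+2%:R / k.+1%:R.
Proof. by rewrite /lnstep lnK // posrE divr_gt0 ?ltr0n. Qed.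

Lemma lnstepE k : ln k.+2%:R = ln k.+1%:R + lnstep k :> R.
Proof. by rewrite /lnstep ln_div ?posrE ?ltr0n // addrC subrK. Qed.

(** The quotient of consecutive terms of the Euler-Gauss sequence, inverted. *)
Definition gstep (k : nat) (z : C) : C :=
  (1 + z / k.+2%:R) * Cexp (- (lnstep k)%:C%C * z).

Definition gseq (k : nat) (z : C) : C := z * (1 + z) * \prod_(j < k) gstep j z.

(* Polynomial approximations, by Cexp_lim with exponent m.+1. *)
Definition gstepp (m k : nat) : {poly C} :=
  (1 + k.+2%:R^-1 *: 'X) * (1 - ((lnstep k)%:C%C / m.+1%:R) *: 'X) ^+ m.+1.

Definition gseqp (m k : nat) : {poly C} :=
  'X * (1 + 'X) * \prod_(j < k) gstepp m j.

(** An expansion to second order; for c = l / n the norm of the remainder stays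
    bounded as n grows. *)
Lemma pow_expansion (c : C) (rho : R) n : 0 <= rho ->
  exists2 r : {poly C}, (1 - c *: 'X) ^+ n = 1 - (n%:R * c) *: 'X + c ^+ 2 *: ('X ^+ 2 * r)
    & pnorm rho r <= n%:R ^+ 2 * (1 + nm c * rho) ^+ n.
Proof.
move=> r0; have E1 : 1 <= 1 + nm c * rho by rewrite lerDl mulr_ge0 ?nm_ge0.
elim: n => [|n [r rE rn]].
  exists 0; last by rewrite pnorm0 expr0n mul0r.
  by rewrite expr0 mul0r scale0r subr0 mulr0 scaler0 addr0.
exists (n%:R%:P + (1 - c *: 'X) * r).
  rewrite exprS rE -!mul_polyC -[n.+1%:R]natr1 !polyCM polyCD polyC1.
  by ring.
apply: (le_trans (pnormD _ _ r0)); rewrite pnormC nm_nat.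
have N1 : pnorm rho (1 - c *: 'X) <= 1 + nm c * rho.
  apply: (le_trans (pnormD _ _ r0)); rewrite pnorm1 lerD2l -scaleNr.
  by apply: (le_trans (pnormZ _ _ r0)); rewrite normcN -['X]expr1 pnormXn.
have En : 1 <= (1 + nm c * rho) ^+ n.+1 by rewrite exprn_ege1.
apply: (@le_trans _ _ (n%:R * (1 + nm c * rho) ^+ n.+1
    + n%:R ^+ 2 * (1 + nm c * rho) ^+ n.+1)).
  apply: lerD; first by rewrite ler_peMr.
  apply: (le_trans (pnormM _ _ r0)); rewrite [_ ^+ n.+1]exprS mulrCA.
  by apply: ler_pM => //; exact: pnorm_ge0.
rewrite -mulrDl ler_wpM2r //; first by apply: le_trans En.
by rewrite -natr1; have : 0 <= n%:R :> R by []; nra.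
Qed.

Definition gbound (rho : R) : R :=
  rho + (expR rho + 1) * rho ^+ 2 + expR rho * rho ^+ 3.

Lemma gbound_ge0 rho : 0 <= rho -> 0 <= gbound rho.
Proof.
by move=> r0; rewrite /gbound !addr_ge0 ?mulr_ge0 ?exprn_ge0 ?addr_ge0 ?expR_ge0.
Qed.

(** The linear terms cancel up to O(1/k^2); this makes the Euler-Gauss
    product converge. *)
Lemma gstepp_bound rho m k : 0 <= rho ->
  pnorm rho (gstepp m k - 1) <= gbound rho / k.+1%:R ^+ 2.
Proof.
move=> r0; pose l := lnstep k; pose b : R := k.+2%:R^-1; pose t : R := k.+1%:R^-1.
pose M : R := m.+1%:R; have M0 : 0 < M by rewrite ltr0n.
have M0' := ltW M0.
have b0 : 0 <= b by rewrite invr_ge0.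
have bl : b <= l by exact: lnstep_ge.
have lt : l <= t by exact: lnstep_le.
have k0 : 0 < k.+1%:R :> R by rewrite ltr0n.
have t1 : t <= 1 by rewrite invf_le1 // ler1n.
have tb : t - b <= t ^+ 2.
  have -> : t - b = t * b.
    rewrite /t /b; have : k.+2%:R = 1 + k.+1%:R :> R by rewrite -natr1 addrC.
    move=> ->; move: k0; move: (k.+1%:R) => x x0; field; rewrite ?gt_eqF //; lra.
  by rewrite expr2 ler_wpM2l //; lra.
have Mc : (m.+1%:R : C) = M%:C%C by rewrite rmorph_nat.
have [r rE rn] := @pow_expansion (l%:C%C / m.+1%:R) rho m.+1 r0.
have nc : nm (l%:C%C / m.+1%:R) = l / M.
  by rewrite Normc.normcM Normc.normcV nm_nat nmR ger0_norm //; lra.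
have rn' : M ^+ 2 * pnorm rho r <= M ^+ 4 * expR rho.
  rewrite (_ : M ^+ 4 = M ^+ 2 * M ^+ 2); last by rewrite -exprD.
  rewrite -mulrA ler_wpM2l ?exprn_ge0 //; apply: (le_trans rn).
  rewrite ler_wpM2l ?exprn_ge0 // nc.
  apply: (@le_trans _ _ (expR (rho / M) ^+ m.+1)).
    rewrite lerXn2r ?nnegrE ?expR_ge0 //.
      by rewrite addr_ge0 // mulr_ge0 // divr_ge0 //; lra.
    apply: le_trans (expR_ge1Dx _); rewrite lerD2l mulrAC ler_wpM2r ?invr_ge0 //.
    by rewrite ler_piMl //; lra.
  by rewrite -expRM_natl mulrC divfK // gt_eqF.
have {}rn' : (l / M) ^+ 2 * pnorm rho r <= t ^+ 2 * expR rho.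
  have {}rn' : M ^- 2 * pnorm rho r <= expR rho.
    rewrite -(@ler_pM2l _ (M ^+ 4)) ?exprn_gt0 // mulrA.
    by rewrite (_ : M ^+ 4 * M ^- 2 = M ^+ 2) //; field; rewrite gt_eqF.
  rewrite exprMn exprVn -mulrA; apply: ler_pM => //; rewrite ?exprn_ge0 //.
  - by lra.
  - by rewrite mulr_ge0 ?invr_ge0 ?exprn_ge0 ?pnorm_ge0 //.
  - by rewrite lerXn2r ?nnegrE //; lra.
have bC : (k.+2%:R^-1 : C) = b%:C%C by rewrite /b fmorphV rmorph_nat.
have -> : gstepp m k - 1 = (b - l)%:C%C *: 'X - (b * l)%:C%C *: 'X^2
    + ((l%:C%C / m.+1%:R) ^+ 2 *: ('X^2 * r) + (b%:C%C * (l%:C%C / m.+1%:R) ^+ 2) *: ('X^3 * r)).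
  rewrite /gstepp rE bC -/l.
  have -> : m.+1%:R * (l%:C%C / m.+1%:R) = l%:C%C by rewrite mulrC divfK // pnatr_eq0.
  rewrite rmorphB rmorphM -!mul_polyC polyCB !polyCM /=; ring.
have nX j : pnorm rho ('X^j * r) <= rho ^+ j * pnorm rho r.
  by apply: (le_trans (pnormM _ _ r0)); rewrite pnormXn.
apply: (@le_trans _ _ ((l - b) * rho + b * l * rho ^+ 2
   + ((l / M) ^+ 2 * (rho ^+ 2 * pnorm rho r) + b * (l / M) ^+ 2 * (rho ^+ 3 * pnorm rho r)))).
  apply: (le_trans (pnormD _ _ r0)); apply: lerD.
    apply: (le_trans (pnormD _ _ r0)); apply: lerD.
      apply: (le_trans (pnormZ _ _ r0)); rewrite nmR -[X in pnorm _ X]expr1 pnormXn expr1.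
      by rewrite ler0_norm ?subr_le0 // opprB.
    rewrite -scaleNr; apply: (le_trans (pnormZ _ _ r0)); rewrite normcN nmR pnormXn.
    by rewrite ger0_norm // mulr_ge0 //; lra.
  apply: (le_trans (pnormD _ _ r0)); apply: lerD.
    apply: (le_trans (pnormZ _ _ r0)); rewrite nmX nc ler_wpM2l ?exprn_ge0 //.
    by rewrite divr_ge0 //; lra.
  apply: (le_trans (pnormZ _ _ r0)); rewrite Normc.normcM nmX nc nmR ger0_norm //.
  by rewrite ler_wpM2l // mulr_ge0 // exprn_ge0 // divr_ge0 //; lra.
move: rn' (pnorm_ge0 r r0); rewrite -exprVn -/t /gbound.
set L := (l / M) ^+ 2; set N := pnorm rho r; set e := expR rho => LN N0.
have e0 : 0 <= e by exact: expR_ge0.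
have bl2 : b * l <= t ^+ 2 by rewrite expr2 ler_pM //; lra.
have -> : L * (rho ^+ 2 * N) = (L * N) * rho ^+ 2 by ring.
have -> : b * L * (rho ^+ 3 * N) = b * (L * N) * rho ^+ 3 by ring.
have h1 : (l - b) * rho <= t ^+ 2 * rho by rewrite ler_wpM2r //; lra.
have h2 : b * l * rho ^+ 2 <= t ^+ 2 * rho ^+ 2 by rewrite ler_wpM2r ?exprn_ge0.
have h3 : L * N * rho ^+ 2 <= t ^+ 2 * e * rho ^+ 2 by rewrite ler_wpM2r ?exprn_ge0.
have LN0 : 0 <= L * N by rewrite mulr_ge0 // exprn_ge0 // divr_ge0 //; lra.
have h4 : b * (L * N) * rho ^+ 3 <= t ^+ 2 * e * rho ^+ 3.
  rewrite ler_wpM2r ?exprn_ge0 //; apply: le_trans LN.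
  by rewrite ler_piMl //; lra.
have -> : (rho + (e + 1) * rho ^+ 2 + e * rho ^+ 3) * t ^+ 2 =
  t ^+ 2 * rho + t ^+ 2 * rho ^+ 2 + (t ^+ 2 * e * rho ^+ 2 + t ^+ 2 * e * rho ^+ 3) by ring.
by rewrite !lerD.
Qed.

Lemma sum_inv_sq m l : (m <= l)%N ->
  \sum_(m <= j < l) j.+1%:R ^- 2 <= 2 / m.+1%:R - 2 / l.+1%:R :> R.
Proof.
elim: l => [|l IH]; first by rewrite leqn0 => /eqP->; rewrite big_geq // subrr.
rewrite leq_eqVlt => /orP[/eqP->|]; first by rewrite big_geq // subrr.
rewrite ltnS => ml; rewrite big_nat_recr //=.
have := IH ml; have l0 : 0 < l.+1%:R :> R by rewrite ltr0n.
have : l.+1%:R ^- 2 <= 2 / l.+1%:R - 2 / l.+2%:R :> R.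
  have -> : l.+2%:R = 1 + l.+1%:R :> R by rewrite -natr1 addrC.
  have : 1 <= l.+1%:R :> R by rewrite ler1n.
  move: l0; move: (l.+1%:R) => x x0 x1.
  have y0 : 0 < 1 + x by lra.
  have -> : 2 / x - 2 / (1 + x) = 2 / (x * (1 + x)).
    by field; rewrite (gt_eqF y0) (gt_eqF x0).
  rewrite ler_pdivlMr; last by rewrite mulr_gt0.
  rewrite mulrC ler_pdivrMr ?exprn_gt0 // expr2; nra.
set u := l.+1%:R ^- 2; set v := 2 / l.+1%:R; set w := 2 / l.+2%:R.
set x := 2 / m.+1%:R; set S := \sum_(_ <= _ < _) _.
by clearbody u v w x S; lra.
Qed.

Lemma sum_inv_sq2 m l : \sum_(m <= j < l) j.+1%:R ^- 2 <= 2 / m.+1%:R :> R.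
Proof.
have [ml|lm] := leqP m l; last by rewrite big_geq ?divr_ge0 // ltnW.
by apply: (le_trans (sum_inv_sq ml)); rewrite gerBl divr_ge0.
Qed.

Lemma prod_le_exp (K : R) m l : 0 <= K ->
  \prod_(m <= j < l) (1 + K / j.+1%:R ^+ 2) <= expR (2 * K).
Proof.
move=> K0; apply: (@le_trans _ _ (expR (\sum_(m <= j < l) K / j.+1%:R ^+ 2))).
  rewrite expR_sum; apply: ler_prod => j _; rewrite expR_ge1Dx andbT.
  by rewrite addr_ge0 // divr_ge0 ?exprn_ge0.
rewrite ler_expR -mulr_sumr mulrC ler_wpM2r //.
apply: (le_trans (sum_inv_sq2 _ _)); rewrite ler_pdivrMr ?ltr0n // ler_peMr //.
by rewrite ler1n.
Qed.

Lemma gstepp_horner m k z :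
  (gstepp m k).[z] = (1 + z / k.+2%:R) * (1 + (- (lnstep k)%:C%C * z) / m.+1%:R) ^+ m.+1.
Proof.
rewrite /gstepp hornerM horner_exp !hornerE /=; congr (_ * _ ^+ _); ring.
Qed.

Lemma gstepp_cvg k z :
  ((fun m => (gstepp m k).[z]) : nat -> R[i]^o) @ \oo --> (gstep k z : R[i]^o).
Proof.
under eq_fun do rewrite gstepp_horner.
by apply: cvgC_mul; [exact: cvgC_cst | exact: Cexp_lim].
Qed.

Lemma gseqp_cvg k z :
  ((fun m => (gseqp m k).[z]) : nat -> R[i]^o) @ \oo --> (gseq k z : R[i]^o).
Proof.
under eq_fun do rewrite /gseqp !hornerM hornerD hornerC hornerX horner_prod.
apply: cvgC_mul; first exact: cvgC_cst.
elim: k => [|k IH].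
  under eq_fun do rewrite big_ord0; rewrite big_ord0; exact: cvgC_cst.
under eq_fun do rewrite big_ord_recr /=; rewrite big_ord_recr /=.
by apply: cvgC_mul; [exact: IH | exact: gstepp_cvg].
Qed.

Lemma gstep_bound z k : nm (gstep k z - 1) <= gbound (nm z) / k.+1%:R ^+ 2.
Proof.
apply: (@cvg_nm_le _ (fun m => (gstepp m k - 1).[z])).
  under eq_fun do rewrite hornerD hornerN hornerC.
  by apply: cvgC_sub; [exact: gstepp_cvg | exact: cvgC_cst].
exists 0%N => m _; apply: (le_trans _ (gstepp_bound m k (nm_ge0 z))).
exact: nm_horner_le.
Qed.

Definition gseq_bound (rho : R) : R := rho * (1 + rho) * expR (2 * gbound rho).

Lemma gseqp_bound rho m k : 0 <= rho -> pnorm rho (gseqp m k) <= gseq_bound rho.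
Proof.
move=> r0; rewrite /gseqp /gseq_bound.
have nX : pnorm rho 'X = rho by rewrite -['X]expr1 pnormXn expr1.
have n1X : pnorm rho (1 + 'X) <= 1 + rho.
  by apply: (le_trans (pnormD _ _ r0)); rewrite pnorm1 nX.
apply: (le_trans (pnormM _ _ r0)); apply: ler_pM; rewrite ?pnorm_ge0 //.
  by apply: (le_trans (pnormM _ _ r0)); rewrite nX ler_wpM2l.
apply: (le_trans (pnorm_prod _ _ _ r0)).
apply: (le_trans _ (prod_le_exp 0 k (gbound_ge0 r0))); rewrite big_mkord.
apply: ler_prod => j _; rewrite pnorm_ge0 //=.
rewrite -[gstepp m j](subrK 1) [_ - 1 + 1]addrC.
by apply: (le_trans (pnormD _ _ r0)); rewrite pnorm1 lerD2l gstepp_bound.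
Qed.

Lemma gseq_le z k : nm (gseq k z) <= gseq_bound (nm z).
Proof.
apply: (@cvg_nm_le _ (fun m => (gseqp m k).[z])); first exact: gseqp_cvg.
exists 0%N => m _.
by apply: (le_trans _ (gseqp_bound m k (nm_ge0 z))); exact: nm_horner_le.
Qed.

Lemma gseqS k z : gseq k.+1 z = gseq k z * gstep k z.
Proof. by rewrite /gseq big_ord_recr mulrA. Qed.

Lemma gseq_is_cvg z : exists l : C,
  ((gseq^~ z) : nat -> R[i]^o) @ \oo --> (l : R[i]^o).
Proof.
pose D := gseq_bound (nm z) * gbound (nm z) * 2.
have B0 : 0 <= gseq_bound (nm z) by apply: le_trans (gseq_le z 0); exact: nm_ge0.
have [k l kl|l Hl] := @seqC_complete _ (gseq^~ z) D; last first.
  by exists l; exact: (@cvg_seq_rate _ _ (2 * D)).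
apply: (@le_trans _ _ (\sum_(k <= j < l) (gseq_bound (nm z) * gbound (nm z)) * j.+1%:R ^- 2)).
  elim: l kl => [|l IH]; first by rewrite leqn0 => /eqP->; rewrite big_geq // subrr Normc.normc0.
  rewrite leq_eqVlt => /orP[/eqP->|]; first by rewrite big_geq // subrr Normc.normc0.
  rewrite ltnS => kl; rewrite big_nat_recr //=.
  have -> : gseq l.+1 z - gseq k z = gseq l z - gseq k z + gseq l z * (gstep l z - 1).
    by rewrite gseqS; ring.
  apply: (le_trans (le_normcD _ _)); apply: lerD; first exact: IH.
  rewrite Normc.normcM -mulrA; apply: ler_pM; rewrite ?nm_ge0 ?gseq_le //.
  exact: gstep_bound.
rewrite -mulr_sumr /D -[_ * 2 / _]mulrA; apply: ler_wpM2l; last exact: sum_inv_sq2.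
by rewrite mulr_ge0 ?gbound_ge0 ?nm_ge0.
Qed.

Definition gpole z := exists m : nat, z = - m%:R.

Lemma gstep_neq0 k z : ~ gpole z -> gstep k z != 0.
Proof.
move=> np; rewrite mulf_neq0 ?Cexp_neq0 //; apply/eqP => H; apply: np; exists k.+2.
have k0 : k.+2%:R != 0 :> C by rewrite pnatr_eq0.
have -> : z = z / k.+2%:R * k.+2%:R by rewrite divfK.
by rewrite -[z / _](addKr 1) H addr0 mulN1r.
Qed.

Lemma gseq_neq0 k z : ~ gpole z -> gseq k z != 0.
Proof.
move=> np; rewrite !mulf_neq0 //.
- by apply/eqP => z0; apply: np; exists 0%N; rewrite oppr0.
- by apply/eqP => z0; apply: np; exists 1%N; rewrite -[z](addKr 1) z0 addr0.
by apply/prodf_neq0 => j _; exact: gstep_neq0.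
Qed.

Lemma weierstrass_ineq (e : nat -> R) m l : (forall j, 0 <= e j) ->
  \sum_(m <= j < l) e j <= 1 ->
  1 - \sum_(m <= j < l) e j <= \prod_(m <= j < l) (1 - e j).
Proof.
move=> e0; elim: l => [|l IH]; first by rewrite !big_geq // subr0.
have [ml|ml] := leqP m l; last by rewrite !big_geq // subr0.
rewrite !big_nat_recr //=; have : 0 <= \sum_(m <= j < l) e j by exact: sumr_ge0.
move: IH; set S := \sum_(_ <= _ < _) _; set P := \prod_(_ <= _ < _) _ => IH S0 H.
have := e0 l => el; have /IH : S <= 1 by lra.
by move=> SP; nra.
Qed.

(** 1/Gamma has no zero besides the poles of Gamma: all but finitely many
    factors of the product are so close to 1 that the tail stays above 1/2. *)
Lemma gseq_lim_neq0 z l : ~ gpole z ->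
  ((gseq^~ z) : nat -> R[i]^o) @ \oo --> (l : R[i]^o) -> l != 0.
Proof.
move=> np cl; pose K := gbound (nm z); have K0 : 0 <= K by rewrite gbound_ge0 ?nm_ge0.
(* N is such that the deviations from 1 beyond it add up to at most 1/2 *)
have e0 : 0 < (4 * (K + 1))^-1 by rewrite invr_gt0; lra.
have [N /(_ N (leqnn _)) HN] := inv_nat_lt e0.
have sumN k : \sum_(N <= j < k) K / j.+1%:R ^+ 2 <= 1 / 2.
  rewrite -mulr_sumr; apply: (le_trans (ler_wpM2l K0 (sum_inv_sq2 _ _))).
  have : N.+1%:R^-1 * (4 * (K + 1)) <= 1 :> R.
    by rewrite -ler_pdivlMr ?div1r ?ltW //; lra.
  have : 0 <= N.+1%:R^-1 :> R by rewrite invr_ge0.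
  by move: (N.+1%:R^-1) => v; nra.
rewrite -nm_gt0; apply: (@lt_le_trans _ _ (nm (gseq N z) / 2)).
  by rewrite divr_gt0 // nm_gt0 gseq_neq0.
apply: (@cvg_nm_ge _ (gseq^~ z)); first exact: cl.
exists N => k Nk.
have -> : nm (gseq k z) = nm (gseq N z) * \prod_(N <= j < k) nm (gstep j z).
  elim: k Nk => [|k IH]; first by rewrite leqn0 => /eqP->; rewrite big_geq // mulr1.
  rewrite leq_eqVlt => /orP[/eqP->|]; first by rewrite big_geq // mulr1.
  by rewrite ltnS => Nk; rewrite gseqS Normc.normcM IH // big_nat_recr //= mulrA.
rewrite ler_wpM2l ?nm_ge0 //.
have H := @weierstrass_ineq (fun j => K / j.+1%:R ^+ 2) N k.
apply: (@le_trans _ _ (\prod_(N <= j < k) (1 - K / j.+1%:R ^+ 2))).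
  apply: le_trans (H _ _); rewrite ?(le_trans (sumN k)) //; first 1 last.
  - by move=> j; rewrite divr_ge0 // exprn_ge0.
  - by lra.
  by have := sumN k; lra.
rewrite big_seq [leRHS]big_seq; apply: ler_prod => j.
rewrite mem_index_iota => /andP[Nj jk]; apply/andP; split.
  have := sumN j.+1; rewrite big_nat_recr //=.
  have : 0 <= \sum_(N <= i < j) K / i.+1%:R ^+ 2.
    by apply: sumr_ge0 => i _; rewrite divr_ge0 // exprn_ge0.
  by move: (\sum_(_ <= _ < _) _) (K / _) => a b; lra.
have := ler_dist_nm 1 (gstep j z); rewrite Normc.normc1 nmC.
by have := gstep_bound z j; rewrite -/K; move: (K / _) => b; lra.
Qed.

Lemma gamma_termE k z :
  k.+1`!%:R * Cpow ((ln (k.+1%:R : R))%:C)%C z / \prod_(j < k.+2) (z + j%:R)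
  = (gseq k z)^-1.
Proof.
elim: k => [|k IH].
  rewrite !big_ord_recr big_ord0 /= /gseq big_ord0 ln1 /Cpow mulr0 Cexp0 !mul1r !mulr1.
  by rewrite addr0 [1 + z]addrC.
have -> : Cpow ((ln (k.+2%:R : R))%:C)%C z =
    Cpow ((ln (k.+1%:R : R))%:C)%C z * Cexp (z * (lnstep k)%:C%C).
  by rewrite /Cpow lnstepE rmorphD mulrDr CexpD.
rewrite gseqS invfM -IH big_ord_recr /= factS natrM.
rewrite /gstep mulNr CexpN [(_)%:C%C * z]mulrC /Cpow.
set E := Cexp (z * (lnstep k)%:C%C); set E' := Cexp _; set P := \prod_(j < k.+2) _.
have k0 : k.+2%:R != 0 :> C by rewrite pnatr_eq0.
have -> : 1 + z / k.+2%:R = (z + k.+2%:R) / k.+2%:R by rewrite mulrDl divff // addrC.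
by rewrite (invfM P) (invfM _ E^-1) invrK invf_div; ring.
Qed.

Lemma cvg_shift1 (a : nat -> C) (l : C) :
  ((fun k => a k.+1) : nat -> R[i]^o) @ \oo --> (l : R[i]^o) ->
  (a : nat -> R[i]^o) @ \oo --> (l : R[i]^o).
Proof.
move=> /cvg_seqCP H; apply/cvg_seqCP => e /H[N HN].
by exists N.+1 => [[|k]] //; rewrite ltnS; exact: HN.
Qed.

Lemma cvgC_lim (a : nat -> C) (l : C) :
  (a : nat -> R[i]^o) @ \oo --> (l : R[i]^o) ->
  lim ((a : nat -> R[i]^o) @ \oo) = l.
Proof. by move/cvg_lim; apply. Qed.

Lemma cvgC_uniq (a : nat -> C) (l l' : C) :
  (a : nat -> R[i]^o) @ \oo --> (l : R[i]^o) ->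
  (a : nat -> R[i]^o) @ \oo --> (l' : R[i]^o) -> l = l'.
Proof. by move=> /cvgC_lim <- /cvgC_lim. Qed.

Lemma gseq_pole (m k : nat) : (m < k)%N -> gseq k (- m%:R) = 0.
Proof.
case: m => [|[|m]] mk; rewrite /gseq; first by rewrite oppr0 !mul0r.
  by rewrite subrr mulr0 mul0r.
have mk' : (m < k)%N by lia.
have g0 : gstep m (- m.+2%:R) = 0.
  by rewrite /gstep [- _ / _]mulNr divff ?pnatr_eq0 // subrr mul0r.
by rewrite (bigD1 (Ordinal mk')) //= g0 mul0r mulr0.
Qed.

(** The Euler-Gauss limit in inverted form: it then converges at every z, the
    poles included. *)
Lemma gseq_cvg z :
  ((gseq^~ z) : nat -> R[i]^o) @ \oo --> ((Gamma z)^-1 : R[i]^o).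
Proof.
have [l cl] := gseq_is_cvg z.
suff -> : (Gamma z)^-1 = l by [].
have [[m zm]|np] := pselect (gpole z).
  have -> : l = 0.
    apply: (cvgC_uniq cl); apply/cvg_seqCP => e e0; exists m.+1 => k mk.
    by rewrite zm gseq_pole // subrr Normc.normc0.
  suff -> : Gamma z = 0 by rewrite invr0.
  apply: cvgC_lim; apply: cvg_shift1; apply/cvg_seqCP => e e0; exists m.+1 => k mk.
  by rewrite gamma_termE zm gseq_pole // invr0 subrr Normc.normc0.
suff -> : Gamma z = l^-1 by rewrite invrK.
apply: cvgC_lim; apply: cvg_shift1.
under eq_fun do rewrite gamma_termE.
by apply: cvgC_inv; [exact: gseq_lim_neq0 np cl | exact: cl].
Qed.

Lemma Gamma_neq0 z : ~ gpole z -> Gamma z != 0.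
Proof.
move=> np; rewrite -invr_eq0.
by apply: (@gseq_lim_neq0 z) => //; exact: gseq_cvg.
Qed.

Lemma dd_bounded_le (f : C -> C) rho B B' : B <= B' ->
  dd_bounded f rho B -> dd_bounded f rho B'.
Proof.
move=> BB [H2 H3]; split=> [x y u *|x y w u *].
  by apply: le_trans BB; exact: H2.
by apply: le_trans BB; exact: H3.
Qed.

(** The approximating polynomials obey one norm bound on each disc, uniformly
    in m and k, and the resulting bound on divided differences survives both
    limits. *)
Lemma nice_invGamma s : nice (fun z => (Gamma z)^-1) s.
Proof.
pose rho := nm s + 1; have rho1 : 1 <= rho by rewrite lerDr nm_ge0.
have r0 : 0 <= 8 * rho by lra.
apply: (@dd_nice _ _ rho (gseq_bound (8 * rho))); last by rewrite ltrDl.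
  by rewrite !mulr_ge0 ?expR_ge0 //; lra.
apply: (dd_bounded_lim gseq_cvg) => k.
apply: (@dd_bounded_lim _ (fun m => horner (gseqp m k))) => [x|m]; first exact: gseqp_cvg.
by apply: dd_bounded_le (poly_dd_bounded _ rho1); exact: gseqp_bound.
Qed.

Lemma nice_Gamma s : ~ gpole s -> nice (@Gamma R) s.
Proof.
move=> np; have := nice_inv (nice_invGamma s).
rewrite invr_eq0 Gamma_neq0 // => /(_ isT); apply: nice_near.
by near=> u; rewrite invrK.
Unshelve. all: by end_near. Qed.

Lemma nice_Cexp s : nice (@Cexp R) s.
Proof.
pose rho := nm s + 1; have rho1 : 1 <= rho by rewrite lerDr nm_ge0.
have r0 : 0 <= 8 * rho by lra.
apply: (@dd_nice _ _ rho (expR (8 * rho))); last by rewrite ltrDl.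
  exact: expR_ge0.
apply: (@dd_bounded_lim _ (fun m => horner ((1 + m.+1%:R^-1 *: 'X) ^+ m.+1))).
  move=> x; under eq_fun do rewrite horner_exp hornerD hornerC hornerZ hornerX mulrC.
  exact: Cexp_lim.
move=> m; apply: dd_bounded_le (poly_dd_bounded _ rho1).
apply: (le_trans (pnorm_exp _ _ r0)).
rewrite -[8 * rho](@divfK _ m.+1%:R) ?pnatr_eq0 // [_ * m.+1%:R]mulrC expRM_natl.
rewrite lerXn2r ?nnegrE ?expR_ge0 ?pnorm_ge0 //.
  by rewrite mulrC divfK ?pnatr_eq0.
apply: le_trans (expR_ge1Dx _); rewrite mulrC divfK ?pnatr_eq0 //.
apply: (le_trans (pnormD _ _ r0)); rewrite pnorm1 lerD2l.
apply: (le_trans (pnormZ _ _ r0)).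
by rewrite Normc.normcV nm_nat -['X]expr1 pnormXn expr1 mulrC.
Qed.

Lemma gseq_shift k z : z * gseq k (z + 1) = gseq k z * ((z + k.+2%:R) / k.+1%:R).
Proof.
elim: k => [|k IH].
  by rewrite /gseq !big_ord0 !mulr1 divr1; ring.
rewrite !gseqS mulrA IH /gstep mulrDr mulr1 CexpD.
have -> : Cexp (- (lnstep k)%:C%C) = k.+1%:R / k.+2%:R :> C.
  rewrite CexpN Cexp_real expR_lnstep rmorphM /= fmorphV !rmorph_nat.
  by rewrite invfM invrK mulrC.
rewrite -[k.+3%:R]natr1 -[k.+2%:R]natr1.
have k0 : k.+1%:R != 0 :> C by rewrite pnatr_eq0.
have : k.+1%:R + 1 != 0 :> C by rewrite natr1 pnatr_eq0.
move: k0; move: (k.+1%:R) => x x0 x1.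
by field; rewrite x0 x1.
Qed.

Lemma cvg_ratio z : ((fun k => (z + k.+2%:R) / k.+1%:R) : nat -> R[i]^o) @ \oo --> (1 : R[i]^o).
Proof.
apply: (@cvg_seq_rate _ _ (nm (z + 1))) => k.
have k0 : k.+1%:R != 0 :> C by rewrite pnatr_eq0.
have -> : 1 - (z + k.+2%:R) / k.+1%:R = - ((z + 1) / k.+1%:R).
  by rewrite -[k.+2%:R]natr1; move: k0; move: (k.+1%:R) => x x0; field.
by rewrite normcN Normc.normcM Normc.normcV nm_nat.
Qed.

Lemma GammaS z : z != 0 -> Gamma (z + 1) = z * Gamma z.
Proof.
move=> z0.
suff H : z * (Gamma (z + 1))^-1 = (Gamma z)^-1.
  by apply: invr_inj; rewrite invfM -H mulrA mulVf // mul1r.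
apply: (@cvgC_uniq (fun k => z * gseq k (z + 1))).
  by apply: cvgC_mul; [exact: cvgC_cst | exact: gseq_cvg].
under eq_fun do rewrite gseq_shift.
by rewrite -[(Gamma z)^-1]mulr1; apply: cvgC_mul; [exact: gseq_cvg | exact: cvg_ratio].
Qed.

Lemma Gamma1 : Gamma (1 : C) = 1.
Proof.
suff H : (Gamma (1 : C))^-1 = 1 by apply: invr_inj; rewrite H invr1.
apply: (@cvgC_uniq (gseq^~ 1)); first exact: gseq_cvg.
suff -> : gseq^~ 1 = fun k => (0 + k.+2%:R) / k.+1%:R by exact: cvg_ratio.
apply/funext; elim => [|k IH].
  by rewrite /gseq big_ord0 mulr1 mul1r add0r divr1.
rewrite gseqS IH /gstep mulr1 CexpN Cexp_real expR_lnstep rmorphM /= fmorphV !rmorph_nat.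
rewrite !add0r -[k.+3%:R]natr1 -[k.+2%:R]natr1.
have k0 : k.+1%:R != 0 :> C by rewrite pnatr_eq0.
have : k.+1%:R + 1 != 0 :> C by rewrite natr1 pnatr_eq0.
move: k0; move: (k.+1%:R) => x x0 x1.
by field; rewrite x0 x1.
Qed.

Lemma not_gpole_nat (m : nat) : ~ gpole (m.+1%:R : C).
Proof.
move=> [k /eqP]; rewrite -subr_eq0 opprK -natrD pnatr_eq0; by [].
Qed.

Lemma nice_Gamma_rev (b s : C) : ~ gpole (b - s) -> nice (fun u => Gamma (b - u)) s.
Proof.
move=> np; have := @nice_affine _ (@Gamma R) (-1) b s.
rewrite mulN1r addrC => /(_ (nice_Gamma np)); apply: nice_near.
by near=> u; rewrite mulN1r addrC.
Unshelve. all: by end_near. Qed.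

(** Residue of u |-> Gamma (b - u) at s, where b - s = p - q; for q < p the
    point is regular. *)
Definition gres (q p : nat) : C :=
  if (p <= q)%N then (-1) ^+ (q - p).+1 / ((q - p)`!)%:R else 0.

Lemma polar_Gamma_pole (b s : C) m : b - s = - m%:R ->
  polar (fun u => Gamma (b - u)) s 1 ((-1) ^+ m.+1 / (m`!)%:R).
Proof.
have GS (b' u : C) : b' - u != 0 -> Gamma (b' - u) = (b' - u)^-1 * Gamma (b' + 1 - u).
  by move=> h; rewrite addrAC GammaS // mulKf.
elim: m b => [|m IH] b bs.
  have bs1 : b + 1 - s = 1 by rewrite addrAC bs oppr0 add0r.
  exists (fun u => -1 * Gamma (b + 1 - u)); split.
  - apply: nice_mul; first exact: nice_cst.
    by apply: nice_Gamma_rev; rewrite bs1; exact: (@not_gpole_nat 0).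
  - by rewrite bs1 Gamma1 expr1 fact0 divr1 mulr1.
  apply/dnearCP; exists 1 => // u us _.
  have -> : b = s by apply/eqP; rewrite -subr_eq0 bs oppr0.
  by rewrite addrAC GammaS ?subr_eq0 1?eq_sym // expr1; field; rewrite subr_eq0.
have bs1 : b + 1 - s = - m%:R by rewrite addrAC bs -natr1 opprD subrK.
have nb : nice (fun u => (b - u)^-1) s.
  apply: (@nice_inv _ (fun u => b - u)); last by rewrite bs oppr_eq0 pnatr_eq0.
  have := @nice_affine _ id (-1) b s (nice_id _); apply: nice_near.
  by near=> u; rewrite mulN1r addrC.
have := polar_mul (polar_nice nb) (IH _ bs1).
rewrite bs add0n => H; apply: polar_near (_ : polar _ _ _ _); last first.
  have -> : (-1) ^+ m.+2 / (m.+1`!)%:R = (- m.+1%:R)^-1 * ((-1) ^+ m.+1 / (m`!)%:R) :> C.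
    by rewrite factS natrM invfM exprS invrN; ring.
  exact: H.
apply/dnearCP; exists (1 / 2); first by rewrite divr_gt0.
move=> u us uh; apply/esym/GS; apply: contraTneq uh => bu.
have -> : u - s = - m.+1%:R by rewrite -bs -[u](subKr b) bu subr0.
rewrite normcN nm_nat -leNgt.
apply: (@le_trans _ _ 1); [lra | by rewrite ler1n].
Unshelve. all: by end_near. Qed.

Lemma polar_Gamma_rev (b s : C) q p : b - s = p%:R - q%:R ->
  polar (fun u => Gamma (b - u)) s 1 (gres q p).
Proof.
rewrite /gres; case: leqP => [pq|qp] bs.
  by apply: polar_Gamma_pole; rewrite bs natrB // opprB.
have np : ~ gpole (b - s).
  rewrite bs -natrB ?(ltnW qp) //.
  by rewrite -(@prednK (p - q)) ?subn_gt0 //; exact: not_gpole_nat.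
exists (fun u => (u - s) * Gamma (b - u)); split.
- apply: nice_mul; last exact: nice_Gamma_rev.
  have := @nice_affine _ id 1 (- s) s (nice_id _); apply: nice_near.
  by near=> u; rewrite mul1r.
- by rewrite subrr mul0r.
apply/dnearCP; exists 1 => // u us _; rewrite expr1 mulrAC divff ?mul1r //.
by rewrite subr_eq0.
Unshelve. all: by end_near. Qed.

End GammaFunction.

(** * Ordered partitions and iterated residues *)

Section OrderedPartitions.
Variables (M n : nat) (lam : 'I_M.+1 -> nat).
Variable (I : opart n lam).

Lemma card_block j : #|block I j| = lam j.
Proof. by have /and3P[/forallP/(_ j)/eqP ? _ _] := valP I. Qed.

Lemma block_disjoint i j : i != j -> [disjoint block I i & block I j].
Proof. by have /and3P[_ /forallP/(_ i)/forallP/(_ j)/implyP ? _] := valP I. Qed.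

Lemma block_cover a : exists j, a \in block I j.
Proof.
have /and3P[_ _ /eqP H] := valP I.
by have /finset.bigcupP[j _ aj] : a \in \bigcup_j (val I) j; [rewrite H inE | exists j].
Qed.

Definition blk (a : 'I_n) : 'I_M.+1 := xchoose (block_cover a).

Lemma mem_block a j : (a \in block I j) = (blk a == j).
Proof.
have Ha := xchooseP (block_cover a); apply/idP/eqP => [aj|<-//].
apply/eqP; rewrite -[_ == _]negbK; apply/negP => /block_disjoint/pred0P/(_ a) /=.
by rewrite Ha aj.
Qed.

Lemma mem_upto a k : (a \in upto I k) = (blk a <= k)%N.
Proof.
apply/finset.bigcupP/idP => [[j jk]|bk]; first by rewrite mem_block => /eqP->.
by exists (blk a) => //; rewrite mem_block.
Qed.

Lemma card_upto k : #|upto I k| = psum lam k.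
Proof.
rewrite /psum -sum1_card (eq_bigl (fun a => (blk a <= k)%N)); last by move=> a; rewrite mem_upto.
rewrite (partition_big blk (fun j : 'I_M.+1 => (j <= k)%N)) //=.
apply: eq_bigr => j jk; rewrite -card_block -sum1_card; apply: eq_bigl => a.
by rewrite mem_block; apply: andb_idl => /eqP->.
Qed.

Lemma size_enum_upto k : size (enum (upto I k)) = psum lam k.
Proof. by rewrite -cardE card_upto. Qed.

Section Index.
Variable a0 : 'I_n.

Definition ix (v : tvar lam) : 'I_n := nth a0 (enum (upto I (tag v))) (tagged v).

Lemma ix_upto v : ix v \in upto I (tag v).
Proof. by rewrite -mem_enum mem_nth // size_enum_upto. Qed.

Lemma map_ix (i : 'I_M) :
  [seq ix (tv a) | a <- enum 'I_(psum lam i)] = enum (upto I i).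
Proof.
apply: (@eq_from_nth _ a0); rewrite size_map size_enum_ord ?size_enum_upto // => k kp.
rewrite (nth_map (Ordinal kp)) ?size_enum_ord // /ix /=.
by rewrite nth_enum_ord.
Qed.

Definition xvar := (tvar lam + 'I_n)%type.

(** The variables of the level above, the last level being that of the z_a. *)
Definition nxt (i : 'I_M) : seq xvar :=
  if insub i.+1 is Some i'
  then [seq inl (@tv M lam i' a) | a <- enum 'I_(psum lam i')]
  else [seq inr a | a <- enum 'I_n].

Definition xix (d : xvar) : 'I_n :=
  match d with inl v => ix v | inr a => a end.

Lemma map_xix i : map xix (nxt i) = enum (upto I i.+1).
Proof.
rewrite /nxt; case: insubP => [i' _ i'E|iM].
  by rewrite -map_comp -[in RHS]i'E -map_ix; apply: eq_map.
rewrite -map_comp (eq_map (g := id)) // map_id.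
have -> : upto I i.+1 = finset.setTfor 'I_n.
  apply/setP => a; rewrite mem_upto inE; apply: leq_trans (_ : M <= _)%N.
    by rewrite -ltnS ltn_ord.
  by rewrite leqNgt.
by rewrite enum_setT enumT.
Qed.

Lemma uniq_xix i : uniq (map xix (nxt i)).
Proof. by rewrite map_xix enum_uniq. Qed.

Lemma size_nxt i : size (nxt i) = psum lam i.+1.
Proof. by rewrite -(size_map xix) map_xix size_enum_upto. Qed.

Lemma ix_nxt v : ix v \in map xix (nxt (tag v)).
Proof. by rewrite map_xix mem_enum mem_upto leqW // -mem_upto ix_upto. Qed.

Lemma count_xix v : count (fun d => xix d == ix v) (nxt (tag v)) = 1%N.
Proof.
have <- := count_map xix (pred1 (ix v)).
by rewrite (count_uniq_mem _ (uniq_xix _)) ix_nxt.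
Qed.

Lemma nxt_tag (i : 'I_M) (w : tvar lam) : inl w \in nxt i -> nat_of_ord (tag w) = i.+1.
Proof.
rewrite /nxt; case: insubP => [i' _ i'E|_] /mapP[a _] //.
by move=> [->] /=.
Qed.

End Index.

Lemma tvarsE : tvars lam = enum {: tvar lam}.
Proof.
rewrite enumT unlock /=; rewrite /tvars /tag_enum /=.
by rewrite !enumT; congr flatten; apply: eq_map => i; rewrite enumT.
Qed.

Lemma tvars_uniq : uniq (tvars lam).
Proof. by rewrite tvarsE enum_uniq. Qed.

Lemma mem_tvars v : v \in tvars lam.
Proof. by rewrite tvarsE mem_enum. Qed.

Lemma tvars_sorted : pairwise (fun v w : tvar lam => (tag v <= tag w)%N) (tvars lam).
Proof.
rewrite /tvars.
have : pairwise (fun i j : 'I_M => (i <= j)%N) (enum 'I_M).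
  rewrite -sorted_pairwise; last by move=> i j k; exact: leq_trans.
  have := iota_sorted 0 M; rewrite -val_enum_ord; by rewrite sorted_map.
elim: (enum 'I_M) => //= i s IH /andP[/allP si /IH {}IH].
rewrite pairwise_cat IH andbT; apply/andP; split.
  apply/allrelP => v w /mapP[a _ ->] /flatten_mapP[j js /mapP[b _ ->]] /=.
  exact: si.
rewrite pairwise_map; elim: (enum _) => //= a s' ->; rewrite andbT.
by apply/allP => b _ /=.
Qed.
Lemma prod_tvar (K : comPzRingType) (F : tvar lam -> K) :
  \prod_(v : tvar lam) F v = \prod_(i < M) \prod_(a < psum lam i) F (tv a).
Proof. by rewrite sig_big_dep /=; apply: eq_bigr => -[i a]. Qed.

End OrderedPartitions.

Section IteratedResidue.
Local Open Scope classical_set_scope.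
Import numFieldNormedType.Exports.
Variables (R : realType) (M n : nat) (lam : 'I_M.+1 -> nat).
Local Notation C := (R[i]).
Local Notation nm := (@Normc.normc R).
Local Notation tvar := (tvar lam).
Local Notation nxt := (nxt n lam).

Definition is_int (x : C) : Prop := exists m : int, x = m%:~R.

Lemma gpole_int (x : C) : gpole x -> is_int x.
Proof. by move=> [m ->]; exists (- m%:Z); rewrite rmorphN. Qed.

Lemma is_intN x : is_int x -> is_int (- x).
Proof. by move=> [m ->]; exists (- m); rewrite rmorphN. Qed.

Lemma is_intD x y : is_int x -> is_int y -> is_int (x + y).
Proof. by move=> [m ->] [k ->]; exists (m + k); rewrite rmorphD. Qed.

Lemma is_int_nat k : is_int k%:R.
Proof. by exists k%:Z. Qed.

Lemma dnear_not_int (s : C) : \forall u \near (s : R[i]^o)^', ~ is_int u.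
Proof.
have [[m sm]|sn] := pselect (is_int s).
  apply/dnearCP; exists 1 => // u us ud [k uk]; move: us ud.
  rewrite sm uk -rmorphB /= -subr_eq0 -rmorphB /= intr_eq0 => km.
  have -> : ((k - m)%:~R : C) = ((k - m)%:~R : R)%:C%C by rewrite (rmorph_int (real_complex R)).
  rewrite nmR -intr_norm -[1]/(1%:~R) ltr_int => H.
  have E : k = m by lia.
  by rewrite E subrr eqxx in km.
(* only finitely many integers lie within distance 1 of s *)
pose f := Num.floor (complex.Re s).
have [d d0 H] : exists2 d : R, 0 < d & forall k : int, (f - 2 <= k <= f + 2) ->
    d <= nm (k%:~R - s).
  suff H N : exists2 d : R, 0 < d & forall k : nat, (k < N)%N ->
     d <= nm ((f - 2 + k%:Z)%:~R - s).
    have [d d0 Hd] := H 5%N; exists d => // k /andP[k1 k2].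
    have -> : k = f - 2 + (absz (k - (f - 2))%R)%:Z by lia.
    by apply: Hd; lia.
  elim: N => [|N [d d0 Hd]]; first by exists 1.
  exists (Num.min d (nm ((f - 2 + N%:Z)%:~R - s))).
    rewrite lt_min d0 nm_gt0 subr_eq0; apply/eqP => sE; apply: sn.
    by exists (f - 2 + N%:Z).
  move=> k; rewrite ltnS leq_eqVlt => /orP[/eqP->|/Hd h].
    by rewrite ge_min lexx orbT.
  by rewrite ge_min h.
apply/dnearCP; exists (Num.min d 1); first by rewrite lt_min d0 ltr01.
move=> u us; rewrite lt_min => /andP[ud u1] [k uk].
suff : d <= nm (u - s) by rewrite leNgt ud.
rewrite uk; apply: H.
have : `|k%:~R - complex.Re s| < 1.
  apply: le_lt_trans u1; rewrite uk; apply: le_trans (Re_le_nm _).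
  have -> : (k%:~R : C) = (k%:~R : R)%:C%C by rewrite (rmorph_int (real_complex R)).
  by rewrite ReB.
rewrite ltr_norml => /andP[k1 k2].
have /andP[f1 f2] := floor_itv (complex.Re s); rewrite -/f in f1 f2.
have a1 : (k%:~R : R) < (f + 2)%:~R.
  by rewrite rmorphD /=; move: f2; rewrite rmorphD /=; lra.
have a2 : ((f - 2)%:~R : R) < k%:~R.
  by rewrite rmorphB /=; lra.
by move: a1 a2; rewrite !ltr_int; lia.
Qed.

Variables (logk : C) (z : 'I_n -> C) (logp : 'I_M.+1 -> C).
Hypothesis z_dom : forall a b : 'I_n, a != b -> ~ is_int (z a - z b).
Variables (I : opart n lam) (a0 : 'I_n) (r : {ffun tvar -> nat}).

Local Notation ix := (ix I a0).
Local Notation xix := (xix I a0).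

Lemma SigmaE v : Sigma z I v = z (ix v).
Proof.
rewrite /Sigma /ix (nth_map a0) // size_enum_upto.
by case: v => i a /=.
Qed.

Definition xval (t : tvar -> C) (d : xvar n lam) : C :=
  match d with inl v => t v | inr a => z a end.

Definition xr (d : xvar n lam) : nat :=
  match d with inl v => r v | inr _ => 0%N end.

Local Notation s := (shifted 1 z I r).

Lemma shiftedE v : s v = z (ix v) + (r v)%:R.
Proof. by rewrite /shifted mulr1 SigmaE. Qed.

Lemma xval_shifted d : xval s d = z (xix d) + (xr d)%:R.
Proof. by case: d => [v|a] /=; rewrite ?addr0 ?shiftedE. Qed.

Lemma levelE t (i : 'I_M) : level z t i.+1 = map (xval t) (nxt i).
Proof.
rewrite /level /nxt; case: insubP => [i' _ _|_]; by rewrite -[RHS]map_comp; apply: eq_map.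
Qed.

Definition Lfac (i : 'I_M) : C :=
  pi_i R * ((lam (lo i))%:R - (lam (hi i))%:R)
  - (lam (lo i) + lam (hi i))%:R * logk + (logp (lo i) - logp (hi i)).

Definition topfac : C :=
  Cpow (pi_i R * ((lam ord_max)%:R - n%:R) + logp ord_max) (\sum_(a < n) z a).

Definition gfac (P : pred tvar) (v : tvar) (d : xvar n lam) (t : tvar -> C) : C :=
  if P v && (xix d == ix v) then gres R (r v) (xr d)
  else Gamma (xval t d - t v).

(** The integrand after the residues in the variables of P have been taken:
    each of these variables has lost the one Gamma factor that is singular at
    its target, in favour of the residue of that factor. *)
Definition PhiP (P : pred tvar) (t : tvar -> C) : C :=
  topfac * (\prod_(v : tvar) Cexp (t v * Lfac (tag v)))
  * \prod_(v : tvar) ((\prod_(b < psum lam (tag v) | b != tagged v)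
              (Gamma (t (tv b) - t v))^-1)
            * \prod_(d <- nxt (tag v)) gfac P v d t).

Lemma Phi_PhiP t : Phi 1 logk z logp t = PhiP pred0 t.
Proof.
rewrite /Phi /PhiP /topfac divr1; congr (_ * _ * _).
  transitivity (\prod_(i < M) \prod_(a < psum lam i) Cexp (t (tv a) * Lfac i)).
    apply: eq_bigr => i _; rewrite divr1 /Cpow -Cexp_sum; congr Cexp.
    by rewrite mulr_suml.
  rewrite sig_big_dep /=; apply: eq_bigr => -[i a] _ //.
rewrite sig_big_dep /=; apply: eq_bigr => -[i a] _ /=; congr (_ * _).
  by apply: eq_bigr => b _; rewrite divr1.
by rewrite levelE big_map; apply: eq_bigr => d _; rewrite divr1.
Qed.

Definition ovr (t : tvar -> C) (l : seq tvar) (v : tvar) : C :=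
  if v \in l then s v else t v.

Definition upd (t : tvar -> C) (v : tvar) (u : C) : tvar -> C :=
  fun w => if w == v then u else t w.

(** Genericity of a variable whose residue is still to be taken; it holds near
    every point, the point itself excepted. *)
Definition good (x : C) : Prop := forall e, ~ is_int (x - z e).

Lemma dnear_good (x : C) : \forall u \near (x : R[i]^o)^', good u.
Proof.
suff : forall l : seq 'I_n, \forall u \near (x : R[i]^o)^',
    forall e, e \in l -> ~ is_int (u - z e).
  move=> /(_ (enum 'I_n)); apply: filterS => u H e.
  by apply: H; rewrite mem_enum.
elim=> [|e l IH]; first by near=> u => ?.
have He : \forall u \near (x : R[i]^o)^', ~ is_int (u - z e).
  have /dnearCP[d d0 H] := dnear_not_int (x - z e).
  apply/dnearCP; exists d => // u us ud.
  by apply: H; [rewrite (inj_eq (addIr _)) | rewrite opprB addrA subrK].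
move: He IH; apply: filterS2 => u h1 h2 e'.
by rewrite inE => /orP[/eqP->|/h2].
Unshelve. all: by end_near. Qed.

Lemma xval_upd T v u d : xval (upd T v u) d =
  (d == inl v)%:R * u + (if d == inl v then 0 else xval T d).
Proof.
case: d => [w|a] /=; last by rewrite mul0r add0r.
rewrite /upd (inj_eq (@inl_inj _ _)); case: eqP => _.
  by rewrite mul1r addr0.
by rewrite mul0r add0r.
Qed.

(** Induction from the innermost residue outwards.  The residue in v only needs
    the values at points u that differ from all z_e by non-integers.  There the
    level above already sits at its target, so that at most one of its Gamma
    factors is singular, and the factors from the level below are regular
    because its variables are still generic. *)
Lemma iter_res_PhiP pre vs t : tvars lam = pre ++ vs ->
  (forall v, v \in pre -> good (t v)) ->
  iter_res vs (Phi 1 logk z logp) s t = PhiP (mem vs) (ovr t vs).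
Proof.
elim: vs pre t => [|v vs IH] pre t tE gt /=.
  by rewrite Phi_PhiP.
have := tvars_uniq lam; rewrite tE cat_uniq /= => /and3P[_ /norP[vpre _] /andP[vvs _]].
have upre w : w \in pre -> w != v /\ w \notin vs.
  move=> wp; have := tvars_uniq lam; rewrite tE cat_uniq => /and3P[_ /hasPn H _].
  split; first by apply: contraTneq wp => ->; apply: H; rewrite mem_head.
  by apply/negP => wv; move: (H w); rewrite inE wv orbT => /(_ isT); rewrite wp.
have mem3 w : w \in tvars lam by exact: mem_tvars.
have srt := tvars_sorted lam; rewrite tE pairwise_cat /= in srt.
have /and4P[/allrelP srt1 _ /allP srt2 _] := srt.
(* the variables of the level above v are inner, those below are outer *)
have above w : inl w \in nxt (tag v) -> w \in vs.
  move=> /nxt_tag wt; have := mem3 w; rewrite tE mem_cat inE => /or3P[wp|/eqP wv|//].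
    by have := srt1 _ _ wp (mem_head _ _); rewrite wt ltnn.
  by move: wt; rewrite wv => /eqP; rewrite -[X in X == _]addn0 -addn1 eqn_add2l.
have below w : inl v \in nxt (tag w) -> w \in pre.
  move=> /nxt_tag wt; have := mem3 w; rewrite tE mem_cat inE => /or3P[//|/eqP wv|wp].
    by move: wt; rewrite wv => /eqP; rewrite -[X in X == _]addn0 -addn1 eqn_add2l.
  by have := srt2 _ wp; rewrite wt ltnn.
set T1 := ovr t (v :: vs).
have T1v : T1 v = s v by rewrite /T1 /ovr mem_head.
have T1pre w : w \in pre -> T1 w = t w.
  by move=> /upre[wv wvs]; rewrite /T1 /ovr inE (negPf wv) (negPf wvs).
have ovrE u : ovr (upd t v u) vs = upd T1 v u.
  apply/funext => w; rewrite /ovr /upd /T1 /ovr inE.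
  by case: eqVneq => [->|_] //=; rewrite (negPf vvs).
have T1E : upd T1 v (s v) = T1.
  by apply/funext => w; rewrite /upd; case: eqP => // ->.
apply: polar_residue.
apply: (@polar_near _ (fun u => PhiP (mem vs) (upd T1 v u))).
  have := dnear_good (s v); apply: filterS => u gu.
  rewrite -ovrE -(IH (rcons pre v)) ?cat_rcons //.
  move=> w; rewrite mem_rcons inE => /orP[/eqP->|wp].
    by rewrite /upd eqxx.
  by have [wv _] := upre _ wp; rewrite /upd (negPf wv); exact: gt.
have updE u w : upd T1 v u w = xval (upd T1 v u) (inl w) by [].
have Nlin f (phi : C -> C) (a b : C) : (forall u, phi u = a * u + b) ->
    nice f (phi (s v)) -> polar (fun u => f (phi u)) (s v) 0 (f (phi (s v))).
  by move=> pE nf; apply: (@polar_nice _ (fun u => f (phi u))); exact: nice_lin nf.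
pose ord w (d : xvar n lam) : nat := (w == v) && (xix d == ix v).
have Hg (w : tvar) (d : xvar n lam) : d \in nxt (tag w) ->
    polar (fun u => gfac (mem vs) w d (upd T1 v u)) (s v) (ord w d)
       (gfac (mem (v :: vs)) w d T1).
  move=> dn; rewrite /gfac /ord /= inE; case: (eqVneq w v) => [wv|wv] /=.
    subst w; rewrite (negPf vvs) /=.
    have dE u : xval (upd T1 v u) d = xval s d.
      case: d dn => [w|a] //= /above wvs.
      have wv : w != v by apply: contraNneq vvs => <-.
      by rewrite /upd (negPf wv) /T1 /ovr inE wvs orbT.
    have T1d : xval T1 d = xval s d by rewrite -(dE (s v)) T1E.
    have uE u : upd T1 v u v = u by rewrite /upd eqxx.
    case: eqP => [dv|dv].
      have := @polar_Gamma_rev _ (xval s d) (s v) (r v) (xr d).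
      rewrite xval_shifted dv shiftedE opprD addrACA subrr add0r => /(_ erefl).
      by apply: polar_near; near=> u; rewrite dE uE xval_shifted dv.
    have np : ~ gpole (xval s d - s v).
      move=> /gpole_int H; apply: (@z_dom (xix d) (ix v)); first exact/eqP.
      have -> : z (xix d) - z (ix v) = xval s d - s v + (- (xr d)%:R + (r v)%:R).
        by rewrite xval_shifted shiftedE; ring.
      apply: is_intD => //; apply: is_intD; last exact: is_int_nat.
      by apply: is_intN; exact: is_int_nat.
    rewrite T1d T1v; have := polar_nice (nice_Gamma_rev np).
    by apply: polar_near; near=> u; rewrite dE uE.
  case: (boolP ((w \in vs) && (xix d == ix w))) => _.
    exact: (polar_nice (nice_cst _ _)).
  have wE u : upd T1 v u w = T1 w by rewrite /upd (negPf wv).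
  have [dv|dv] := eqVneq d (inl v); last first.
    have dE u : xval (upd T1 v u) d = xval T1 d.
      by rewrite xval_upd (negPf dv) mul0r add0r.
    have := polar_nice (nice_cst (Gamma (xval T1 d - T1 w)) (s v)).
    by apply: polar_near; near=> u; rewrite dE wE.
  have wp : w \in pre by apply: below; rewrite -dv.
  have np : ~ gpole (s v - T1 w).
    rewrite T1pre // => /gpole_int H; apply: (gt w wp (ix v)).
    have -> : t w - z (ix v) = - (s v - t w) + (r v)%:R by rewrite shiftedE; ring.
    by apply: is_intD; [exact: is_intN | exact: is_int_nat].
  rewrite dv /= T1v; have := @Nlin (@Gamma R) (fun u => u - T1 w) 1 (- T1 w).
  move=> /(_ (fun u => _)); rewrite /= => H.
  have := H (fun u => congr1 (fun x => x - T1 w) (esym (mul1r u))) (nice_Gamma np).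
  by apply: polar_near; near=> u; rewrite wE /upd eqxx.
have Hw (w : tvar) : polar (fun u => (\prod_(b < psum lam (tag w) | b != tagged w)
              (Gamma (upd T1 v u (tv b) - upd T1 v u w))^-1)
            * \prod_(d <- nxt (tag w)) gfac (mem vs) w d (upd T1 v u)) (s v)
     (0 + \sum_(d <- nxt (tag w)) ord w d)
     ((\prod_(b < psum lam (tag w) | b != tagged w)
              (Gamma (T1 (tv b) - T1 w))^-1)
            * \prod_(d <- nxt (tag w)) gfac (mem (v :: vs)) w d T1).
  apply: polar_mul; last by apply: polar_prod => d dn _; exact: Hg.
  have -> : 0%N = (\sum_(b < psum lam (tag w) | b != tagged w) 0)%N by rewrite big1.
  apply: polar_prod => b _ _; rewrite -[in X in polar _ _ _ X]T1E.
  apply: (@Nlin (fun x => (Gamma x)^-1) (fun u => upd T1 v u (tv b) - upd T1 v u w)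
    ((inl (tv b) == inl v :> xvar n lam)%:R - (inl w == inl v :> xvar n lam)%:R)
    ((if inl (tv b) == inl v :> xvar n lam then 0 else T1 (tv b))
      - (if inl w == inl v :> xvar n lam then 0 else T1 w))).
    by move=> u; rewrite !updE !xval_upd /=; ring.
  exact: nice_invGamma.
have Hall := @polar_prod _ _ (index_enum _) xpredT _ (s v) _ _
  (fun w _ _ => Hw w).
have Hexp : polar (fun u => \prod_(w : tvar) Cexp (upd T1 v u w * Lfac (tag w))) (s v) 0
    (\prod_(w : tvar) Cexp (T1 w * Lfac (tag w))).
  have -> : 0%N = (\sum_(w : tvar) 0)%N by rewrite big1.
  apply: polar_prod => w _ _; rewrite -[in X in polar _ _ _ X]T1E.
  apply: (@Nlin (@Cexp R) (fun u => upd T1 v u w * Lfac (tag w))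
    ((inl w == inl v :> xvar n lam)%:R * Lfac (tag w))
    ((if inl w == inl v :> xvar n lam then 0 else T1 w) * Lfac (tag w))).
    move=> u; rewrite updE xval_upd /= mulrDl; congr (_ + _); exact: mulrAC.
  exact: nice_Cexp.
have := polar_mul (polar_mul (polar_nice (nice_cst topfac (s v))) Hexp) Hall.
suff -> : (0 + 0 + \sum_(w : tvar) (0 + \sum_(d <- nxt (tag w)) ord w d) = 1)%N.
  by [].
rewrite !add0n (bigD1 v) //= [X in (_ + X)%N = _]big1 ?addn0 => [|w wv]; last first.
  by rewrite ?add0n big1 // => d _; rewrite /ord (negPf wv).
rewrite ?add0n -[RHS](count_xix I a0 v) -sum1_count [RHS]big_mkcond /=.
by apply: eq_bigr => d _; rewrite /ord eqxx; case: eqP.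
Unshelve. all: by end_near. Qed.

Lemma iter_resE : iter_res (tvars lam) (Phi 1 logk z logp) s s = PhiP predT s.
Proof.
rewrite (@iter_res_PhiP [::]) //.
have -> : ovr s (tvars lam) = s by apply/funext => v; rewrite /ovr mem_tvars.
congr (_ * _); apply: eq_bigr => v _; congr (_ * _); apply: eq_bigr => d _.
by rewrite /gfac /= mem_tvars.
Qed.

End IteratedResidue.

(** * Growth of Gamma, and unconditional sums *)

Section GammaGrowth.
Variable R : realType.
Local Notation C := (R[i]).
Local Notation nm := (@Normc.normc R).

Definition within (K : R) (k : nat) (x y : R) : Prop :=
  (y <= K ^+ k * x) /\ (x <= K ^+ k * y).

Lemma within_mul K k l x y x' y' : 0 <= K -> 0 <= x -> 0 <= y -> 0 <= x' -> 0 <= y' ->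
  within K k x y -> within K l x' y' -> within K (k + l) (x * x') (y * y').
Proof.
by move=> K0 x0 y0 x'0 y'0 [h1 h2] [h3 h4]; split; rewrite exprD mulrACA; apply: ler_pM.
Qed.

Lemma within_inv K k x y : 0 < x -> 0 < y -> within K k x y -> within K k x^-1 y^-1.
Proof.
move=> x0 y0 [h1 h2]; split; first by rewrite ler_pdivlMr // mulrC ler_pdivrMr.
by rewrite ler_pdivlMr // mulrC ler_pdivrMr.
Qed.

Lemma within_trans K k l x y z : 0 <= K -> within K k x y -> within K l y z ->
  within K (k + l) x z.
Proof.
move=> K0 [h1 h2] [h3 h4]; split; rewrite exprD.
  by apply: (le_trans h3); rewrite [leRHS]mulrAC [leRHS]mulrC ler_wpM2l ?exprn_ge0.
by apply: (le_trans h2); rewrite -mulrA ler_wpM2l ?exprn_ge0.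
Qed.

Lemma within_le K K' k l x y : 1 <= K -> K <= K' -> (k <= l)%N -> 0 <= x -> 0 <= y ->
  within K k x y -> within K' l x y.
Proof.
move=> K1 KK' kl x0 y0 [h1 h2].
have KK : K ^+ k <= K' ^+ l.
  apply: (@le_trans _ _ (K' ^+ k)); first by rewrite lerXn2r ?nnegrE //; lra.
  by rewrite ler_weXn2l //; lra.
by split; [apply: (le_trans h1) | apply: (le_trans h2)]; rewrite ler_wpM2r.
Qed.

Lemma linear_growth (v : C) : (forall j : nat, v + j%:R != 0) ->
  exists2 K, 1 <= K & forall j : nat, within K 1 (nm (v + j%:R)) j.+1%:R.
Proof.
move=> v0.
pose N := Num.bound (2 * (nm v + 1)).
have v1 := nm_ge0 v.
have HN : 2 * (nm v + 1) < N%:R by rewrite archi_boundP //; lra.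
have [c c0 Hc] : exists2 c : R, 0 < c & forall j, (j < N)%N -> c * j.+1%:R <= nm (v + j%:R).
  elim: N {HN} => [|N [c c0 Hc]]; first by exists 1.
  have q0 : 0 < nm (v + N%:R) / N.+1%:R by rewrite divr_gt0 ?ltr0n // nm_gt0.
  exists (Num.min c (nm (v + N%:R) / N.+1%:R)); first by rewrite lt_min c0.
  move=> j; rewrite ltnS leq_eqVlt => /orP[/eqP->|jN].
    by rewrite -ler_pdivlMr ?ltr0n // ge_min lexx orbT.
  by apply: le_trans (Hc _ jN); rewrite ler_wpM2r // ge_min lexx.
have ci : 0 < c^-1 by rewrite invr_gt0.
pose K := nm v + 2 + c^-1; exists K; first by rewrite /K; lra.
move=> j; have j1 : 1 <= j.+1%:R :> R by rewrite ler1n.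
have j2 : j.+1%:R = j%:R + 1 :> R by rewrite -natr1.
have j0 : 0 <= j%:R :> R by [].
split; rewrite expr1.
  have [jN|Nj] := ltnP j N.
    apply: (@le_trans _ _ (c^-1 * nm (v + j%:R))).
      by rewrite mulrC ler_pdivlMr // mulrC Hc.
    by rewrite ler_wpM2r ?nm_ge0 // /K; lra.
  have : N%:R <= j%:R :> R by rewrite ler_nat.
  have := ler_dist_nm (j%:R : C) (- v); rewrite opprK addrC normcN nm_nat => h hN.
  have : nm (j%:R + v) * 2 <= nm (j%:R + v) * K.
    by rewrite ler_wpM2l ?nm_ge0 // /K; lra.
  rewrite [v + _]addrC [K * _]mulrC; move: h.
  by move: (nm (j%:R + v)) => x; lra.
apply: (le_trans (le_normcD _ _)); rewrite nm_nat.
rewrite /K !mulrDl; have : 0 <= c^-1 * j.+1%:R by rewrite mulr_ge0 // ltW.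
have : nm v <= nm v * j.+1%:R by rewrite ler_peMr.
by move: (c^-1 * _) (nm v * _) => x y; lra.
Qed.

Lemma Gamma_nonint (w : C) (m : int) : ~ is_int w -> Gamma (w + m%:~R) != 0.
Proof.
move=> wn; apply: Gamma_neq0 => /gpole_int H; apply: wn.
have -> : w = w + m%:~R + (- m)%:~R by rewrite rmorphN /= addrK.
by apply: is_intD => //; exists (- m).
Qed.

Lemma Gamma_growth1 (w : C) : ~ is_int w -> exists2 K, 1 <= K & forall m : nat,
  within K m.+1 (nm (Gamma (w + m%:R))) (m`!)%:R /\
  within K m.+1 (nm (Gamma (w - m%:R))) (m`!)%:R^-1.
Proof.
move=> wn.
have nz (x : C) (m : int) : x = w + m%:~R -> Gamma x != 0.
  by move=> ->; exact: Gamma_nonint.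
have nG x m : x = w + m%:~R -> 0 < nm (Gamma x).
  by move=> /nz; rewrite nm_gt0.
have [K1 K11 H1] : exists2 K, 1 <= K & forall j : nat, within K 1 (nm (w + j%:R)) j.+1%:R.
  apply: linear_growth => j; apply/eqP => H; apply: wn; exists (- j%:Z).
  by rewrite rmorphN /=; apply/eqP; rewrite -addr_eq0 H.
have [K2 K21 H2] : exists2 K, 1 <= K & forall j : nat, within K 1 (nm ((1 - w) + j%:R)) j.+1%:R.
  apply: linear_growth => j; apply/eqP => H; apply: wn; exists (j.+1%:Z).
  rewrite -pmulrn -natr1; apply/eqP; rewrite -subr_eq0 -oppr_eq0.
  by rewrite -[_ == _]/(_ == 0) -H; apply/eqP; ring.
have G0 : 0 < nm (Gamma w) by apply: (nG _ 0); rewrite addr0.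
have Gi : 0 < (nm (Gamma w))^-1 by rewrite invr_gt0.
pose K := K1 + K2 + nm (Gamma w) + (nm (Gamma w))^-1.
have KK1 : K1 <= K by rewrite /K; lra.
have KK2 : K2 <= K by rewrite /K; lra.
have K0 : 0 <= K by rewrite /K; lra.
have w0 : within K 1 (nm (Gamma w)) 1.
  split; rewrite expr1 ?mulr1; last by rewrite /K; lra.
  by rewrite -ler_pdivrMr // div1r /K; lra.
exists K; first by rewrite /K; lra.
elim=> [|m [IH1 IH2]]; first by rewrite addr0 subr0 fact0 invr1.
have f0 : 0 < (m`!)%:R :> R by rewrite ltr0n fact_gt0.
split.
  have -> : Gamma (w + m.+1%:R) = (w + m%:R) * Gamma (w + m%:R).
    rewrite -natr1 addrA GammaS //; apply/eqP => H; apply: wn; exists (- m%:Z).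
    by rewrite rmorphN /=; apply/eqP; rewrite -addr_eq0 H.
  rewrite Normc.normcM factS natrM -add1n.
  apply: within_mul; rewrite ?nm_ge0 ?(ltW f0) //.
  by apply: within_le (H1 m); rewrite ?nm_ge0.
have wm : w - m.+1%:R != 0.
  by apply/eqP => H; apply: wn; exists m.+1%:Z; rewrite -pmulrn; apply/eqP; rewrite -subr_eq0 H.
have GE : Gamma (w - m.+1%:R) = (w - m.+1%:R)^-1 * Gamma (w - m%:R).
  have -> : w - m%:R = w - m.+1%:R + 1 by rewrite -natr1 opprD addrA subrK.
  by rewrite GammaS // mulKf.
rewrite GE Normc.normcM Normc.normcV factS natrM invfM -add1n.
apply: within_mul; rewrite ?nm_ge0 ?invr_ge0 ?nm_ge0 ?(ltW f0) //.
apply: within_inv; rewrite ?nm_gt0 ?ltr0n //.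
have -> : nm (w - m.+1%:R) = nm (1 - w + m%:R).
  by rewrite nmC -natr1; congr nm; ring.
by apply: within_le (H2 m); rewrite ?nm_ge0.
Qed.

Lemma bin_le_exp2 p q : ('C(p, q) <= 2 ^ p)%N.
Proof.
have [qp|pq] := leqP q p; last by rewrite bin_small.
rewrite -[2%N]/(1 + 1)%N expnDn (bigD1 (Ordinal (qp : (q < p.+1)%N))) //=.
by rewrite !exp1n !muln1 leq_addr.
Qed.

Lemma fact_within p q : (q <= p)%N ->
  within 2 p ((p - q)`!%:R : R) ((p`!)%:R / (q`!)%:R).
Proof.
move=> qp; have q0 : 0 < (q`!)%:R :> R by rewrite ltr0n fact_gt0.
have -> : (p`!)%:R / (q`!)%:R = ('C(p, q))%:R * ((p - q)`!)%:R :> R.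
  by rewrite -(bin_fact qp) !natrM mulrA mulrAC mulfK // gt_eqF.
split; first by rewrite ler_wpM2r // -natrX ler_nat bin_le_exp2.
rewrite mulrA ler_peMl // -natrX -natrM ler1n muln_gt0 expn_gt0 /=.
by rewrite bin_gt0.
Qed.

(** Gamma grows along w + p - q as p! / q!; this form, unlike (p - q)!, makes
    the bounds for the factors of a product cancel each other. *)
Lemma Gamma_growth (w : C) : ~ is_int w -> exists2 K, 1 <= K & forall p q : nat,
  within K (p + q).+1 (nm (Gamma (w + p%:R - q%:R))) ((p`!)%:R / (q`!)%:R).
Proof.
move=> wn; have [K K1 H] := Gamma_growth1 wn.
pose K' := 2 * K; have K'1 : 1 <= K' by rewrite /K'; lra.
have K'0 : 0 <= K' by lra.
have fr p q : 0 <= (p`!)%:R / (q`!)%:R :> R by rewrite divr_ge0.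
exists (K' ^+ 2); first by rewrite expr2; nra.
move=> p q.
suff Hs : within K' ((p + q).+1 + (p + q).+1) (nm (Gamma (w + p%:R - q%:R)))
    ((p`!)%:R / (q`!)%:R).
  by move: Hs; rewrite addnn -mul2n /within -exprM.
have [qp|/ltnW pq] := leqP q p.
  have -> : w + p%:R - q%:R = w + (p - q)%:R by rewrite natrB // addrA.
  apply: within_trans => //.
    by apply: within_le (H (p - q)%N).1; rewrite ?nm_ge0 //; [rewrite /K'; lra | lia].
  by apply: within_le (fact_within qp); rewrite // ?ler1n //; [rewrite /K'; lra | lia].
have -> : w + p%:R - q%:R = w - (q - p)%:R by rewrite natrB // opprB addrA.
apply: within_trans => //.
  by apply: within_le (H (q - p)%N).2; rewrite ?nm_ge0 ?invr_ge0 //; [rewrite /K'; lra | lia].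
have := within_inv _ _ (fact_within pq); rewrite invf_div => Hi.
apply: within_le (Hi _ _); rewrite ?invr_ge0 ?ler1n ?divr_gt0 ?ltr0n ?fact_gt0 //.
  by rewrite /K'; lra.
by lia.
Qed.

Lemma gres_growth q p : nm (gres R q p) <= 2 ^+ q * ((p`!)%:R / (q`!)%:R).
Proof.
rewrite /gres; case: leqP => pq; last by rewrite Normc.normc0 mulr_ge0 ?exprn_ge0 ?divr_ge0.
rewrite Normc.normcM nmX normcN Normc.normc1 expr1n mul1r Normc.normcV nm_nat.
have := within_inv _ _ (fact_within pq).
rewrite invf_div => H; apply: (H _ _).2; first by rewrite ltr0n fact_gt0.
by rewrite divr_gt0 // ltr0n fact_gt0.
Qed.

Lemma exp_le_fact (Q : R) : 1 <= Q -> exists2 c, 0 < c & forall k, Q ^+ k / (k`!)%:R <= c.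
Proof.
move=> Q1; pose N := Num.bound Q; have HN : Q < N%:R by rewrite archi_boundP //; lra.
have Q0 : 0 < Q by lra.
exists (Q ^+ N); first by rewrite exprn_gt0.
move=> k; rewrite ler_pdivrMr ?ltr0n ?fact_gt0 //.
elim: k => [|k IH]; first by rewrite expr0 fact0 mulr1 exprn_ege1.
have [kN|Nk] := ltnP k N.
  apply: (@le_trans _ _ (Q ^+ N)); first by rewrite ler_weXn2l.
  by rewrite ler_peMr ?exprn_ge0 ?(ltW Q0) // ler1n fact_gt0.
rewrite factS natrM exprS mulrCA; apply: ler_pM => //; rewrite ?exprn_ge0 // ltW //.
by apply: (lt_le_trans HN); rewrite ler_nat ltnW.
Qed.

End GammaGrowth.

Section UnconditionalSums.
Local Open Scope classical_set_scope.
Import numFieldNormedType.Exports.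
Variable R : realType.
Local Notation C := (R[i]).
Local Notation nm := (@Normc.normc R).
Local Open Scope fset_scope.
Local Open Scope ring_scope.

Lemma partial_sumE (V : zmodType) (T : choiceType) (f : T -> V) (D : {fset T}) :
  summability.partial_sum f D = \sum_(i <- D) f i.
Proof. by rewrite /summability.partial_sum [RHS]big_seq_fsetE. Qed.

Lemma has_sumP (T : choiceType) (f : T -> C) (s : C) :
  has_sum f s <-> forall e : R, 0 < e -> exists A : {fset T},
    forall D, A `<=` D -> nm (s - \sum_(i <- D) f i) < e.
Proof.
pose FF := @filter_filter _ _ (@summability.totally_filter T).
rewrite /has_sum; split=> [H e e0|H].
  have [A _ HA] := (cvgCP FF _ _).1 H e e0.
  by exists A => D AD; have := HA D AD; rewrite /= partial_sumE.
apply/(cvgCP FF) => e /H[A HA]; exists A => // D AD /=.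
by rewrite partial_sumE; exact: HA.
Qed.

Lemma sum_fset_le (T : choiceType) (f : T -> R) (A B : {fset T}) :
  (forall i, 0 <= f i) -> A `<=` B -> \sum_(i <- A) f i <= \sum_(i <- B) f i.
Proof.
move=> f0 AB; rewrite [leRHS](big_fsetID _ (mem A)) /=.
have -> : [fset x in B | x \in A] = A.
  by apply/fsetP => x; rewrite !inE /= andb_idl //; exact: (fsubsetP AB).
by rewrite lerDl sumr_ge0.
Qed.

Lemma bounded_sum_nonneg (T : choiceType) (f : T -> R) (B : R) :
  (forall i, 0 <= f i) -> (forall D : {fset T}, \sum_(i <- D) f i <= B) ->
  exists s, forall e : R, 0 < e -> exists A : {fset T},
    forall D, A `<=` D -> `|s - \sum_(i <- D) f i| < e.
Proof.
move=> f0 fB; pose E := range (fun D : {fset T} => \sum_(i <- D) f i).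
have hs : has_sup E.
  by split; [exists (\sum_(i <- fset0) f i); exists fset0 | exists B => _ [D _ <-]].
exists (sup E) => e e0; have [_ [A _ <-] hA] := sup_adherent e0 hs.
exists A => D AD; have h1 := sum_fset_le f0 AD.
have h2 : \sum_(i <- D) f i <= sup E by apply: ub_le_sup; [exact: hs.2 | exists D].
by rewrite ger0_norm ?subr_ge0 //; lra.
Qed.

Lemma bounded_sum_real (T : choiceType) (f g : T -> R) (B : R) :
  (forall i, `|f i| <= g i) -> (forall D : {fset T}, \sum_(i <- D) g i <= B) ->
  exists s, forall e : R, 0 < e -> exists A : {fset T},
    forall D, A `<=` D -> `|s - \sum_(i <- D) f i| < e.
Proof.
move=> fg gB.
have g0 i : 0 <= g i by apply: le_trans (fg i); exact: normr_ge0.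
have [s Hs] := bounded_sum_nonneg g0 gB.
have h0 i : 0 <= f i + g i by have := fg i; rewrite ler_norml => /andP[]; lra.
have [|s' Hs'] := @bounded_sum_nonneg _ (fun i => f i + g i) (B + B) h0.
  move=> D; rewrite big_split /= lerD //; apply: le_trans (gB D); apply: ler_sum => i _.
  by apply: le_trans (fg i); exact: ler_norm.
exists (s' - s) => e e0; have e2 : 0 < e / 2 by lra.
have [A HA] := Hs _ e2; have [A' HA'] := Hs' _ e2.
exists (A `|` A') => D; rewrite fsubUset => /andP[/HA h1 /HA' h2].
move: h2; rewrite big_split /= !ltr_norml => /andP[h3 h4].
by move: h1; rewrite ltr_norml => /andP[h1 h2]; apply/andP; split; lra.
Qed.

Lemma bounded_has_sum (T : choiceType) (f : T -> C) (g : T -> R) (B : R) :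
  (forall i, nm (f i) <= g i) -> (forall D : {fset T}, \sum_(i <- D) g i <= B) ->
  exists s, has_sum f s.
Proof.
move=> fg gB.
have [x Hx] := @bounded_sum_real T (fun i => complex.Re (f i)) g B
  (fun i => le_trans (Re_le_nm _) (fg i)) gB.
have [y Hy] := @bounded_sum_real T (fun i => complex.Im (f i)) g B
  (fun i => le_trans (Im_le_nm _) (fg i)) gB.
exists (x +i* y)%C; apply/has_sumP => e e0; have e2 : 0 < e / 2 by lra.
have [A HA] := Hx _ e2; have [A' HA'] := Hy _ e2.
exists (A `|` A') => D; rewrite fsubUset => /andP[/HA h1 /HA' h2].
apply: (le_lt_trans (nm_le_ReIm _)).
rewrite ReB ImB /= (big_morph _ (@ReD R) (erefl : complex.Re (0 : C) = 0)).
rewrite (big_morph _ (@ImD R) (erefl : complex.Im (0 : C) = 0)).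
move: h1 h2; move: `|_| `|_| => u v; lra.
Qed.

Lemma Csum_has_sum (T : choiceType) (f : T -> C) (s : C) : has_sum f s -> Csum f = s.
Proof.
rewrite /has_sum /Csum /summability.sum => H.
have PF := @summability.totally_filter T.
apply: (@cvg_lim _ (@norm_hausdorff _ R[i]^o)); exact: H.
Qed.

Lemma has_sumZ (T : choiceType) (f : T -> C) (c s : C) :
  has_sum f s -> has_sum (fun i => c * f i) (c * s).
Proof.
move=> /has_sumP H; apply/has_sumP => e e0.
have c1 : 0 < nm c + 1 by have := nm_ge0 c; lra.
have [A HA] := H _ (divr_gt0 e0 c1); exists A => D /HA.
rewrite ltr_pdivlMr // -mulr_sumr -mulrBr Normc.normcM => h.
by apply: le_lt_trans h; rewrite mulrC ler_wpM2l ?nm_ge0 //; lra.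
Qed.

Lemma has_sum_ext (T : choiceType) (f g : T -> C) s : f =1 g -> has_sum f s -> has_sum g s.
Proof. by move=> /funext->. Qed.

(** The preimages of finite sets of values are finite, and they are cofinal
    among the finite sets of indices. *)
Lemma has_sum_fibers (T U : choiceType) (phi : T -> U) (fib : U -> seq T) (f : T -> C) s :
  (forall u, uniq (fib u)) -> (forall u t, (t \in fib u) = (phi t == u)) ->
  has_sum f s -> has_sum (fun u => \sum_(t <- fib u) f t) s.
Proof.
move=> fu fE /has_sumP H; apply/has_sumP => e /H[A HA].
exists [fset phi t | t in A] => D AD.
pose l := flatten [seq fib u | u <- D].
have lE t : (t \in l) = (phi t \in D).
  apply/flatten_mapP/idP => [[u uD]|tD]; first by rewrite fE => /eqP->.
  by exists (phi t) => //; rewrite fE.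
have lu : uniq l.
  rewrite /l; have : uniq (enum_fset D) by exact: fset_uniq.
  elim: (enum_fset D) => //= u s' IH /andP[us' /IH us].
  rewrite cat_uniq fu us andbT /=; apply/hasPn => t /flatten_mapP[u' u's].
  by rewrite !fE => /eqP->; apply: contraNneq us' => <-.
have := HA [fset t in l]; rewrite (_ : \sum_(i <- [fset t in l]) f i = \sum_(i <- l) f i).
  rewrite /l big_flatten big_map; apply.
  apply/fsubsetP => t tA; rewrite inE /= -/l lE; apply: (fsubsetP AD).
  by apply: in_imfset.
apply: perm_big; apply: uniq_perm; [exact: fset_uniq | exact: lu |].
by move=> t; rewrite inE.
Qed.

Definition box (V : finType) (N : nat) : seq {ffun V -> nat} :=
  [seq [ffun v => nat_of_ord (h v)] | h : {ffun V -> 'I_N} <- enum {ffun V -> 'I_N}].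

Lemma box_uniq (V : finType) N : uniq (box V N).
Proof.
rewrite map_inj_uniq ?enum_uniq // => h h' /ffunP E; apply/ffunP => v; apply: val_inj.
by have := E v; rewrite !ffunE.
Qed.

Lemma mem_box (V : finType) N (r : {ffun V -> nat}) :
  (forall v, r v < N)%N -> r \in box V N.
Proof.
move=> rN; apply/mapP; exists [ffun v => Ordinal (rN v)]; first by rewrite mem_enum.
by apply/ffunP => v; rewrite !ffunE.
Qed.

(** Inside a box the sum is a product of finite geometric sums. *)
Lemma geometric_box_bound (V : finType) (D : {fset {ffun V -> nat}}) :
  \sum_(r <- D) \prod_v (2^-1 : R) ^+ r v <= 2 ^+ #|V|.
Proof.
pose N := (\sum_(r <- D) \sum_v r v).+1.
have rN r v : r \in D -> (r v < N)%N.
  move=> rD; rewrite ltnS (big_fsetD1 r) //= (bigD1 v) //= -addnA.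
  exact: leq_addr.
have lE : perm_eq D [seq r <- box V N | r \in D].
  apply: uniq_perm; [exact: fset_uniq | by rewrite filter_uniq // box_uniq |].
  move=> r; rewrite mem_filter; case: (boolP (r \in D)) => //= rD.
  by apply/esym/mem_box => v; exact: rN.
rewrite (perm_big _ lE) /= big_filter big_map.
apply: (@le_trans _ _ (\sum_(h : {ffun V -> 'I_N}) \prod_v (2^-1 : R) ^+ h v)).
  rewrite big_enum_cond /= big_mkcond /=; apply: ler_sum => h _.
  have p0 : 0 <= \prod_v (2^-1 : R) ^+ h v.
    by apply: prodr_ge0 => v _; rewrite exprn_ge0 // invr_ge0.
  case: ifP => // _; rewrite le_eqVlt; apply/orP; left; apply/eqP.
  by apply: eq_bigr => v _; rewrite ffunE.
rewrite -(bigA_distr_bigA (fun (v : V) (k : 'I_N) => (2^-1 : R) ^+ k)) /=.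
apply: (@le_trans _ _ (\prod_(v : V) (2 : R))); last by rewrite prodr_const.
apply: ler_prod => v _; apply/andP; split.
  by apply: sumr_ge0 => k _; rewrite exprn_ge0 // invr_ge0.
suff -> : \sum_(k < N) (2^-1 : R) ^+ k = 2 - 2 * 2^-1 ^+ N.
  by rewrite gerBl mulr_ge0 // exprn_ge0 // invr_ge0.
elim: N {rN lE} => [|m IH]; first by rewrite big_ord0 expr0 mulr1 subrr.
by rewrite big_ord_recr /= IH exprS; field.
Qed.

End UnconditionalSums.

(** * Convergence of the sum of residues *)

Section Convergence.
Variables (R : realType) (M n : nat) (lam : 'I_M.+1 -> nat).
Local Notation C := (R[i]).
Local Notation nm := (@Normc.normc R).
Local Notation tvar := (tvar lam).
Local Notation nxt := (nxt n lam).
Local Notation shifts := ({ffun tvar -> nat}).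

Definition total_shift (r : shifts) : nat := (\sum_v r v)%N.

Lemma le_total_shift (r : shifts) v : (r v <= total_shift r)%N.
Proof. by rewrite /total_shift (bigD1 v) //= leq_addr. Qed.

(** Exponential factors are left unspecified: the factorials in rho alone decide
    the convergence, and in this form the estimate is stable under products. *)
Definition ubd (F : shifts -> C) (rho : shifts -> R) : Prop :=
  exists2 K : R, 1 <= K & forall r : shifts,
    0 <= rho r /\ nm (F r) <= K ^+ (total_shift r).+1 * rho r.

Lemma ubd_ext F G rho sigma : F =1 G -> rho =1 sigma -> ubd F rho -> ubd G sigma.
Proof. by move=> /funext-> /funext->. Qed.

Lemma ubd_mul F G rho sigma : ubd F rho -> ubd G sigma ->
  ubd (fun r => F r * G r) (fun r => rho r * sigma r).
Proof.
move=> [K K1 HF] [L L1 HG]; exists (K * L); first by nra.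
move=> r; have [r0 hF] := HF r; have [s0 hG] := HG r; split; first exact: mulr_ge0.
by rewrite Normc.normcM exprMn mulrACA; apply: ler_pM; rewrite ?nm_ge0.
Qed.

Lemma ubd_cst (c : C) : ubd (fun=> c) (fun=> 1).
Proof.
exists (nm c + 1) => [|r]; first by have := nm_ge0 c; lra.
split=> //; rewrite mulr1; apply: (@le_trans _ _ (nm c + 1)); first by lra.
by rewrite -[leLHS]expr1 ler_weXn2l //; have := nm_ge0 c; lra.
Qed.

Lemma ubd_prod (T : eqType) (l : seq T) (P : pred T) F rho :
  (forall i, i \in l -> P i -> ubd (F i) (rho i)) ->
  ubd (fun r => \prod_(i <- l | P i) F i r) (fun r => \prod_(i <- l | P i) rho i r).
Proof.
elim: l => [|i l IH] H.
  by apply: ubd_ext (ubd_cst 1) => r; rewrite big_nil.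
have {}IH := IH (fun j jr => H j (mem_behead (s := i :: l) jr)).
case Pi: (P i); last by apply: ubd_ext IH => r; rewrite big_cons Pi.
by apply: ubd_ext (ubd_mul (H i (mem_head _ _) Pi) IH) => r; rewrite big_cons Pi.
Qed.

Lemma ubd_pow F rho (K : R) (k : nat) : 1 <= K ->
  (forall r, 0 <= rho r /\ nm (F r) <= K ^+ (k * (total_shift r).+1) * rho r) -> ubd F rho.
Proof.
move=> K1 H; exists (K ^+ k) => [|r]; first by rewrite exprn_ege1.
by rewrite -exprM; exact: H.
Qed.

Lemma ubd_exp (c L : C) v : ubd (fun r => Cexp ((c + (r v)%:R) * L)) (fun=> 1).
Proof.
pose K := nm (Cexp (c * L)) + nm (Cexp L) + 1.
have c0 := nm_ge0 (Cexp (c * L)); have L0 := nm_ge0 (Cexp L).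
have K1 : 1 <= K by rewrite /K; lra.
exists K => // r; split=> //; rewrite mulr1 mulrDl CexpD CexpMn Normc.normcM nmX exprS.
apply: ler_pM; rewrite ?exprn_ge0 //; first by rewrite /K; lra.
apply: (@le_trans _ _ (K ^+ r v)); last by rewrite ler_weXn2l // le_total_shift.
by rewrite lerXn2r ?nnegrE //; rewrite /K; lra.
Qed.

Lemma ubd_linear (c : C) v : ubd (fun r => c + (r v)%:R) (fun=> 1).
Proof.
pose K := nm c + 2; have c0 := nm_ge0 c; have K1 : 1 <= K by rewrite /K; lra.
exists K => // r; split=> //; rewrite mulr1.
apply: (@le_trans _ _ (K ^+ (r v).+1)); last by rewrite ler_weXn2l // ltnS le_total_shift.
apply: (le_trans (le_normcD _ _)); rewrite nm_nat.
elim: (r v) => [|k IH]; first by rewrite addr0 expr1 /K; lra.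
rewrite exprS -natr1; have : 1 <= K ^+ k.+1 by rewrite exprn_ege1.
have K2 : 2 <= K by rewrite /K; lra.
by move: IH; move: (K ^+ k.+1) => x; clearbody K; nra.
Qed.

Local Notation fact_R k := ((k`!)%:R : R).

Lemma fact_gt0R k : 0 < fact_R k.
Proof. by rewrite ltr0n fact_gt0. Qed.

Lemma exp_sum_le (r : shifts) (p q : nat) : (p <= total_shift r)%N ->
  (q <= total_shift r)%N -> ((p + q).+1 <= 2 * (total_shift r).+1)%N.
Proof. by lia. Qed.

Lemma ubd_Gamma (w : C) (p q : shifts -> nat) : ~ is_int w ->
  (forall r, (p r <= total_shift r)%N) -> (forall r, (q r <= total_shift r)%N) ->
  ubd (fun r => Gamma (w + (p r)%:R - (q r)%:R)) (fun r => fact_R (p r) / fact_R (q r)).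
Proof.
move=> wn Hp Hq; have [K K1 H] := Gamma_growth wn.
apply: (@ubd_pow _ _ K 2) => // r; split; first by rewrite divr_ge0.
apply: (le_trans (H _ _).2); rewrite ler_wpM2r ?divr_ge0 // ler_weXn2l //.
exact: exp_sum_le.
Qed.

Lemma ubd_invGamma (w : C) (p q : shifts -> nat) : ~ is_int w ->
  (forall r, (p r <= total_shift r)%N) -> (forall r, (q r <= total_shift r)%N) ->
  ubd (fun r => (Gamma (w + (p r)%:R - (q r)%:R))^-1) (fun r => fact_R (q r) / fact_R (p r)).
Proof.
move=> wn Hp Hq; have [K K1 H] := Gamma_growth wn.
apply: (@ubd_pow _ _ K 2) => // r; split; first by rewrite divr_ge0.
have g0 : 0 < nm (Gamma (w + (p r)%:R - (q r)%:R)).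
  rewrite nm_gt0; have := @Gamma_nonint _ w ((p r)%:Z - (q r)%:Z) wn.
  by rewrite rmorphB /= addrA.
have f0 : 0 < fact_R (p r) / fact_R (q r) by rewrite divr_gt0 // fact_gt0R.
rewrite Normc.normcV -invf_div; apply: (le_trans (within_inv g0 f0 (H _ _)).2).
rewrite ler_wpM2r ?invr_ge0 ?divr_ge0 // ler_weXn2l //.
exact: exp_sum_le.
Qed.

Variables (logk : C) (z : 'I_n -> C) (logp : 'I_M.+1 -> C).
Hypothesis z_dom : forall a b : 'I_n, a != b -> ~ is_int (z a - z b).
Variables (I : opart n lam) (a0 : 'I_n) (g : roots_type R lam).

Local Notation ix := (ix I a0).
Local Notation xix := (xix I a0).
Local Notation sh := (shifted 1 z I).

Definition res_term (r : shifts) : C :=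
  PhiP logk z logp I a0 r predT (sh r) * What (sh r) g.

(** The factorials contributed by the inverse Gamma factors of each level and by
    the Gamma factors between a level and the next one. *)
Definition ratio (r : shifts) : R :=
  \prod_(v : tvar) ((\prod_(b < psum lam (tag v) | b != tagged v)
                       (fact_R (r v) / fact_R (r (tv b))))
                    * \prod_(d <- nxt (tag v)) (fact_R (xr r d) / fact_R (r v))).

Lemma xr_le (r : shifts) (d : xvar n lam) : (xr r d <= total_shift r)%N.
Proof. by case: d => [v|a] //=; exact: le_total_shift. Qed.

Lemma ix_inj (i : 'I_M) : injective (fun a => ix (@tv M lam i a)).
Proof.
move=> a b; rewrite /= /ix /= => /eqP; rewrite nth_uniq ?enum_uniq ?size_enum_upto //.
by move/eqP/val_inj.
Qed.

Lemma ubd_res_term : ubd res_term ratio.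
Proof.
have -> : ratio = fun r => 1 * 1 * ratio r * 1 by apply/funext => r; rewrite !mul1r mulr1.
apply: ubd_mul; last first.
  apply: (@ubd_ext _ _ (fun=> \prod_(i < M) \prod_(a < psum lam i) \prod_(b < lam (hi i)) 1)) => //.
    move=> r; rewrite big1 // => i _; rewrite big1 // => a _; by rewrite big1.
  apply: ubd_prod => i _ _; apply: ubd_prod => a _ _; apply: ubd_prod => b _ _.
  apply: (ubd_ext _ _ (ubd_linear (z (ix (tv a)) - @g (hi i) b) (tv a))) => // r.
  by rewrite (shiftedE z I a0) addrAC.
apply: ubd_mul.
  apply: ubd_mul; first exact: ubd_cst.
  apply: (@ubd_ext _ _ (fun=> \prod_(v : tvar) 1)) => //; first by move=> r; rewrite big1.
  apply: ubd_prod => v _ _.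
  apply: (ubd_ext _ _ (ubd_exp (z (ix v)) (Lfac lam logk logp (tag v)) v)) => // r.
  by rewrite (shiftedE z I a0).
apply: ubd_prod => v _ _; apply: ubd_mul.
  apply: ubd_prod => b _ bv.
  have zb : ~ is_int (z (ix (tv b)) - z (ix v)).
    apply: z_dom; apply: contraNneq bv; case: v b => i a b /= H.
    by apply/eqP; exact: (ix_inj H).
  apply: (ubd_ext _ _ (ubd_invGamma zb (fun r => le_total_shift r (tv b))
    (fun r => le_total_shift r v))) => // r.
  by rewrite !(shiftedE z I a0); congr (Gamma _)^-1; ring.
apply: ubd_prod => d dn _; rewrite /gfac /=.
case: eqP => [dv|/eqP dv].
  apply: (@ubd_pow _ _ 2 1) => [|r]; first by rewrite ler1n.
  split; first by rewrite divr_ge0.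
  apply: (le_trans (gres_growth _ _ _)); rewrite ler_wpM2r ?divr_ge0 //.
  by rewrite mul1n ler_weXn2l ?ler1n // leqW // le_total_shift.
apply: (ubd_ext _ _ (ubd_Gamma (z_dom dv) (fun r => xr_le r d)
    (fun r => le_total_shift r v))) => // r.
by rewrite (xval_shifted z I a0) !(shiftedE z I a0); congr (Gamma _); ring.
Qed.

Definition supported (r : shifts) : Prop :=
  forall v d, d \in nxt (tag v) -> xix d = ix v -> (xr r d <= r v)%N.

(** Otherwise one of the Gamma factors is regular at its target, and its residue
    there is 0. *)
Lemma res_term_supported r : res_term r != 0 -> supported r.
Proof.
rewrite /res_term /PhiP !mulf_eq0 !negb_or => /andP[/andP[_ /prodf_neq0 H] _] v d dn dv.
have := H v isT; rewrite mulf_eq0 negb_or => /andP[_].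
rewrite prodf_seq_neq0 => /allP/(_ d dn) /=; rewrite /gfac /= dv eqxx /gres.
by case: leqP => //; rewrite eqxx.
Qed.

(** The sum of the sizes of the blocks k and k.+1, counted from 0; it may be
    0. *)
Definition expo (k : nat) : nat :=
  psum lam k.+1 - (if k is k'.+1 then psum lam k' else 0).

Lemma psum_le k l : (k <= l)%N -> (psum lam k <= psum lam l)%N.
Proof.
move=> kl; rewrite /psum [leqRHS]big_mkcond [leqLHS]big_mkcond /=.
by apply: leq_sum => j _; case: ifP => // jk; rewrite (leq_trans jk kl).
Qed.

(** The factorials of a level stand in the numerators of the level below and in
    its own denominators. *)
Lemma telescope_ratio (f : nat -> R) k : (forall i, 0 < f i) ->
  \prod_(i < k) (f i.+1 ^+ psum lam i / f i ^+ psum lam i.+1)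
  = f k ^+ (if k is k'.+1 then psum lam k' else 0) * \prod_(i < k) (f i ^- expo i).
Proof.
move=> f0; elim: k => [|k IH]; first by rewrite !big_ord0 expr0 mulr1.
rewrite !big_ord_recr /= IH.
have -> : f k ^+ psum lam k.+1 =
    f k ^+ (if k is k'.+1 then psum lam k' else 0) * f k ^+ expo k.
  rewrite -exprD /expo subnKC //; case: (k) => // k'.
  by apply: psum_le; lia.
have : f k ^+ (if k is k'.+1 then psum lam k' else 0) != 0 by rewrite expf_neq0 // gt_eqF.
have : f k ^+ expo k != 0 by rewrite expf_neq0 // gt_eqF.
set x := f k ^+ _; set y := f k ^+ _; set w := f k.+1 ^+ _ => x0 y0.
set P := \prod_(_ < _) _; by field; rewrite x0 y0.
Qed.

Lemma prodr_seq_const (T : Type) (l : seq T) (x : R) : \prod_(i <- l) x = x ^+ size l.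
Proof. by elim: l => [|i l IH]; rewrite ?big_nil ?expr0 // big_cons IH exprS. Qed.

Lemma ratioE r : ratio r = \prod_(v : tvar) (fact_R (r v) ^- expo (tag v)).
Proof.
pose F (i : 'I_M) : R := \prod_(a < psum lam i) fact_R (r (tv a)).
pose Fn k : R := if insub k is Some i then F i else 1.
have FnE (i : 'I_M) : Fn i = F i by rewrite /Fn valK.
have Fn0 k : 0 < Fn k.
  by rewrite /Fn; case: insubP => // i _ _; apply: prodr_gt0 => a _; exact: fact_gt0R.
have fn0 k : fact_R k != 0 by rewrite gt_eqF // fact_gt0R.
have GE (i : 'I_M) : \prod_(d <- nxt i) fact_R (xr r d) = Fn i.+1.
  rewrite /nxt /Fn; case: insubP => [j _ _|_]; rewrite big_map big_enum //=.
  by rewrite big1 // => a _; rewrite fact0.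
rewrite /ratio big_split /= !prod_tvar /=.
have -> : \prod_(i < M) \prod_(a < psum lam i) \prod_(b < psum lam i | b != a)
    (fact_R (r (tv a)) / fact_R (r (tv b))) = 1.
  rewrite big1 // => i _.
  under eq_bigr do rewrite prodf_div.
  rewrite prodf_div (exchange_big_dep xpredT) //=.
  under eq_bigr do under eq_bigl do rewrite eq_sym.
  by rewrite divff //; do 2!apply/prodf_neq0 => ? _; exact: fn0.
rewrite mul1r.
transitivity (\prod_(i < M) (Fn i.+1 ^+ psum lam i / Fn i ^+ psum lam i.+1)).
  apply: eq_bigr => i _.
  transitivity (\prod_(a < psum lam i) (Fn i.+1 / fact_R (r (tv a)) ^+ psum lam i.+1)).
    by apply: eq_bigr => a _; rewrite prodf_div GE prodr_seq_const (size_nxt I).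
  by rewrite prodf_div prodr_const card_ord FnE /F prodrXl.
rewrite (telescope_ratio M Fn0).
have -> : Fn M = 1 by rewrite /Fn insubF // ltnn.
rewrite expr1n mul1r; apply: eq_bigr => i _.
by rewrite FnE /F prodfV prodrXl.
Qed.

(** Where two consecutive blocks are empty, the level below carries the same
    indices, and on the support its shifts are at least as large; the descent
    ends at a non-empty block. *)
Lemma dominating_var r : supported r -> forall v, exists w : tvar,
  (0 < expo (tag w))%N /\ (r v <= r w)%N.
Proof.
move=> sr v; move: {2}(tag v : nat) (erefl (tag v : nat)) => k.
elim: k v => [|k IH] v vk; have [e0|e0] := posnP (expo (tag v)); try by exists v.
  move: e0; rewrite /expo vk subn0 => p1.
  have := psum_le (leqnSn 0); rewrite p1 leqn0 => /eqP p0.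
  by have := leq_ltn_trans (leq0n _) (ltn_ord (tagged v)); rewrite vk p0.
move: e0; rewrite /expo vk => /eqP; rewrite subn_eq0 => p1.
have pE : psum lam k = psum lam k.+1.
  apply/eqP; rewrite eqn_leq psum_le //=; apply: leq_trans p1; exact: psum_le.
have kM : (k < M)%N by rewrite ltnW // -vk ltn_ord.
have uE : upto I k = upto I k.+1.
  apply/eqP; rewrite eqEcard !card_upto pE leqnn andbT.
  by apply/fintype.subsetP => a; rewrite !mem_upto => /leqW.
have := ix_upto I a0 v; rewrite vk -uE -mem_enum.
rewrite -(map_ix I a0 (Ordinal kM)) => /mapP[a _ va].
have [w [ew rw]] := IH (tv a) erefl.
exists w; split=> //; apply: leq_trans rw.
apply: (sr (tv a) (inl v)); last by rewrite /= va.
rewrite /nxt /=; case: insubP => [j _ jE|/negP kM']; last by case: kM'; rewrite -vk.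
have : j = tag v by apply: val_inj; rewrite /= jE vk.
by case: v {vk va} => i b /= ->; apply/mapP; exists b; rewrite ?mem_enum.
Qed.

(** The factorials beat the exponential factor even in the variables on which
    they act with exponent 0, since these are dominated by other ones. *)
Lemma ratio_decay (K : R) : 1 <= K -> exists2 c : R, 0 <= c &
  forall r, supported r ->
    K ^+ (total_shift r).+1 * ratio r <= c * \prod_(v : tvar) (2^-1) ^+ r v.
Proof.
move=> K1; have K0 : 0 <= K by lra.
have K2 : 1 <= 2 * K by lra.
pose N := #|{: tvar}|; pose Q := (2 * K) ^+ N.
have Q1 : 1 <= Q by rewrite exprn_ege1.
have [c c0 Hc] := exp_le_fact Q1.
have c1 : 1 <= c by have := Hc 0%N; rewrite expr0 fact0 divr1.
have Q0 : 0 <= Q := le_trans ler01 Q1.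
exists (K * c ^+ N); first by apply: mulr_ge0 => //; apply: exprn_ge0; exact: ltW.
move=> r sr; rewrite ratioE.
pose Sp := (\sum_(v : tvar | (0 < expo (tag v))%N) r v)%N.
have SN : (total_shift r <= N * Sp)%N.
  rewrite /total_shift /N -sum_nat_const; apply: leq_sum => v _.
  have [w [ew rw]] := dominating_var sr v; apply: (leq_trans rw).
  by rewrite /Sp (bigD1 w) //= leq_addr.
have -> : \prod_(v : tvar) (2^-1 : R) ^+ r v = 2^-1 ^+ total_shift r.
  by rewrite prodrXr.
have half0 : 0 < (2^-1 : R) ^+ total_shift r by rewrite exprn_gt0 // invr_gt0.
(* doubling K leaves a factor 1/2 for each unit of shift *)
have KE : K ^+ total_shift r = (2 * K) ^+ total_shift r * 2^-1 ^+ total_shift r.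
  by rewrite -exprMn mulrAC divff ?mul1r.
rewrite exprS KE.
set P := \prod_(v : tvar) (fact_R (r v) ^- expo (tag v)).
suff : (2 * K) ^+ total_shift r * P <= c ^+ N.
  move: half0; move: (2^-1 ^+ total_shift r) ((2 * K) ^+ total_shift r) P (c ^+ N).
  move=> h A P cN h0 H.
  have -> : K * (A * h) * P = (K * h) * (A * P) by ring.
  have -> : K * cN * h = (K * h) * cN by ring.
  have Kh : 0 <= K * h by apply: mulr_ge0; [exact: K0 | exact: ltW].
  exact: ler_wpM2l Kh _ _ H.
have P0 : 0 <= P.
  by apply: prodr_ge0 => v _; rewrite invr_ge0; apply: exprn_ge0; exact: ler0n.
have QS : (2 * K) ^+ total_shift r <=
    \prod_(v : tvar) (if (0 < expo (tag v))%N then Q ^+ r v else 1).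
  by rewrite -big_mkcond /= prodrXr -exprM ler_weXn2l.
apply: le_trans (ler_wpM2r P0 QS) _.
have -> : c ^+ N = \prod_(v : tvar) c by rewrite prodr_const.
clear QS KE half0 SN; clearbody Q N.
rewrite /P -big_split /=; apply: ler_prod => v _.
have f1 : 1 <= fact_R (r v) by rewrite ler1n fact_gt0.
have fe : 0 < fact_R (r v) ^+ expo (tag v) by rewrite exprn_gt0 // fact_gt0R.
apply/andP; split.
  by apply: mulr_ge0; [case: ifP => // _; exact: exprn_ge0 | rewrite invr_ge0 ltW].
case: posnP => [->|e0]; first by rewrite mul1r expr0 invr1.
apply: le_trans (Hc (r v)); rewrite ler_wpM2l ?exprn_ge0 //.
rewrite lef_pV2 ?posrE ?fact_gt0R // -[leLHS]expr1.
exact: ler_weXn2l.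
Qed.

Lemma res_term_summable : exists s, has_sum res_term s.
Proof.
have [K K1 HK] := ubd_res_term.
have [c c0 Hc] := ratio_decay K1.
apply: (@bounded_has_sum R _ res_term
  (fun r : shifts => c * \prod_(v : tvar) (2^-1) ^+ r v) (c * 2 ^+ #|{: tvar}|)).
  move=> r; have [->|tr] := eqVneq (res_term r) 0.
    rewrite Normc.normc0 mulr_ge0 //; apply: prodr_ge0 => v _.
    by rewrite exprn_ge0 // invr_ge0.
  by apply: (le_trans (HK r).2); apply: Hc; exact: res_term_supported.
move=> D; rewrite -mulr_sumr ler_wpM2l //.
exact: geometric_box_bound.
Qed.

End Convergence.

(** * Products and sums over ordered partitions *)

Section OrderedPairs.
Variables (M n : nat) (lam : 'I_M.+1 -> nat) (K : comPzRingType).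
Variable (I : opart n lam).
Local Notation blk := (blk I).
Implicit Types f : 'I_n -> 'I_n -> K.

Lemma prod_blk (F : 'I_M.+1 -> 'I_n -> K) :
  \prod_j \prod_(a in block I j) F j a = \prod_a F (blk a) a.
Proof.
rewrite [RHS](partition_big blk xpredT) //=; apply: eq_bigr => j _.
by apply: eq_big => [a|a]; rewrite mem_block // => /eqP->.
Qed.

Lemma prod_blocks_lt f :
  \prod_(i < M.+1) \prod_(j < M.+1 | (i < j)%N)
     \prod_(a in block I i) \prod_(b in block I j) f a b
  = \prod_a \prod_(b | (blk a < blk b)%N) f a b.
Proof.
rewrite -(prod_blk (fun i a => \prod_(b | (i < blk b)%N) f a b)).
apply: eq_bigr => i _; rewrite exchange_big /=; apply: eq_bigr => a _.
rewrite [RHS](partition_big blk (fun j : 'I_M.+1 => (i < j)%N)) //=.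
apply: eq_bigr => j ij; apply: eq_bigl => b; rewrite mem_block.
by apply/esym/andb_idl => /eqP->.
Qed.

Lemma prod_levels_lt f :
  \prod_(i < M) \prod_(a in upto I i) \prod_(b in block I (hi i)) f a b
  = \prod_a \prod_(b | (blk a < blk b)%N) f a b.
Proof.
rewrite [RHS](exchange_big_dep xpredT) //=.
rewrite -(prod_blk (fun j b => \prod_(a | (blk a < j)%N) f a b)).
rewrite big_ord_recl [X in X * _]big1 ?mul1r; last first.
  by move=> b _; rewrite big_pred0.
apply: eq_bigr => i _; rewrite exchange_big /=; apply: eq_bigr => b _.
by apply: eq_bigl => a; rewrite mem_upto.
Qed.

Lemma prod_upto (i : 'I_M) (a0 : 'I_n) (F : 'I_n -> K) :
  \prod_(a < psum lam i) F (ix I a0 (tv a)) = \prod_(c in upto I i) F c.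
Proof. by rewrite -[RHS]big_enum -(map_ix I a0) big_map big_enum. Qed.

End OrderedPairs.

Section LevelSums.
Variables (R : realType) (M n : nat) (lam : 'I_M.+1 -> nat) (I : opart n lam).
Local Notation C := (R[i]).

Lemma sum_upto (i : 'I_M) (a0 : 'I_n) (F : 'I_n -> C) :
  \sum_(a < psum lam i) F (ix I a0 (tv a)) = \sum_(c in upto I i) F c.
Proof. by rewrite -[RHS]big_enum -(map_ix I a0) big_map big_enum. Qed.

(** Summation by parts over the levels. *)
Lemma abel_levels (u : 'I_M.+1 -> C) (z : 'I_n -> C) :
  u ord_max * (\sum_a z a) + \sum_(i < M) (u (lo i) - u (hi i)) * (\sum_(a in upto I i) z a)
  = \sum_j u j * \sum_(a in block I j) z a.
Proof.
transitivity (\sum_a u (blk I a) * z a); last first.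
  rewrite [LHS](partition_big (blk I) xpredT) //=; apply: eq_bigr => j _.
  rewrite mulr_sumr; apply: eq_big => [a|a]; first by rewrite mem_block.
  by move=> /eqP->.
rewrite mulr_sumr.
have -> : \sum_(i < M) (u (lo i) - u (hi i)) * (\sum_(a in upto I i) z a) =
    \sum_a (\sum_(i < M | (blk I a <= i)%N) (u (lo i) - u (hi i))) * z a.
  under eq_bigr do rewrite mulr_sumr.
  rewrite (exchange_big_dep xpredT) //=; apply: eq_bigr => a _.
  by rewrite mulr_suml; apply: eq_bigl => i; rewrite mem_upto.
rewrite -big_split /=; apply: eq_bigr => a _; rewrite -mulrDl; congr (_ * _).
pose w k := u (inord k).
have -> : \sum_(i < M | (blk I a <= i)%N) (u (lo i) - u (hi i)) =
    \sum_(i < M | (blk I a <= i)%N) (w i - w i.+1).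
  apply: eq_bigr => i _; congr (u _ - u _); apply: val_inj; rewrite /= inordK //.
    by rewrite ltnS ltnW.
  by rewrite ltnS.
have -> : \sum_(i < M | (blk I a <= i)%N) (w i - w i.+1) =
    \sum_(blk I a <= i < M) (w i - w i.+1).
  by rewrite big_geq_mkord.
under eq_bigr do rewrite -opprB.
rewrite sumrN telescope_sumr; last by rewrite -ltnS.
rewrite opprB addrC /w inord_val (_ : inord M = ord_max) ?subrK //.
by apply: val_inj; rewrite /= inordK.
Qed.

End LevelSums.

Section FixedPoints.
Variables (R : realType) (M n : nat) (lam : 'I_M.+1 -> nat).
Local Notation C := (R[i]).
Variables (z : 'I_n -> C).
Hypothesis z_dom : forall a b : 'I_n, a != b -> ~ is_int (z a - z b).

Lemma z_inj : injective z.
Proof.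
move=> a b zab; apply/eqP/negPn/negP => /z_dom; apply.
by rewrite zab subrr; exists 0.
Qed.

Lemma map_fixed_point (J : opart n lam) i :
  [seq @fixed_point R M n lam z J i a | a <- enum 'I_(lam i)] =
  [seq z c | c <- enum (block J i)].
Proof.
have sz : size [seq z c | c <- enum (block J i)] = lam i.
  by rewrite size_map -cardE card_block.
apply: (@eq_from_nth _ 0); first by rewrite size_map size_enum_ord sz.
rewrite size_map size_enum_ord => k kp.
by rewrite (nth_map (Ordinal kp)) ?size_enum_ord // /fixed_point nth_enum_ord.
Qed.

Lemma prod_fixed_point (J : opart n lam) i (f : C -> C) :
  \prod_(a < lam i) f (@fixed_point R M n lam z J i a) = \prod_(c in block J i) f (z c).
Proof.
rewrite -[LHS]big_enum -[RHS]big_enum /=.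
by rewrite -(big_map z xpredT f) -map_fixed_point big_map.
Qed.

Lemma c1_fixed_point (J : opart n lam) i :
  c1 (@fixed_point R M n lam z J) i = \sum_(c in block J i) z c.
Proof.
rewrite /c1 -[LHS]big_enum -[RHS]big_enum /=.
by rewrite -(big_map z xpredT id) -map_fixed_point big_map.
Qed.

Lemma blk_inj (I J : opart n lam) : blk I =1 blk J -> I = J.
Proof.
move=> E; apply: val_inj; apply/ffunP => j; apply/setP => a.
by rewrite -!/(block _ _) !mem_block E.
Qed.

Lemma sum_blk (I : opart n lam) : (\sum_a blk I a = \sum_(j < M.+1) j * lam j)%N.
Proof.
rewrite (partition_big (blk I) xpredT) //=; apply: eq_bigr => j _.
rewrite (eq_bigr (fun=> j : nat)); last by move=> a /eqP->.
rewrite sum_nat_const mulnC -(card_block I); congr (_ * _)%N.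
by apply: eq_card => a; rewrite mem_block.
Qed.

(** As the blocks have prescribed sizes, the block numbers in I and in J have the
    same sum; hence those in I cannot all be at least as large as those in J,
    unless they are all equal. *)
Lemma blk_lt (I J : opart n lam) : I <> J -> exists c, (blk I c < blk J c)%N.
Proof.
move=> IJ; have [/existsP//|] := boolP [exists c, (blk I c < blk J c)%N].
rewrite negb_exists => /forallP H; exfalso; apply: IJ; apply: blk_inj => c.
have JI a : (blk J a <= blk I a)%N by have := H a; rewrite -leqNgt.
apply/eqP; rewrite -val_eqE /= eqn_leq JI andbT leqNgt; apply/negP => lt.
have := sum_blk I; rewrite -(sum_blk J) (bigD1 c) //= [RHS](bigD1 c) //= => E.
have S : (\sum_(a | a != c) blk J a <= \sum_(a | a != c) blk I a)%N by apply: leq_sum.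
by have := leq_add lt S; rewrite addSn E ltnn.
Qed.

End FixedPoints.

(** * The leading term *)

Section LeadingTerm.
Variables (R : realType) (M n : nat) (lam : 'I_M.+1 -> nat).
Local Notation C := (R[i]).
Local Notation tvar := (tvar lam).
Local Notation nxt := (nxt n lam).
Local Notation shifts := ({ffun tvar -> nat}).
Variables (logk : C) (z : 'I_n -> C).
Hypothesis logkE : Cexp logk = 1.
Hypothesis z_dom : forall a b : 'I_n, a != b -> ~ is_int (z a - z b).
Variables (I : opart n lam) (a0 : 'I_n).
Local Notation ix := (ix I a0).
Local Notation xix := (xix I a0).
Local Notation sh := (shifted 1 z I).

(** The part of a residue that depends neither on the p_i nor on logk. *)
Definition core (r : shifts) : C :=
  \prod_(v : tvar) ((\prod_(b < psum lam (tag v) | b != tagged v)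
              (Gamma (sh r (tv b) - sh r v))^-1)
            * \prod_(d <- nxt (tag v)) gfac z I a0 r predT v d (sh r)).

Definition level_shift (r : shifts) : {ffun 'I_M -> nat} :=
  [ffun i : 'I_M => (\sum_(a < psum lam i) r (tv a))%N].

Definition sgn_fac (i : 'I_M) : C :=
  Cexp (pi_i R * ((lam (lo i))%:R - (lam (hi i))%:R)).

Definition phase : C :=
  \prod_(j < M.+1) Cexp (pi_i R * ((lam j)%:R - n%:R) * (\sum_(a in block I j) z a)).

Lemma Cexp_Lfac logp i :
  Cexp (Lfac lam logk logp i) = sgn_fac i * (Cexp (logp (lo i)) / Cexp (logp (hi i))).
Proof.
by rewrite /Lfac !CexpD !CexpN CexpMn logkE expr1n invr1 mulr1.
Qed.

(** All the dependence on the p_i, apart from the powers of their ratios,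
    sums up by parts to the leading factor. *)
Lemma PhiP_split logp r :
  Cpow logk (\sum_(i < M) \sum_(a in upto I i) (lam (lo i) + lam (hi i))%:R * z a / 1)
  * PhiP logk z logp I a0 r predT (sh r)
  = lead_factor 1 z logp I * (phase
    * \prod_(i < M) (sgn_fac i * (Cexp (logp (lo i)) / Cexp (logp (hi i))))
                      ^+ level_shift r i * core r).
Proof.
pose u j := pi_i R * ((lam j)%:R - n%:R) + logp j.
pose Z (i : 'I_M) := \sum_(a in upto I i) z a.
rewrite /PhiP -/(core r).
have -> : \prod_(v : tvar) Cexp (sh r v * Lfac lam logk logp (tag v)) =
  Cexp (\sum_(i < M) Z i * Lfac lam logk logp i) *
  \prod_(i < M) (sgn_fac i * (Cexp (logp (lo i)) / Cexp (logp (hi i)))) ^+ level_shift r i.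
  rewrite prod_tvar Cexp_sum -big_split /=; apply: eq_bigr => i _.
  rewrite -Cexp_Lfac ffunE -prodrXr /Z -(sum_upto I i a0) mulr_suml Cexp_sum -big_split /=.
  by apply: eq_bigr => a _; rewrite (shiftedE z I a0) mulrDl CexpD CexpMn.
have EL : lead_factor 1 z logp I * phase = Cexp (\sum_j u j * \sum_(a in block I j) z a).
  rewrite /lead_factor /phase -big_split Cexp_sum; apply: eq_bigr => j _ /=.
  by rewrite /Cpow divr1 -CexpD; congr Cexp; rewrite /u; ring.
have ET : Cpow logk (\sum_(i < M) \sum_(a in upto I i) (lam (lo i) + lam (hi i))%:R * z a / 1)
    * (topfac lam z logp * Cexp (\sum_(i < M) Z i * Lfac lam logk logp i))
    = Cexp (\sum_j u j * \sum_(a in block I j) z a).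
  rewrite -abel_levels /topfac /Cpow -!CexpD; congr Cexp.
  rewrite mulr_suml addrCA -big_split /=; congr (_ + _); first by rewrite mulrC.
  apply: eq_bigr => i _; under eq_bigr do rewrite divr1.
  by rewrite -mulr_sumr -/(Z i) /Lfac /u; ring.
move: EL ET; move: (Cpow logk _) (topfac _ _ _) (Cexp (\sum_(i < M) _)) (Cexp (\sum_j _)).
move: (lead_factor _ _ _ _) phase (\prod_(i < M) _) (core r) => l ph X c a t e f <- H.
by rewrite !mulrA -H; ring.
Qed.

Definition fiber (d : {ffun 'I_M -> nat}) : seq shifts :=
  [seq r <- box tvar (\sum_i d i).+1 | level_shift r == d].

Lemma fiber_uniq d : uniq (fiber d).
Proof. by rewrite filter_uniq // box_uniq. Qed.

Lemma mem_fiber d r : (r \in fiber d) = (level_shift r == d).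
Proof.
rewrite mem_filter; apply: andb_idr => /eqP <-; apply: mem_box => -[i a].
rewrite ltnS (bigD1 i) //= ffunE (bigD1 a) //= -addnA; exact: leq_addr.
Qed.

Lemma fiber0 : perm_eq (fiber [ffun=> 0%N]) [:: [ffun=> 0%N]].
Proof.
apply: uniq_perm => //; first exact: fiber_uniq.
move=> r; rewrite mem_fiber inE; apply/eqP/eqP => [H|->]; last first.
  by apply/ffunP => i; rewrite !ffunE big1 // => a _; rewrite ffunE.
apply/ffunP => -[i a]; rewrite ffunE.
have := congr1 (fun f : {ffun 'I_M -> nat} => f i) H; rewrite !ffunE (bigD1 a) //= => /eqP.
by rewrite addn_eq0 => /andP[/eqP].
Qed.

Definition coeff (d : {ffun 'I_M -> nat}) : class R n lam := fun J =>
  (- 1) ^- (lam_up1 lam + lam_low2 lam) * phase * (\prod_(i < M) sgn_fac i ^+ d i)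
  * \sum_(r <- fiber d) core r * What (sh r) (@fixed_point R M n lam z J).

Lemma lead_factor_neq0 logp : lead_factor 1 z logp I != 0.
Proof. by apply/prodf_neq0 => i _; exact: Cexp_neq0. Qed.

(** The residues with given level shifts are finite in number and carry the same
    powers of the p_i, so that the convergent sum of residues regroups into a
    power series in the ratios. *)
Lemma Psi_series logp (J : opart n lam) : exists2 S : C,
  has_sum (fun d : {ffun 'I_M -> nat} => coeff d J *
    \prod_(i < M) (Cexp (logp (lo i)) / Cexp (logp (hi i))) ^+ d i) S
  & Psi 1 logk z logp I (@fixed_point R M n lam z J) = lead_factor 1 z logp I * S.
Proof.
pose g := @fixed_point R M n lam z J; pose lead := lead_factor 1 z logp I.
pose PF := (- 1) ^- (lam_up1 lam + lam_low2 lam) * Cpow logk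
  (\sum_(i < M) \sum_(a in upto I i) (lam (lo i) + lam (hi i))%:R * z a / 1).
have [s hs] := res_term_summable logk logp z_dom I a0 g.
have lead0 : lead != 0 by exact: lead_factor_neq0.
exists (lead^-1 * (PF * s)); last first.
  rewrite mulVKf // /PF /Psi; congr (_ * _).
  have -> : (fun r : shifts => iter_res (tvars lam) (Phi 1 logk z logp) (sh r) (sh r)
       * What (sh r) g) = res_term logk z logp I a0 g.
    by apply/funext => r; rewrite (iter_resE logk logp z_dom I a0).
  exact: Csum_has_sum.
have := has_sumZ (c := lead^-1) (has_sumZ (c := PF) hs).
move=> /(has_sum_fibers fiber_uniq mem_fiber); apply: has_sum_ext => d.
rewrite /coeff mulr_sumr mulr_suml; apply: eq_big_seq => r.
rewrite mem_fiber => /eqP rd; have := PhiP_split logp r.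
rewrite -/lead rd (eq_bigr _ (fun i _ => exprMn _ _ _)) big_split /res_term /PF /=.
move: lead0; move: lead (Cpow logk _) (PhiP _ _ _ _ _ _ _ _) (core r) (What _ _) phase.
move: (\prod_(i < M) sgn_fac i ^+ d i) (\prod_(i < M) _) (_ ^- _).
move=> x y s' l c P k w ph l0 E.
have -> : l^-1 * (s' * c * (P * w)) = l^-1 * s' * w * (c * P) by ring.
by rewrite E; field.
Qed.

(** * The constant term *)

Local Notation r0 := ([ffun=> 0%N] : shifts).

Lemma shifted0 v : sh r0 v = z (ix v).
Proof. by rewrite (shiftedE z I a0) ffunE addr0. Qed.

Lemma prod_nxt (F : 'I_n -> C) (i : 'I_M) :
  \prod_(d <- nxt i) F (xix d) = \prod_(c in upto I i.+1) F c.
Proof. by rewrite -(big_map xix xpredT F) map_xix big_enum. Qed.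

Lemma Gamma_diff_neq0 a b : a != b -> Gamma (z a - z b) != 0.
Proof. by move=> /z_dom zab; apply: Gamma_neq0 => /gpole_int. Qed.

(** The inverse Gamma factors inside a level cancel the factors that join it to
    the same indices of the next level; what is left are the factors for the
    block that the next level adds, and the residue -1 of the singular one. *)
Lemma core0 : core r0 =
  \prod_(i < M) \prod_(a in upto I i) (- \prod_(c in block I (hi i)) Gamma (z c - z a)).
Proof.
rewrite /core prod_tvar; apply: eq_bigr => i _.
rewrite -(prod_upto I i a0); apply: eq_bigr => a _ /=.
set x := ix (tv a); have xu : x \in upto I i by exact: (ix_upto I a0 (tv a)).
have -> : \prod_(d <- nxt i) gfac z I a0 r0 predT (tv a) d (sh r0) =
    \prod_(c in upto I i.+1) (if c == x then -1 else Gamma (z c - z x)).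
  rewrite -prod_nxt; apply: eq_bigr => d _; rewrite /gfac /= shifted0 -/x.
  have d0 : xr r0 d = 0%N by case: (d) => [v|//]; rewrite /xr ffunE.
  rewrite d0 ffunE (xval_shifted z I a0) d0 addr0.
  by rewrite /gres /= fact0 divr1 expr1.
have -> : \prod_(b < psum lam i | b != a) (Gamma (sh r0 (tv b) - sh r0 (tv a)))^-1
    = (\prod_(c in upto I i | c != x) Gamma (z c - z x))^-1.
  rewrite -prodfV big_mkcondr /= -(prod_upto I i a0) big_mkcond /=.
  apply: eq_bigr => b _; rewrite !shifted0 -/x.
  by rewrite /x (inj_eq (@ix_inj _ _ _ I a0 i)).
have xu1 : x \in upto I i.+1 by rewrite mem_upto leqW // -mem_upto.
have -> : \prod_(c in upto I i.+1) (if c == x then -1 else Gamma (z c - z x)) =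
    -1 * \prod_(c in upto I i.+1 | c != x) Gamma (z c - z x).
  rewrite (bigD1 x xu1) /= eqxx; congr (_ * _).
  by apply: eq_bigr => c /andP[_ /negPf->].
rewrite mulN1r mulrN; congr (- _).
rewrite [X in _ * X](bigID (mem (upto I i))) /= mulrA.
have -> : \prod_(c | (c \in upto I i.+1) && (c != x) && (c \in upto I i)) Gamma (z c - z x)
   = \prod_(c in upto I i | c != x) Gamma (z c - z x).
  apply: eq_bigl => c; rewrite andbAC; congr (_ && _).
  by apply: andb_idl; rewrite !mem_upto => /leqW.
rewrite mulVf ?mul1r; last by apply/prodf_neq0 => c /andP[_]; exact: Gamma_diff_neq0.
apply: eq_bigl => c; rewrite !mem_upto mem_block -ltnNge.
have -> : (blk I c == hi i) = (blk I c == i.+1 :> nat) by [].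
move: xu; rewrite mem_upto; case: (eqVneq c x) => [->|_] /=; last by lia.
by lia.
Qed.

Lemma What0 J : What (sh r0) (@fixed_point R M n lam z J) =
  \prod_(i < M) \prod_(a in upto I i) \prod_(c in block J (hi i)) (z a - z c).
Proof.
apply: eq_bigr => i _; rewrite -(prod_upto I i a0); apply: eq_bigr => a _.
rewrite (prod_fixed_point z J (hi i) (fun w => sh r0 (tv a) - w)).
by apply: eq_bigr => c _; rewrite shifted0.
Qed.

Lemma gamma_class_fixed J : gamma_class (@fixed_point R M n lam z J) =
  \prod_a \prod_(c | (blk J a < blk J c)%N) Gamma (1 + z c - z a).
Proof.
rewrite -(prod_blocks_lt J (fun a c => Gamma (1 + z c - z a))).
apply: eq_bigr => i _; apply: eq_bigr => j _.
rewrite -(prod_fixed_point z J i (fun x => \prod_(c in block J j) Gamma (1 + z c - x))).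
apply: eq_bigr => a _.
by rewrite -(prod_fixed_point z J j (fun y => Gamma (1 + y - _))).
Qed.

Lemma sign_low2 : \prod_a \prod_(c | (blk I a < blk I c)%N) (-1 : C) =
  (-1) ^+ lam_low2 lam.
Proof.
rewrite -(prod_blocks_lt I (fun _ _ => -1)) /lam_low2 -prodrXr; apply: eq_bigr => i _.
rewrite -prodrXr; apply: eq_bigr => j _.
by rewrite !prodr_const !card_block -exprM mulnC.
Qed.

(** Each linear factor of the weight function turns Gamma(z_c - z_a) into
    Gamma(1 + z_c - z_a). *)
Lemma core_What0 : core r0 * What (sh r0) (@fixed_point R M n lam z I) =
  (-1) ^+ (lam_up1 lam + lam_low2 lam) * gamma_class (@fixed_point R M n lam z I).
Proof.
have S : (-1) ^+ lam_low2 lam * gamma_class (@fixed_point R M n lam z I) =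
  \prod_(i < M) \prod_(a in upto I i) \prod_(c in block I (hi i)) (-1 * Gamma (1 + z c - z a)).
  rewrite gamma_class_fixed -sign_low2 -big_split.
  rewrite (prod_levels_lt I (fun a c => -1 * Gamma (1 + z c - z a))).
  by apply: eq_bigr => a _; rewrite -big_split.
rewrite core0 What0 exprD -mulrA S.
rewrite /lam_up1 -prodrXr -!big_split /=; apply: eq_bigr => i _.
rewrite -(card_upto I) -prodr_const -!big_split /=; apply: eq_bigr => a ai.
rewrite mulNr mulN1r -big_split /=; congr (- _); apply: eq_bigr => c ci.
have ca : z c - z a != 0.
  rewrite subr_eq0; apply/eqP => /(z_inj z_dom) ca.
  by move: ai ci; rewrite ca mem_upto mem_block => + /eqP e; rewrite e ltnn.
have -> : 1 + z c - z a = z c - z a + 1 by ring.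
by rewrite GammaS //; ring.
Qed.

Lemma Delta_diag : Delta z I (@fixed_point R M n lam z I) = 1.
Proof.
rewrite /Delta; set num := (X in X / _); set den := (X in _ / X).
have -> : num = den.
  apply: eq_bigr => i _; apply: eq_bigr => j _.
  by rewrite (prod_fixed_point z I i (fun x => \prod_(b in block I j) (x - z b))).
rewrite divff //; apply/prodf_neq0 => i _; apply/prodf_neq0 => j ij.
apply/prodf_neq0 => a ai; apply/prodf_neq0 => b bj.
rewrite subr_eq0; apply/eqP => /(z_inj z_dom) ab.
by move: ai bj ij; rewrite ab !mem_block => /eqP-> /eqP->; rewrite ltnn.
Qed.

Lemma Delta_off J : J <> I -> Delta z I (@fixed_point R M n lam z J) = 0.
Proof.
move=> /blk_lt[c cJI]; rewrite /Delta; apply/eqP; rewrite mulf_eq0; apply/orP; left.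
rewrite (bigD1 (blk J c)) //= (bigD1 (blk I c)) //=.
rewrite (prod_fixed_point z J _ (fun x => \prod_(b in block I (blk I c)) (x - z b))).
rewrite (bigD1 c) ?mem_block //= (bigD1 c) ?mem_block //=.
by rewrite subrr !mul0r.
Qed.

(** An element that lies earlier in I than in J is a common zero of a linear
    factor of the weight function; blk_lt also gives one that lies later, on
    which Delta vanishes. *)
Lemma What_off J : J <> I -> What (sh r0) (@fixed_point R M n lam z J) = 0.
Proof.
move=> JI; have [c cIJ] := blk_lt (nesym JI).
have iM : ((blk J c).-1 < M)%N by have := ltn_ord (blk J c); lia.
pose i := Ordinal iM.
have ci : blk J c = hi i by apply: val_inj; rewrite /= /bump /=; lia.
rewrite What0 (bigD1 i) //= (bigD1 c) ?mem_upto /=; last by lia.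
by rewrite (bigD1 c) ?mem_block ?ci //= subrr !mul0r.
Qed.

Lemma leading_coeff logp (J : opart n lam) :
  gamma_class (@fixed_point R M n lam z J)
  * \prod_(i < M.+1) Cpow (pi_i R * ((lam i)%:R - n%:R) + logp i)
      (c1 (@fixed_point R M n lam z J) i)
  * Delta z I (@fixed_point R M n lam z J)
  = lead_factor 1 z logp I * coeff [ffun=> 0%N] J.
Proof.
rewrite /coeff (perm_big _ fiber0) big_seq1.
have [->|/eqP JI] := eqVneq J I; last first.
  by rewrite Delta_off // What_off // !mulr0.
rewrite Delta_diag core_What0 mulr1.
have -> : \prod_(i < M) sgn_fac i ^+ ([ffun=> 0%N] : {ffun 'I_M -> nat}) i = 1.
  by rewrite big1 // => i _; rewrite ffunE.
have -> : \prod_(i < M.+1) Cpow (pi_i R * ((lam i)%:R - n%:R) + logp i)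
      (c1 (@fixed_point R M n lam z I) i) = lead_factor 1 z logp I * phase.
  rewrite /lead_factor /phase -big_split; apply: eq_bigr => i _ /=.
  rewrite c1_fixed_point /Cpow divr1 -CexpD; congr Cexp; ring.
have s0 : (-1) ^+ (lam_up1 lam + lam_low2 lam) != 0 :> C by rewrite signr_eq0.
by field.
Qed.

End LeadingTerm.

Theorem theoremB2 (R : realType) (M n : nat) (lam : 'I_M.+1 -> nat)
    (n_gt0 : (0 < n)%N) (lam_sum : (\sum_(i < M.+1) lam i = n)%N)
    (kappa logk : R[i]) (kappa1 : kappa = 1) (logkE : Cexp logk = kappa)
    (z : 'I_n -> R[i])
    (z_dom : forall a b : 'I_n, a != b ->
       forall m : int, z a - z b <> kappa * m%:~R)
    (I : opart n lam) :
  has_leading_term kappa z I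
    (fun logp => Cls z (fun g => Psi kappa logk z logp I g))
    (fun logp => Cls z (fun g =>
       gamma_class g
       * \prod_(i < M.+1)
           Cpow (pi_i R * ((lam i)%:R - n%:R) + logp i) (c1 g i)
       * Delta z I g)).
Proof.
subst kappa.
have zd (a b : 'I_n) : a != b -> ~ is_int (z a - z b).
  by move=> ab [m zab]; apply: (z_dom a b ab m); rewrite mul1r.
pose a0 := Ordinal n_gt0.
exists (coeff z I a0) => p logp pE J; split; last exact: leading_coeff.
have -> : p = fun i => Cexp (logp i) by apply/funext => i; rewrite pE.
exact: Psi_series.
Qed.
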